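(* Let $\mathcal{X}=\bigcap_{n\in\mathbb{N}}\ell^{p_n}_{\omega_n}(\mathbb{Z},\mathcal{A})$ be an algebra of Type-I, where $\{p_n\}_{n\in\mathbb{N}}$ is a decreasing sequence in $(1,\infty)$, $\{\omega_n\}_{n\in\mathbb{N}}$ is a family of weights on $\mathbb{Z}$ with $\omega_n\le\omega_{n+1}$ for all $n$, and $\omega_n$ is a $p_n$-almost monotone algebra weight for all $n\in\mathbb{N}$. In addition, assume that all $\omega_n$ are admissible or none of them are. If $f\in\mathcal{X}$ is such that $\widehat f(z)$ is left invertible (respectively, right invertible, invertible) in $\mathcal{A}$ for all $z\in\mathbb{T}$, then there exists a family of weights $\{\nu_n\}_{n\in\mathbb{N}}$ on $\mathbb{Z}$ such that for all $n\in\mathbb{N}$: (1) $\nu_n\le K_n\omega_n$ for some $K_n>1$; (2) $\nu_n$ is a $p_n$-almost monotone algebra weight; (3) $\nu_n$ is admissible (nonadmissible) if $\omega_n$ is admissible (nonadmissible); (4) $\nu_n\le\nu_{n+1}$; and (5) a left inverse (respectively, right inverse, inverse) of $f$ is in $\bigcap_{n\in\mathbb{N}}\ell^{p_n}_{\nu_n}(\mathbb{Z},\mathcal{A})$, which is an algebra of Type-I. Moreover, $\mathcal{X}$ is inverse-closed if and only if $\omega_n$ is an admissible $p_n$-almost monotone algebra weight for all $n\in\mathbb{N}$.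
   Context: $\mathbb{N}$ is the set of positive integers, $\mathbb{N}_0=\mathbb{N}\cup\{0\}$, and $\mathbb{T}$ the unit circle in $\mathbb{C}$. $\mathcal{A}$ is a complex unital Banach algebra, not necessarily commutative, with norm $\|\cdot\|$ and unit $1_{\mathcal A}$. A weight on $\mathbb{Z}$ is a map $\omega:\mathbb{Z}\to[1,\infty)$ with $\omega(x+y)\le\omega(x)\omega(y)$; inequalities between weights are pointwise. Put $\rho_{1,\omega}=\sup\{\omega(n)^{1/n}:n<0\}\le1\le\rho_{2,\omega}=\inf\{\omega(n)^{1/n}:n>0\}$. A weight $\omega$ on $\mathbb{Z}$ is admissible if $\lim_{n\to\infty}\omega(nk)^{1/n}=1$ for all $k\in\mathbb{Z}$, equivalently $\rho_{1,\omega}=1=\rho_{2,\omega}$; otherwise it is nonadmissible. For $1<p<\infty$ with conjugate index $p'$ ($\frac1p+\frac1{p'}=1$), a weight $\omega$ on $\mathbb{Z}$ is a $p$-almost monotone algebra weight if: (i) $\omega^{-p'}\star\omega^{-p'}\le\omega^{-p'}$ and $\sum_{n\in\mathbb{Z}}\omega(n)^{-p'}<\infty$; (ii) if $\rho_{1,\omega}=1$, then there is a constant $K>0$ such that $\omega(n)\le K\omega(n+k)$ for all $n,k$ with $-n,-k\in\mathbb{N}$; (iii) if $\rho_{2,\omega}=1$, then there is a constant $K>0$ such that $\omega(n)\le K\omega(n+k)$ for all $n,k\in\mathbb{N}_0$. Here $\star$ is convolution on $\mathbb{Z}$. $\ell^p_\omega(\mathbb{Z},\mathcal{A})=\{f:\mathbb{Z}\to\mathcal{A}:\sum_n\|f(n)\|^p\omega(n)^p<\infty\}$;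 for $p>1$ and $\omega$ a $p$-almost monotone algebra weight it is an algebra under convolution $(f\star g)(n)=\sum_mf(n-m)g(m)$ with unit $\delta_0$ ($\delta_0(0)=1_{\mathcal A}$, zero elsewhere), contained in $\ell^1(\mathbb{Z},\mathcal{A})$. $\widehat f(z)=\sum_{n\in\mathbb{Z}}f(n)z^n$, $z\in\mathbb{T}$. Inverses of $f$ are with respect to convolution. ''Algebra of Type-I'' here means an intersection $\bigcap_n\ell^{p_n}_{\omega_n}(\mathbb{Z},\mathcal{A})$ with $\{p_n\}$ decreasing (not necessarily strictly) in $(1,\infty)$ and weights $\omega_n\le\omega_{n+1}$ for all $n$. A subalgebra $\mathcal{X}$ of $\ell^1(\mathbb{Z},\mathcal{A})$ is inverse-closed if every $f\in\mathcal{X}$ that is invertible in $\ell^1(\mathbb{Z},\mathcal{A})$ is invertible in $\mathcal{X}$ (equivalently, if $f\in\mathcal{X}$ and $\widehat f(z)$ is invertible for all $z\in\mathbb{T}$, then $f$ is invertible in $\mathcal{X}$). *)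

(* Defs.v *)
From HB Require Import structures.
From mathcomp Require Import all_boot all_order all_algebra.
From mathcomp Require Import all_classical all_reals all_analysis.
From mathcomp Require Export complex.

Set Implicit Arguments.
Unset Strict Implicit.
Unset Printing Implicit Defensive.
Import Order.TTheory GRing.Theory Num.Theory.
Import numFieldNormedType.Exports.
Local Open Scope classical_set_scope.
Local Open Scope ring_scope.

(* Unital, not necessarily commutative Banach algebras over [K]. The product is
   a field of the mixin because HB cannot join [GRing.Algebra] with a normed
   module (the join would compete with [Num.NumDomain], which is declared
   earlier). The unit is required to be nonzero, but not to have norm 1. *)
HB.mixin Record NormedModule_isBanachAlgebra (K : numFieldType) A
    of CompleteNormedModule K A := {
  bone : A;
  bmul : A -> A -> A;
  bmulA : associative bmul;
  bmul1l : left_id bone bmul;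
  bmul1r : right_id bone bmul;
  bmulDl : left_distributive bmul +%R;
  bmulDr : right_distributive bmul +%R;
  bmulZl : forall (c : K) (x y : A), bmul (c *: x) y = c *: bmul x y;
  bmulZr : forall (c : K) (x y : A), bmul x (c *: y) = c *: bmul x y;
  bone_neq0 : bone != 0;
  norm_bmul : forall x y : A, `|bmul x y| <= `|x| * `|y|
}.

#[short(type="banachAlgType")]
HB.structure Definition BanachAlgebra (K : numFieldType) :=
  {A of CompleteNormedModule K A & NormedModule_isBanachAlgebra K A}.

Section Weights.
Context {R : realType}.
Implicit Types (p : R) (w : int -> R).

Definition weight w : Prop :=
  (forall n, 1 <= w n) /\ (forall m n, w (m + n) <= w m * w n).

Definition weight_le (w w' : int -> R) : Prop := forall n, w n <= w' n.

Definition rho1 w : R := sup [set w n `^ (n%:~R)^-1 | n in [set n : int | n < 0]].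

Definition rho2 w : R := inf [set w n `^ (n%:~R)^-1 | n in [set n : int | 0 < n]].

Definition admissible w : Prop :=
  forall k : int, (fun n : nat => w (n%:Z * k) `^ (n%:R)^-1) @ \oo --> (1 : R).

Definition nonadmissible w : Prop := ~ admissible w.

(* The solution p' of 1/p + 1/p' = 1. *)
Definition conjugate_index p : R := (1 - p^-1)^-1.

(* Convolution of nonnegative functions on Z, with values in [0, +oo]. *)
Definition nonneg_conv (u v : int -> R) (n : int) : \bar R :=
  \esum_(m in [set: int]) (u (n - m) * v m)%:E.

Definition almost_monotone_algebra_weight p w : Prop :=
  let u n := w n `^ (- conjugate_index p) in
  [/\ weight w,
      (forall n, (nonneg_conv u u n <= (u n)%:E)%E)
        /\ (\esum_(n in [set: int]) (u n)%:E < +oo)%E,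
      rho1 w = 1 -> exists2 K : R, 0 < K &
        forall n k : int, n < 0 -> k < 0 -> w n <= K * w (n + k)
    & rho2 w = 1 -> exists2 K : R, 0 < K &
        forall n k : int, 0 <= n -> 0 <= k -> w n <= K * w (n + k)].

(* The families (p_n), (w_n) allowed in an algebra of Type-I. *)
Definition type_I (p : nat -> R) (w : nat -> int -> R) : Prop :=
  [/\ forall n, 1 < p n,
      forall n, p n.+1 <= p n,
      forall n, weight (w n)
    & forall n, weight_le (w n) (w n.+1)].

Definition controlled_weights (p : nat -> R) (w nu : nat -> int -> R) : Prop :=
  forall n,
    [/\ exists2 K : R, 1 < K & weight_le (nu n) (fun k => K * w n k),
        almost_monotone_algebra_weight (p n) (nu n),
        admissible (w n) -> admissible (nu n),
        nonadmissible (w n) -> nonadmissible (nu n)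
      & weight_le (nu n) (nu n.+1)].

End Weights.

Section Algebras.
Context {R : realType} {A : banachAlgType R[i]}.
Implicit Types (f g : int -> A) (X : set (int -> A)).

(* The norm of [A] takes its (real) values in the scalar field R[i]. *)
Definition rnorm (a : A) : R := complex.Re `|a|.

(* Sum of a two-sided series, as the sum of its two one-sided halves. *)
Definition zsum (F : int -> A) : A :=
  limn (series (fun k : nat => F k%:Z))
  + limn (series (fun k : nat => F (- k.+1%:Z))).

Definition conv f g (n : int) : A := zsum (fun m => bmul (f (n - m)) (g m)).

Definition delta0 (n : int) : A := if n == 0 then bone else 0.

Definition fourier f (z : R[i]) : A := zsum (fun n => z ^ n *: f n).

Definition l1 : set (int -> A) :=
  [set f | (\esum_(n in [set: int]) (rnorm (f n))%:E < +oo)%E].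

Definition lpw (p : R) (w : int -> R) : set (int -> A) :=
  [set f | (\esum_(n in [set: int]) (rnorm (f n) `^ p * w n `^ p)%:E < +oo)%E].

Definition lpw_cap (p : nat -> R) (w : nat -> int -> R) : set (int -> A) :=
  \bigcap_n lpw (p n) (w n).

Definition l1_subalgebra X : Prop :=
  [/\ X `<=` l1,
      X delta0,
      forall f g, X f -> X g -> X (fun n => f n + g n),
      forall (c : R[i]) f, X f -> X (fun n => c *: f n)
    & forall f g, X f -> X g -> X (conv f g)].

Definition conv_left_inverse f g : Prop := conv g f = delta0.

Definition conv_right_inverse f g : Prop := conv f g = delta0.

Definition conv_inverse f g : Prop :=
  conv_left_inverse f g /\ conv_right_inverse f g.

Definition inverse_closed X : Prop :=
  l1_subalgebra X /\
  forall f, X f -> (exists2 g, l1 g & conv_inverse f g) ->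
    exists2 g, X g & conv_inverse f g.

Definition left_invertible (a : A) : Prop := exists b, bmul b a = bone.

Definition right_invertible (a : A) : Prop := exists b, bmul a b = bone.

Definition invertible (a : A) : Prop := exists b, bmul b a = bone /\ bmul a b = bone.

Definition type_I_algebra (p : nat -> R) (w : nat -> int -> R) : Prop :=
  type_I p w /\ l1_subalgebra (lpw_cap p w).

End Algebras.

Arguments l1_subalgebra {R} A X.
Arguments lpw_cap {R} A p w.
Arguments type_I_algebra {R} A p w.

(* Main.v *)
(* Truncating a left inverse [h] of [f] in l1 to finite support gives [h * f = delta0 - u]
   with [u] in the given intersection of weighted spaces and of small l1 norm, so the
   theorem reduces to two facts.

   Wiener's lemma for one-sided inverses. Work modulo the left ideal of [f], with [tau]
   the shift. Left invertibility of [fourier f z] yields [g_z] with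
   [delta0 = (tau - z) g_z], locally Lipschitz in [z], uniformly by compactness of the
   circle. Let S, S' be the sums of [z g_z] over the n-th roots of 1 and of -1; then
   (tau^n - 1) S = n delta0 and (tau^n + 1) S' = - n delta0, so
   (tau^(2n) - 1) (S - S') = 2 n tau^n delta0 while S - S' is bounded in n. Dividing by 2n
   makes [delta0] congruent to elements of arbitrarily small norm.

   Neumann series in lp spaces. The norms of the powers of [u] are dominated by
   convolution powers of the scalar sequence [|u|], where everything commutes; splitting
   off a finitely supported part bounds the spectral radius of [|u|] in lp(nu) by its norm
   in l1(sigma), whenever [nu] is subexponential relative to [sigma]. For admissible [nu],
   [sigma = 1] works. Otherwise the first weight grows exponentially on some half-line,
   and a single weight [nu], equal to [s^n (1+n)^2] there with [s] close to 1 and tempered on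
   the other half-line, serves for all n; [sigma] is then [s^n] on that half-line. *)
Require Import Defs.
From HB Require Import structures.
From mathcomp Require Import all_boot all_order all_algebra.
From mathcomp Require Import all_classical all_reals all_analysis.
From mathcomp Require Import finmap ring lra zify.
Import Defs.
Import Order.TTheory GRing.Theory Num.Theory.
Import numFieldNormedType.Exports.
Set Implicit Arguments.
Unset Strict Implicit.
Unset Printing Implicit Defensive.
Local Open Scope classical_set_scope.
Local Open Scope ring_scope.

(** * Sums over arbitrary index types *)

Section EsumTheory.
Context {R : realType}.
Implicit Types (T : choiceType).

(** A left inverse of [fourier f z] is neither unique nor given continuously in [z], and a left
    ideal has no characters to test it. The averaging avoids both problems: it compares resolvents
    only at neighbouring roots, one pair at a time, and never selects a global family. When the
    weights are nonadmissible, the inverse may decay at an exponential rate that depends on [f], so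
    [nu] has to depend on [f] as well. It is built from index 0 alone: [w 0 <= w n] carries the
    upper bound to every [n], and [p n <= p 0] carries the algebra condition, which survives a
    smaller exponent. Constants: 1/16 for the approximate left inverse and 1/16 for its truncation
    give 1/8; the exponential factor [s^n] may add another 1/8. At 1/4 the weighted powers decay
    like [(3/4)^k], where 3/4 = 1/2 + 1/4 collects the finitely supported part and the remainder. *)

Lemma esum_leP T (a : T -> \bar R) x :
  (forall X : set T, finite_set X -> (\sum_(i \in X) a i <= x)%E) ->
  (\esum_(i in [set: T]) a i <= x)%E.
Proof. by move=> h; apply: ge_ereal_sup => _ [X [finX _] <-]; exact: h. Qed.

Lemma fsum_le_esum T (a : T -> \bar R) (X : set T) : finite_set X ->
  (\sum_(i \in X) a i <= \esum_(i in [set: T]) a i)%E.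
Proof. by move=> finX; apply: esum_ge; exists X. Qed.

Lemma esum_ge_term T (a : T -> \bar R) i : (forall i, 0 <= a i)%E ->
  (a i <= \esum_(i in [set: T]) a i)%E.
Proof.
move=> a0; apply: esum_ge; exists [set i]; first by split.
by rewrite fsbig_set1.
Qed.

Lemma esumZl T (c : R) (a : T -> \bar R) : 0 <= c -> (forall i, 0 <= a i)%E ->
  (\esum_(i in [set: T]) (c%:E * a i) = c%:E * \esum_(i in [set: T]) a i)%E.
Proof.
have esumZl_le (d : R) (b : T -> \bar R) : 0 <= d -> (forall i, 0 <= b i)%E ->
    (\esum_(i in [set: T]) (d%:E * b i) <= d%:E * \esum_(i in [set: T]) b i)%E.
  move=> d0 b0; apply: esum_leP => X finX.
  rewrite -ge0_mule_fsumr//; apply: lee_wpmul2l; first by rewrite lee_fin.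
  exact: fsum_le_esum.
move=> c0 a0; apply/le_anti; rewrite esumZl_le//=.
have [->|cn0] := eqVneq c 0.
  by rewrite mul0e; apply: esum_ge0 => i _; rewrite mul0e.
have cp : 0 < c by rewrite lt_neqAle eq_sym cn0.
have h : (\esum_(i in [set: T]) a i <=
    (c^-1)%:E * \esum_(i in [set: T]) (c%:E * a i))%E.
  apply: le_trans (esumZl_le _ _ _ _).
  - by under [leRHS]eq_esum do rewrite muleA -EFinM mulVf// mul1e.
  - by rewrite invr_ge0.
  - by move=> i; rewrite mule_ge0// lee_fin.
have c0E : (0 <= c%:E)%E by rewrite lee_fin.
by apply: (le_trans (lee_wpmul2l c0E h)); rewrite muleA -EFinM divff// mul1e.
Qed.

(** By symmetry one inequality is enough: a finite outer sum passes inside, and there it is below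
    the full sum. *)
Lemma exchange_esum T1 T2 (a : T1 -> T2 -> \bar R) :
  (forall i j, 0 <= a i j)%E ->
  (\esum_(i in [set: T1]) \esum_(j in [set: T2]) a i j =
   \esum_(j in [set: T2]) \esum_(i in [set: T1]) a i j)%E.
Proof.
have le_exch (U1 U2 : choiceType) (b : U1 -> U2 -> \bar R) :
    (forall i j, 0 <= b i j)%E ->
    (\esum_(i in [set: U1]) \esum_(j in [set: U2]) b i j <=
     \esum_(j in [set: U2]) \esum_(i in [set: U1]) b i j)%E.
  move=> b0; apply: esum_leP => X finX.
  rewrite fsbig_finite//= -esum_sum//; apply: le_esum => j _.
  by rewrite -fsbig_finite//; exact: fsum_le_esum.
by move=> a0; apply/le_anti; rewrite !le_exch.
Qed.

Lemma esum_shift (k : int) (a : int -> \bar R) :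
  \esum_(n in [set: int]) a (n + k) = \esum_(n in [set: int]) a n.
Proof.
symmetry; apply: (@reindex_esum R _ _ setT setT (fun n : int => n + k)).
split=> [x _//|x y _ _ /addIr//|y _].
by exists (y - k) => //; rewrite subrK.
Qed.

Lemma esum_opp (a : int -> \bar R) :
  \esum_(n in [set: int]) a (- n) = \esum_(n in [set: int]) a n.
Proof.
symmetry; apply: (@reindex_esum R _ _ setT setT (fun n : int => - n)).
split=> [x _//|x y _ _ /oppr_inj//|y _].
by exists (- y) => //; rewrite opprK.
Qed.

Lemma esum_reflect (k : int) (a : int -> \bar R) :
  \esum_(n in [set: int]) a (k - n) = \esum_(n in [set: int]) a n.
Proof.
rewrite -(esum_opp a) -(esum_shift (- k) (fun n => a (- n))).
by apply: eq_esum => n _; rewrite opprD opprK addrC.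
Qed.

(* Most estimates are phrased with explicit real bounds on sums of real terms. *)
Definition sumle T (x : T -> R) (t : R) : Prop :=
  (\esum_(i in [set: T]) (x i)%:E <= t%:E)%E.

Lemma sumle_ge0 T (x : T -> R) t : (forall i, 0 <= x i) -> sumle x t -> 0 <= t.
Proof.
by move=> x0 h; rewrite -lee_fin (le_trans _ h)// esum_ge0// => i _; rewrite lee_fin.
Qed.

Lemma sumle_term T (x : T -> R) t i : (forall i, 0 <= x i) -> sumle x t -> x i <= t.
Proof.
move=> x0 h; rewrite -lee_fin (le_trans _ h)//.
by apply: (@esum_ge_term T (EFin \o x)) => j; rewrite lee_fin.
Qed.

Lemma le_sumle T (x y : T -> R) s t :
  (forall i, x i <= y i) -> s <= t -> sumle y s -> sumle x t.
Proof.
move=> xy st h; apply: (@le_trans _ _ (\esum_(i in [set: T]) (y i)%:E)).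
  by apply: le_esum => i _; rewrite lee_fin.
by apply: (le_trans h); rewrite lee_fin.
Qed.

Lemma eq_sumle T (x y : T -> R) t : (forall i, x i = y i) -> sumle x t = sumle y t.
Proof. by move=> xy; congr sumle; apply/funext. Qed.

Lemma sumleD T (x y : T -> R) s t :
  (forall i, 0 <= x i) -> (forall i, 0 <= y i) ->
  sumle x s -> sumle y t -> sumle (fun i => x i + y i) (s + t).
Proof.
move=> x0 y0 xs yt; rewrite /sumle; under eq_esum do rewrite EFinD.
by rewrite esumD; [rewrite EFinD leeD| |] => // i _; rewrite lee_fin.
Qed.

Lemma sumleZ T (c : R) (x : T -> R) t : 0 <= c -> (forall i, 0 <= x i) ->
  sumle x t -> sumle (fun i => c * x i) (c * t).
Proof.
move=> c0 x0 xt; rewrite /sumle; under eq_esum do rewrite EFinM.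
by rewrite (@esumZl T c (EFin \o x))// EFinM lee_wpmul2l// lee_fin.
Qed.

Lemma sumle0 T : sumle (fun _ : T => 0) 0.
Proof. by rewrite /sumle esum1. Qed.

Lemma sumle_shift k (x : int -> R) t : sumle (fun n => x (n + k)) t = sumle x t.
Proof. by rewrite /sumle (esum_shift k (EFin \o x)). Qed.

Lemma sumle_reflect k (x : int -> R) t : sumle (fun n => x (k - n)) t = sumle x t.
Proof. by rewrite /sumle (esum_reflect k (EFin \o x)). Qed.

Lemma esum_lt_pinfty T (x : T -> R) : (forall i, 0 <= x i) ->
  ((\esum_(i in [set: T]) (x i)%:E < +oo)%E <-> exists t, sumle x t).
Proof.
move=> x0; split=> [h|[t]]; last by move=> /le_lt_trans; apply; rewrite ltry.
exists (fine (\esum_(i in [set: T]) (x i)%:E)); rewrite /sumle fineK// ge0_fin_numE//.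
by apply: esum_ge0 => i _; rewrite lee_fin.
Qed.

Lemma sumle_fsetP T (x : T -> R) t :
  (forall s : {fset T}, \sum_(i <- s) x i <= t) -> sumle x t.
Proof.
move=> h; apply: esum_leP => X finX; rewrite fsbig_finite//= sumEFin lee_fin.
exact: h.
Qed.

Lemma sumle_fset T (x : T -> R) t (s : {fset T}) :
  sumle x t -> \sum_(i <- s) x i <= t.
Proof.
move=> h; rewrite -lee_fin (le_trans _ h)// -sumEFin.
have := @fsum_le_esum T (fun i => (x i)%:E) [set` s] (finite_fset s).
by rewrite fsbig_finite//= set_fsetK.
Qed.

Lemma sumle_single T (i0 : T) (x : T -> R) : 0 <= x i0 ->
  (forall i, i != i0 -> x i = 0) -> sumle x (x i0).
Proof.
move=> x0 h; rewrite /sumle (esumID [set i0])/=; last first.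
  by move=> i _; have [->|/h ->] := eqVneq i i0; rewrite lee_fin.
rewrite setTI esum_set1 ?lee_fin// esum1 ?adde0//.
by move=> i [_ /= /eqP/h ->].
Qed.

Lemma sumle_tail (x : int -> R) t e : (forall i, 0 <= x i) -> sumle x t -> 0 < e ->
  exists D : nat, sumle (fun n => if (absz n <= D)%N then 0 else x n) e.
Proof.
move=> x0 xt e0.
have x0E i : (0 <= (x i)%:E)%E by rewrite lee_fin.
set S := \esum_(i in [set: int]) (x i)%:E.
have Sfin : S \is a fin_num.
  rewrite ge0_fin_numE; last by apply: esum_ge0.
  by apply: (le_lt_trans xt); rewrite ltry.
have [_ [X [finX _] <-] hX] := ub_ereal_sup_adherent e0 Sfin.
(* The sum of the moduli over [X] bounds each of them, so [X] lies in [[-D, D]]. *)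
pose D := (\sum_(n <- fset_set X) absz n)%N.
exists D; rewrite /sumle.
rewrite fsbig_finite//= in hX.
pose y n := if (absz n <= D)%N then 0 else x n.
pose z n := if (absz n <= D)%N then x n else 0.
have y0 n : (0 <= (y n)%:E)%E by rewrite lee_fin /y; case: ifP.
have z0 n : (0 <= (z n)%:E)%E by rewrite lee_fin /z; case: ifP.
have SE : S = (\esum_(n in [set: int]) (z n)%:E + \esum_(n in [set: int]) (y n)%:E)%E.
  rewrite -esumD//; apply: eq_esum => n _; rewrite -EFinD /y /z.
  by case: ifP => _; rewrite ?addr0 ?add0r.
have zle : (\sum_(i <- fset_set X) (x i)%:E <= \esum_(n in [set: int]) (z n)%:E)%E.
  apply: (@le_trans _ _ (\sum_(i <- fset_set X) (z i)%:E)%E); last first.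
    by rewrite -fsbig_finite//; exact: fsum_le_esum.
  rewrite big_seq [leRHS]big_seq; apply: lee_sum => n nX.
  rewrite /z ifT// /D.
  by rewrite (big_rem n)//= leq_addr.
have zfin : (\esum_(n in [set: int]) (z n)%:E)%E \is a fin_num.
  rewrite ge0_fin_numE; last by apply: esum_ge0.
  apply: (@le_lt_trans _ _ S); first by rewrite SE leeDl// esum_ge0.
  by rewrite -ge0_fin_numE// esum_ge0.
have : (S - e%:E < \esum_(n in [set: int]) (z n)%:E)%E := lt_le_trans hX zle.
rewrite SE -addeA; set Y := \esum_(n in _) (y n)%:E; set Z := \esum_(n in _) (z n)%:E.
move=> hh; have : (Z + (Y - e%:E) < Z + 0)%E by rewrite adde0.
rewrite lteD2lE// => /ltW.
by rewrite leeBlDr// add0e.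
Qed.

End EsumTheory.

(** * Inequalities of Hoelder and Minkowski *)

Section LpInequalities.
Context {R : realType}.
Implicit Types (T : choiceType) (p q : R).

Lemma powR_inv (b r : R) : 0 <= b -> b^-1 `^ r = b `^ (- r).
Proof. by move=> b0; rewrite -powR_inv1// -powRrM mulN1r. Qed.

Lemma powR_div (a b r : R) : 0 <= a -> 0 <= b -> (a / b) `^ r = a `^ r / b `^ r.
Proof. by move=> a0 b0; rewrite powRM ?invr_ge0// powR_inv// powRN. Qed.

(** Young's inequality for [x i / A] and [y i / B], multiplied by [A B] and summed. A vanishing
    bound forces a vanishing family and is treated apart because of the division. *)
Lemma sumle_hoelder T p q (x y : T -> R) A B :
  0 < p -> 0 < q -> p^-1 + q^-1 = 1 ->
  (forall i, 0 <= x i) -> (forall i, 0 <= y i) -> 0 <= A -> 0 <= B ->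
  sumle (fun i => x i `^ p) (A `^ p) -> sumle (fun i => y i `^ q) (B `^ q) ->
  sumle (fun i => x i * y i) (A * B).
Proof.
move=> p0 q0 pq x0 y0 A0 B0 hx hy.
have zero r (z : T -> R) : 0 < r -> sumle (fun i => z i `^ r) (0 `^ r) ->
    forall i, z i = 0.
  move=> r0 h i; apply: (@powR_eq0_eq0 _ _ r); apply/le_anti; rewrite powR_ge0 andbT.
  have -> : 0 = 0 `^ r :> R by rewrite powR0// gt_eqF.
  by apply: (@sumle_term _ _ (fun i => z i `^ r)) => // j; exact: powR_ge0.
have [A00|An0] := eqVneq A 0.
  rewrite A00 mul0r (@eq_sumle _ _ _ (fun=> 0)); first exact: sumle0.
  by move=> i; rewrite (zero _ _ p0) ?mul0r -?A00.
have [B00|Bn0] := eqVneq B 0.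
  rewrite B00 mulr0 (@eq_sumle _ _ _ (fun=> 0)); first exact: sumle0.
  by move=> i; rewrite (zero _ y q0) ?mulr0 -?B00.
have Ap : 0 < A by rewrite lt_neqAle eq_sym An0.
have Bp : 0 < B by rewrite lt_neqAle eq_sym Bn0.
have APp : 0 < A `^ p by rewrite powR_gt0.
have BQp : 0 < B `^ q by rewrite powR_gt0.
pose c := A * B / p / (A `^ p); pose d := A * B / q / (B `^ q).
have c0 : 0 <= c by rewrite !divr_ge0 ?mulr_ge0 // ltW.
have d0 : 0 <= d by rewrite !divr_ge0 ?mulr_ge0 // ltW.
apply: (@le_sumle _ _ _ (fun i => c * x i `^ p + d * y i `^ q)
  (c * A `^ p + d * B `^ q)).
- move=> i.
  have := @conjugate_powR _ (x i / A) (y i / B) p q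
    (divr_ge0 (x0 i) A0) (divr_ge0 (y0 i) B0) p0 q0 pq.
  rewrite !powR_div// => h.
  have := ler_wpM2l (mulr_ge0 A0 B0) h.
  rewrite [leLHS](_ : _ = x i * y i); last by field; rewrite An0 Bn0.
  move=> /le_trans; apply; rewrite le_eqVlt; apply/orP; left; apply/eqP.
  by rewrite /c /d; field; rewrite !gt_eqF.
- have -> : c * A `^ p + d * B `^ q = A * B * (p^-1 + q^-1).
    by rewrite /c /d; field; rewrite !gt_eqF.
  by rewrite pq mulr1.
- apply: sumleD; [| |apply: sumleZ => //|apply: sumleZ => //].
  all: by move=> i; (exact: powR_ge0 || (apply: mulr_ge0 => //; exact: powR_ge0)).
Qed.

Lemma powR_convex2 p (a b x y : R) : 1 <= p -> 0 <= a -> 0 <= b -> a + b = 1 ->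
  0 <= x -> 0 <= y -> (a * x + b * y) `^ p <= a * x `^ p + b * y `^ p.
Proof.
move=> p1 a0 b0 ab x0 y0.
have a1 : a <= 1 by rewrite -ab lerDl.
have := @convex_powR R p p1 (Itv01 a0 a1) x y.
have nn u : 0 <= u -> u \in (`[0, +oo[%classic : set R).
  by move=> u0; apply/mem_set; rewrite /= in_itv /= u0.
move=> /(_ (nn _ x0) (nn _ y0)).
by rewrite !convRE/= (_ : b = 1 - a)// -ab addrC addKr.
Qed.

(** Convexity of the p-th power at the combination of [x i / s] and [y i / t] with coefficients
    [s / (s + t)] and [t / (s + t)]. The division by [s] and [t] is why lp bounds are kept positive
    from here on. *)
Lemma sumle_minkowski T p (x y : T -> R) s t : 1 <= p ->
  (forall i, 0 <= x i) -> (forall i, 0 <= y i) -> 0 < s -> 0 < t ->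
  sumle (fun i => x i `^ p) (s `^ p) -> sumle (fun i => y i `^ p) (t `^ p) ->
  sumle (fun i => (x i + y i) `^ p) ((s + t) `^ p).
Proof.
move=> p1 x0 y0 s0 t0 hx hy.
have st0 : 0 < s + t by rewrite addr_gt0.
have SP : 0 < s `^ p by rewrite powR_gt0.
have TP : 0 < t `^ p by rewrite powR_gt0.
pose a := s / (s + t); pose b := t / (s + t).
have a0 : 0 <= a by rewrite divr_ge0 ?ltW.
have b0 : 0 <= b by rewrite divr_ge0 ?ltW.
have ab : a + b = 1 by rewrite /a /b -mulrDl divff// gt_eqF.
pose K := (s + t) `^ p.
have K0 : 0 <= K by rewrite powR_ge0.
have [s0w t0w] := (ltW s0, ltW t0).
apply: (@le_sumle _ _ _ (fun i => K * (a / s `^ p) * x i `^ p + K * (b / t `^ p) * y i `^ p)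
  (K * (a / s `^ p) * s `^ p + K * (b / t `^ p) * t `^ p)).
- move=> i.
  have -> : x i + y i = (s + t) * (a * (x i / s) + b * (y i / t)).
    by rewrite /a /b; field; rewrite !gt_eqF.
  have nn : 0 <= a * (x i / s) + b * (y i / t).
    by rewrite addr_ge0// mulr_ge0// divr_ge0// ltW.
  rewrite (powRM _ (ltW st0) nn) -/K.
  rewrite (_ : K * (a / s `^ p) * x i `^ p + K * (b / t `^ p) * y i `^ p =
    K * (a * (x i `^ p / s `^ p) + b * (y i `^ p / t `^ p))); last first.
    by field; rewrite !gt_eqF.
  apply: ler_wpM2l => //; rewrite -!powR_div//.
  by apply: powR_convex2 => //; exact: divr_ge0.
- by rewrite -!mulrA -mulrDr !mulVf ?gt_eqF// !mulr1 ab mulr1.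
- have KA : 0 <= K * (a / s `^ p) := mulr_ge0 K0 (divr_ge0 a0 (powR_ge0 _ _)).
  have KB : 0 <= K * (b / t `^ p) := mulr_ge0 K0 (divr_ge0 b0 (powR_ge0 _ _)).
  apply: sumleD; [| |apply: sumleZ => //|apply: sumleZ => //].
  all: by move=> i; (exact: powR_ge0 || (apply: mulr_ge0 => //; exact: powR_ge0)).
Qed.

(** Each [x i] is at most [s], so [x i ^ p <= s ^ (p - 1) * x i]. *)
Lemma sumle_powR T p (x : T -> R) s : 1 <= p -> (forall i, 0 <= x i) ->
  sumle x s -> sumle (fun i => x i `^ p) (s `^ p).
Proof.
move=> p1 x0 xs.
have p0 : 0 < p by apply: lt_le_trans p1.
have s0 : 0 <= s := sumle_ge0 x0 xs.
apply: (@le_sumle _ _ _ (fun i => s `^ (p - 1) * x i) (s `^ (p - 1) * s)).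
- move=> i; rewrite -(mulr_powRB1 (x0 i) p0) mulrC; apply: ler_wpM2r => //.
  apply: ge0_ler_powR; rewrite ?nnegrE ?subr_ge0//.
  exact: sumle_term xs.
- by rewrite mulrC mulr_powRB1.
- by apply: sumleZ => //; exact: powR_ge0.
Qed.

End LpInequalities.

(** * Convolution of nonnegative scalar sequences *)

Section ScalarConvolution.
Context {R : realType}.
Implicit Types (a b : int -> R) (x : int -> \bar R) (p : R) (nu sg : int -> R).

(** The kernel is real but the argument may be infinite, so iterates make sense before any
    summability is known. *)
Definition ecv a x (n : int) : \bar R :=
  (\esum_(m in [set: int]) ((a m)%:E * x (n - m)%R))%E.

Lemma ecv_ge0 a x : (forall n, 0 <= a n) -> (forall n, 0 <= x n)%E ->
  forall n, (0 <= ecv a x n)%E.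
Proof. by move=> a0 x0 n; apply: esum_ge0 => m _; rewrite mule_ge0// lee_fin. Qed.

Lemma le_ecv a x x' : (forall n, 0 <= a n) -> (forall n, (x n <= x' n)%E) ->
  forall n, (ecv a x n <= ecv a x' n)%E.
Proof. by move=> a0 h n; apply: le_esum => m _; rewrite lee_wpmul2l// lee_fin. Qed.

Lemma ecvDr a x x' : (forall n, 0 <= a n) ->
  (forall n, 0 <= x n)%E -> (forall n, 0 <= x' n)%E ->
  ecv a (fun n => x n + x' n)%E = (fun n => ecv a x n + ecv a x' n)%E.
Proof.
move=> a0 x0 x0'; apply/funext => n; rewrite /ecv -esumD.
- by apply: eq_esum => m _; rewrite ge0_muleDr.
- by move=> m _; rewrite mule_ge0// lee_fin.
- by move=> m _; rewrite mule_ge0// lee_fin.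
Qed.

Lemma ecvDl a b x : (forall n, 0 <= a n) -> (forall n, 0 <= b n) ->
  (forall n, 0 <= x n)%E ->
  ecv (fun n => a n + b n) x = (fun n => ecv a x n + ecv b x n)%E.
Proof.
move=> a0 b0 x0; apply/funext => n; rewrite /ecv -esumD.
- by apply: eq_esum => m _; rewrite EFinD ge0_muleDl// lee_fin.
- by move=> m _; rewrite mule_ge0// lee_fin.
- by move=> m _; rewrite mule_ge0// lee_fin.
Qed.

(** The commutation that is lost in [A] and recovered on norms; it is Tonelli's theorem. *)
Lemma ecvCA a b x : (forall n, 0 <= a n) -> (forall n, 0 <= b n) ->
  (forall n, 0 <= x n)%E -> ecv a (ecv b x) = ecv b (ecv a x).
Proof.
move=> a0 b0 x0; apply/funext => n; rewrite /ecv.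
under eq_esum => m _.
  rewrite -esumZl//; last by move=> l; rewrite mule_ge0// lee_fin.
  over.
rewrite exchange_esum; last by move=> m l; rewrite !mule_ge0// lee_fin.
apply: eq_esum => l _; rewrite -esumZl//; last by move=> m; rewrite mule_ge0// lee_fin.
apply: eq_esum => m _; rewrite muleCA; congr (_ * (_ * x _))%E.
by rewrite -!addrA; congr (_ + _); rewrite addrC.
Qed.

(** Tonelli together with [sg n <= sg m * sg (n - m)]. The choice [sg = 1] is the plain l1 estimate,
    used later for [p]-th powers and for norms in [A]. *)
Lemma ecv_weighted_l1 sg a x s t :
  (forall n, 0 <= sg n) -> (forall m n, sg (m + n) <= sg m * sg n) ->
  (forall n, 0 <= a n) -> (forall n, 0 <= x n)%E -> 0 <= t ->
  sumle (fun n => sg n * a n) s ->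
  (\esum_(n in [set: int]) ((sg n)%:E * x n) <= t%:E)%E ->
  (\esum_(n in [set: int]) ((sg n)%:E * ecv a x n) <= (s * t)%:E)%E.
Proof.
move=> sg0 sgM a0 x0 t0 hs ht.
have ax0 m n : (0 <= (a m)%:E * x n)%E by rewrite mule_ge0// lee_fin.
under eq_esum do rewrite /ecv -esumZl//.
rewrite exchange_esum; last by move=> n m; rewrite mule_ge0// lee_fin.
apply: (@le_trans _ _ (\esum_(m in [set: int]) ((t * (sg m * a m))%:E))%E).
  apply: le_esum => m _.
  apply: (@le_trans _ _ (\esum_(n in [set: int])
      ((sg m * a m)%:E * ((sg (n - m)%R)%:E * x (n - m)%R)))%E).
    apply: le_esum => n _.
    rewrite [leRHS](_ : _ = ((sg m * sg (n - m)%R)%:E * ((a m)%:E * x (n - m)%R)))%E.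
      by apply: lee_wpmul2r => //; rewrite lee_fin -{1}(subrKC m n).
    by rewrite !EFinM !muleA; congr (_ * _)%E; rewrite -!muleA; congr (_ * _)%E; rewrite muleC.
  rewrite esumZl ?mulr_ge0//; last by move=> n; rewrite mule_ge0// lee_fin.
  rewrite (esum_shift (- m) (fun n => (sg n)%:E * x n)%E) (mulrC t) [leRHS]EFinM.
  by apply: lee_wpmul2l => //; rewrite lee_fin mulr_ge0.
rewrite mulrC; apply: sumleZ => // n; exact: mulr_ge0.
Qed.

Lemma conjugate_indexP p : 1 < p ->
  0 < conjugate_index p /\ p^-1 + (conjugate_index p)^-1 = 1.
Proof.
move=> p1; have p0 : 0 < p by apply: lt_trans p1.
by rewrite /conjugate_index invrK subrKC invr_gt0 subr_gt0 invf_lt1.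
Qed.

(* Hoelder with the splitting a(m) y(n-m) = [a nu (m) y nu (n-m)] / [nu(m) nu(n-m)]. *)
Lemma ecv_lp nu p a (y : int -> R) s t : 1 < p -> (forall n, 1 <= nu n) ->
  (forall n, (nonneg_conv (fun k => nu k `^ (- conjugate_index p))%R
     (fun k => nu k `^ (- conjugate_index p))%R n
     <= (nu n `^ (- conjugate_index p))%:E)%E) ->
  (forall n, 0 <= a n) -> (forall n, 0 <= y n) -> 0 <= s -> 0 <= t ->
  sumle (fun n => (a n * nu n) `^ p) (s `^ p) ->
  sumle (fun n => (y n * nu n) `^ p) (t `^ p) ->
  exists z : int -> R, [/\ forall n, 0 <= z n,
    forall n, (ecv a (EFin \o y) n <= (z n)%:E)%E &
    sumle (fun n => (z n * nu n) `^ p) ((s * t) `^ p)].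
Proof.
move=> p1 nu1 nuc a0 y0 s0 t0 hs ht.
have p0 : 0 < p by apply: lt_trans p1.
have [q0 pq] := conjugate_indexP p1; set q := conjugate_index p in nuc q0 pq.
have nu0 n : 0 < nu n by apply: lt_le_trans (nu1 n).
pose al n := (a n * nu n) `^ p; pose be n := (y n * nu n) `^ p.
have al0 n : 0 <= al n by rewrite powR_ge0.
have be0 n : 0 <= be n by rewrite powR_ge0.
(* [S] is the convolution of the [p]-th powers [al] and [be]; the l1 estimate with weight 1 bounds
   its total mass. *)
pose S n := (\esum_(m in [set: int]) (al m * be (n - m)%R)%:E)%E.
have hS : (\esum_(n in [set: int]) S n <= ((s * t) `^ p)%:E)%E.
  have := @ecv_weighted_l1 (fun=> 1) al (EFin \o be) (s `^ p) (t `^ p).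
  rewrite powRM// => h; apply: (le_trans _ (h _ _ _ _ _ _ _)) => //.
  - by apply: le_esum => n _; rewrite mul1e.
  - by move=> *; rewrite mulr1.
  - by rewrite powR_ge0.
  - by under eq_sumle do rewrite mul1r.
  - by under eq_esum do rewrite mul1e.
have S0 n : (0 <= S n)%E by apply: esum_ge0 => m _; rewrite lee_fin mulr_ge0.
have Sfin n : S n \is a fin_num.
  rewrite ge0_fin_numE// (le_lt_trans (esum_ge_term _ S0))//.
  by rewrite (le_lt_trans hS)// ltry.
(* Hoelder's bound: the first factor contributes [S n ^ (1/p)], and the [q]-th powers of the second
   sum to at most [nu n ^ (- q)]. *)
pose z n := (fine (S n)) `^ p^-1 / nu n.
exists z; split.
- by move=> n; rewrite divr_ge0 ?powR_ge0// ltW.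
- move=> n; have := @sumle_hoelder R int p q
    (fun m => (a m * nu m) * (y (n - m) * nu (n - m)))
    (fun m => (nu m)^-1 * (nu (n - m))^-1) (fine (S n) `^ p^-1) (nu n)^-1 p0 q0 pq.
  have -> : sumle (fun m => (a m * nu m) * (y (n - m) * nu (n - m)) *
      ((nu m)^-1 * (nu (n - m))^-1)) (fine (S n) `^ p^-1 / nu n)
      = (ecv a (EFin \o y) n <= (z n)%:E)%E.
    rewrite /sumle /ecv /z; congr (is_true (_ <= _)%E); apply: eq_esum => m _.
    by rewrite /= -EFinM; congr EFin; field; rewrite !gt_eqF.
  apply.
  + by move=> m; rewrite !mulr_ge0// ltW.
  + by move=> m; rewrite !mulr_ge0// invr_ge0 ltW.
  + by rewrite powR_ge0.
  + by rewrite invr_ge0 ltW.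
  + rewrite -powRrM mulVf ?gt_eqF// powRr1 ?fine_ge0//.
    rewrite /sumle fineK// le_eqVlt; apply/orP; left; apply/eqP.
    by apply: eq_esum => m _; rewrite powRM// !mulr_ge0// ltW.
  + have nu0w k := ltW (nu0 k).
    rewrite /sumle (powR_inv _ (nu0w n)); apply: le_trans (nuc n).
    apply: le_esum => m _; rewrite lee_fin powRM ?invr_ge0//.
    by rewrite !powR_inv// mulrC.
- rewrite /sumle; apply: le_trans hS; apply: le_esum => n _.
  rewrite /z divfK ?gt_eqF// -powRrM mulVf ?gt_eqF// powRr1 ?fine_ge0//.
  by rewrite fineK.
Qed.

End ScalarConvolution.

(** * Geometric decay of convolution powers in weighted lp *)

Section GeometricDecay.
Context {R : realType}.
Implicit Types (a : int -> R) (x : int -> \bar R) (p : R) (nu sg : int -> R).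

Definition lp_algebra_weight p nu : Prop :=
  (forall n, 1 <= nu n) /\
  (forall n, (nonneg_conv (fun k => nu k `^ (- conjugate_index p))%R
     (fun k => nu k `^ (- conjugate_index p))%R n
     <= (nu n `^ (- conjugate_index p))%:E)%E).

(** The ratio [nu / sg] grows at most subexponentially in both directions; [sg] carries the
    exponential rate. *)
Definition tempered nu sg : Prop :=
  forall l : R, 1 < l -> exists2 M : R, 0 < M &
    forall n : int, nu n <= M * sg n * l ^+ absz n.

(** An lp bound for extended-valued sequences, expressed through a real majorant so that Minkowski
    and Hoelder apply. *)
Definition lp_majorized nu p x t : Prop :=
  exists y : int -> R, [/\ forall n, 0 <= y n, forall n, (x n <= (y n)%:E)%E &
    sumle (fun n => (y n * nu n) `^ p) (t `^ p)].

Lemma lp_majorizedD nu p x x' s t : 1 <= p -> (forall n, 0 <= nu n) -> 0 < s -> 0 < t ->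
  lp_majorized nu p x s -> lp_majorized nu p x' t ->
  lp_majorized nu p (fun n => x n + x' n)%E (s + t).
Proof.
move=> p1 nu0 s0 t0 [y [y0 xy hy]] [y' [y0' xy' hy']].
exists (fun n => y n + y' n); split.
- by move=> n; rewrite addr_ge0.
- by move=> n; rewrite EFinD leeD.
- rewrite (@eq_sumle _ _ _ (fun n => (y n * nu n + y' n * nu n) `^ p)); last first.
    by move=> n; rewrite mulrDl.
  by apply: sumle_minkowski => // n; rewrite mulr_ge0.
Qed.

Lemma lp_majorized_ecv nu p a x s t : 1 < p -> lp_algebra_weight p nu ->
  (forall n, 0 <= a n) -> 0 <= s -> 0 <= t ->
  sumle (fun n => (a n * nu n) `^ p) (s `^ p) ->
  lp_majorized nu p x t -> lp_majorized nu p (ecv a x) (s * t).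
Proof.
move=> p1 [nu1 nuc] a0 s0 t0 hs [y [y0 xy hy]].
have [z [z0 az hz]] := ecv_lp p1 nu1 nuc a0 y0 s0 t0 hs hy.
exists z; split => // n; apply: le_trans (az n).
exact: le_ecv.
Qed.

Lemma iter_ecv_ge0 a k x : (forall n, 0 <= a n) -> (forall n, 0 <= x n)%E ->
  forall n, (0 <= iter k (ecv a) x n)%E.
Proof. by move=> a0 x0; elim: k => //= k IH; exact: ecv_ge0. Qed.

(** Commutation brings the factor [b] to the outside, where its lp bound is applied to an iterate
    already estimated. *)
Lemma iter_ecvD a b i x : (forall n, 0 <= a n) -> (forall n, 0 <= b n) ->
  (forall n, 0 <= x n)%E ->
  iter i (ecv a) (ecv (fun n => a n + b n) x) =
  (fun n => iter i.+1 (ecv a) x n + ecv b (iter i (ecv a) x) n)%E.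
Proof.
move=> a0 b0 x0; elim: i => [|i IH]; first by rewrite /= ecvDl.
rewrite iterS IH ecvDr//.
- by rewrite ecvCA//; exact: iter_ecv_ge0.
- exact: iter_ecv_ge0.
- by apply: ecv_ge0 => //; exact: iter_ecv_ge0.
Qed.

(** The mass [e] will be the norm of the unit of [A], which may exceed 1. *)
Definition edelta (e : R) (n : int) : \bar R := if n == 0 then e%:E else 0%E.

Lemma edelta_ge0 e n : 0 <= e -> (0 <= edelta e n)%E.
Proof. by move=> e0; rewrite /edelta; case: ifP => //; rewrite lee_fin. Qed.

Lemma esum_edelta (c : int -> R) (e : R) : 0 <= e -> 0 <= c 0 ->
  (\esum_(n in [set: int]) ((c n)%:E * edelta e n) = (c 0 * e)%:E)%E.
Proof.
move=> e0 c0; rewrite (esumID [set 0])/=; last first.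
  move=> i _; rewrite /edelta; case: eqP => [->|_]; last by rewrite mule0.
  by rewrite mule_ge0// lee_fin.
rewrite setTI esum_set1 /edelta ?eqxx; last by rewrite mule_ge0// lee_fin.
rewrite esum1 ?adde0// => i [_ /= /eqP/negPf ->].
by rewrite mule0.
Qed.

Lemma iter_ecv_weighted_l1 sg a e s k :
  (forall n, 0 <= sg n) -> (forall m n, sg (m + n) <= sg m * sg n) ->
  (forall n, 0 <= a n) -> 0 <= e -> sumle (fun n => sg n * a n) s ->
  (\esum_(n in [set: int]) ((sg n)%:E * iter k (ecv a) (edelta e) n) <=
   (s ^+ k * (sg 0 * e))%:E)%E.
Proof.
move=> sg0 sgM a0 e0 hs.
have s0 : 0 <= s by apply: sumle_ge0 hs => n; rewrite mulr_ge0.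
have d0 n := edelta_ge0 n e0.
elim: k => [|k IH]; first by rewrite /= esum_edelta// expr0 mul1r.
rewrite /= exprS -mulrA; apply: ecv_weighted_l1 => //.
- exact: iter_ecv_ge0.
- by rewrite mulr_ge0 ?exprn_ge0 ?mulr_ge0.
Qed.

Lemma lp_majorized_l1 nu mu p x M t : 1 <= p -> 0 <= M ->
  (forall n, 0 <= nu n) -> (forall n, 1 <= mu n) ->
  (forall n, nu n <= M * mu n) -> (forall n, 0 <= x n)%E ->
  (\esum_(n in [set: int]) ((mu n)%:E * x n) <= t%:E)%E ->
  lp_majorized nu p x (M * t).
Proof.
move=> p1 M0 nu0 mu1 numu x0 h.
have mux0 n : (0 <= (mu n)%:E * x n)%E.
  by rewrite mule_ge0// lee_fin (le_trans ler01).
have xfin n : x n \is a fin_num.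
  rewrite ge0_fin_numE//; apply: (@le_lt_trans _ _ t%:E); last by rewrite ltry.
  apply: le_trans (le_trans (esum_ge_term n mux0) h).
  by rewrite lee_pemull// lee_fin.
have f0 n : 0 <= fine (x n) by rewrite fine_ge0.
exists (fun n => fine (x n)); split => //.
- by move=> n; rewrite fineK.
- apply: sumle_powR => //; first by move=> n; rewrite mulr_ge0.
  apply: (@le_sumle _ _ _ (fun n => M * (mu n * fine (x n))) (M * t)) => //.
    by move=> n; rewrite mulrA mulrC ler_wpM2r.
  apply: sumleZ => //; first by move=> n; rewrite mulr_ge0// (le_trans ler01).
  rewrite /sumle; apply: le_trans h; apply: le_esum => n _.
  by rewrite EFinM fineK.
Qed.

(* The part of [a] carrying most of the lp mass is finitely supported, so [tempered] bounds the
   growth of its powers; the powers of the remainder are small in lp. Both parts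
   are scalar, hence commute, and the two estimates combine. *)
Lemma iter_ecv_lp p nu sg a t e : 1 < p -> lp_algebra_weight p nu ->
  (forall n, 1 <= sg n) -> (forall m n, sg (m + n) <= sg m * sg n) ->
  tempered nu sg -> (forall n, 0 <= a n) ->
  sumle (fun n => sg n * a n) (1 / 4) ->
  sumle (fun n => (a n * nu n) `^ p) t -> 0 < e ->
  exists2 C : R, 0 < C &
    forall k, lp_majorized nu p (iter k (ecv a) (edelta e)) (C * (3 / 4) ^+ k).
Proof.
move=> p1 nualg sg1 sgM temp a0 hsg hp e0.
have [nu1 _] := nualg.
have p1w := ltW p1.
have p0 : 0 < p by apply: lt_trans p1.
have nu0 n : 0 <= nu n by rewrite (le_trans ler01).
have sg0 n : 0 <= sg n by rewrite (le_trans ler01).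
have ap0 n : 0 <= (a n * nu n) `^ p by rewrite powR_ge0.
have q4 : 0 < (1 / 4 : R) `^ p by rewrite powR_gt0// divr_gt0.
have [D hD] := sumle_tail ap0 hp q4.
pose a1 n := if (absz n <= D)%N then a n else 0.
pose r n := if (absz n <= D)%N then 0 else a n.
have a10 n : 0 <= a1 n by rewrite /a1; case: ifP.
have r0 n : 0 <= r n by rewrite /r; case: ifP.
have aE : a = (fun n => a1 n + r n).
  by apply/funext => n; rewrite /a1 /r; case: ifP; rewrite ?addr0 ?add0r.
have hr : sumle (fun n => (r n * nu n) `^ p) ((1 / 4) `^ p).
  rewrite (@eq_sumle _ _ _ (fun n => if (absz n <= D)%N then 0 else (a n * nu n) `^ p))//.
  by move=> n; rewrite /r; case: ifP => //; rewrite mul0r powR0// gt_eqF.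
(* With this root of 2, [l ^ |n| <= 2] for [|n| <= D]: replacing [sg] by [mu] at most doubles the
   mass 1/4 of [a1]. *)
pose l : R := 2 `^ (D.+1%:R)^-1.
have l1 : 1 < l.
  have := @gt0_ltr_powR R (D.+1%:R)^-1; rewrite invr_gt0 ltr0Sn => /(_ isT 1 2).
  by rewrite !nnegrE powR1; apply=> //; rewrite ?ltr1n.
have lD : l ^+ D.+1 = 2.
  by rewrite -powR_mulrn ?powR_ge0// -powRrM mulVf ?powRr1.
have [M M0 hM] := temp l l1.
pose mu n := sg n * l ^+ absz n.
have lk k : 1 <= l ^+ k by rewrite exprn_ege1// ltW.
have mu1 n : 1 <= mu n by rewrite /mu -[1]mulr1 ler_pM.
have mu0 n : 0 <= mu n by rewrite (le_trans ler01).
have muM m n : mu (m + n) <= mu m * mu n.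
  rewrite /mu mulrACA -exprD; apply: ler_pM => //.
    by rewrite (le_trans ler01).
  by rewrite ler_weXn2l ?(ltW l1)//; lia.
have ha1 : sumle (fun n => mu n * a1 n) (1 / 2).
  apply: (@le_sumle _ _ _ (fun n => 2 * (sg n * a n)) (2 * (1 / 4))).
  - move=> n; rewrite /a1; case: ifP => [nD|_]; last by rewrite mulr0 !mulr_ge0.
    rewrite /mu -mulrA mulrCA; apply: ler_wpM2r; first by rewrite mulr_ge0.
    by rewrite -lD ler_weXn2l ?(ltW l1)// leqW.
  - by lra.
  - by apply: sumleZ => // n; rewrite mulr_ge0.
pose C := M * (mu 0 * e).
have mu00 : 0 < mu 0 by rewrite (lt_le_trans ltr01).
have C0 : 0 < C := mulr_gt0 M0 (mulr_gt0 mu00 e0).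
exists C => //.
have d0 n := edelta_ge0 n (ltW e0).
(* The induction on [k] needs every [i]: writing one factor [a] as [a1 + r] either raises [i], at
   the price 1/2, or convolves with [r], at the price 1/4. Together they give the ratio 3/4. *)
suff H k i : lp_majorized nu p (iter i (ecv a1) (iter k (ecv a) (edelta e)))
    (C * (1 / 2) ^+ i * (3 / 4) ^+ k).
  by move=> k; have := H k 0; rewrite expr0 mulr1.
have h2 : 0 < 1 / 2 :> R by lra.
have h34 : 0 < 3 / 4 :> R by lra.
elim: k i => [|k IH] i.
  rewrite expr0 mulr1 /= /C -mulrA (mulrC (mu 0 * e)).
  apply: (@lp_majorized_l1 nu mu) => //; first exact: ltW.
  - by move=> n; rewrite /mu mulrA.
  - exact: iter_ecv_ge0.
  - by apply: iter_ecv_weighted_l1 => //; exact: ltW.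
have Ecv x : ecv a x = ecv (fun n => a1 n + r n) x by rewrite -aE.
rewrite iterS Ecv iter_ecvD//; last exact: iter_ecv_ge0.
have -> : C * (1 / 2) ^+ i * (3 / 4) ^+ k.+1 =
  C * (1 / 2) ^+ i.+1 * (3 / 4) ^+ k + 1 / 4 * (C * (1 / 2) ^+ i * (3 / 4) ^+ k).
  by rewrite !exprS; field.
apply: lp_majorizedD => //.
- exact: mulr_gt0 (mulr_gt0 C0 (exprn_gt0 _ h2)) (exprn_gt0 _ h34).
- apply: mulr_gt0; first by lra.
  exact: mulr_gt0 (mulr_gt0 C0 (exprn_gt0 _ h2)) (exprn_gt0 _ h34).
- apply: lp_majorized_ecv => //.
  by apply/ltW; exact: mulr_gt0 (mulr_gt0 C0 (exprn_gt0 _ h2)) (exprn_gt0 _ h34).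
Qed.

End GeometricDecay.

(** * Sequences in a Banach algebra *)

Section RealNorm.
Context {R : realType} {A : banachAlgType R[i]}.
Implicit Types (a b : A).
Local Open Scope complex_scope.

Lemma norm_rnorm a : `|a| = (rnorm a)%:C.
Proof. by rewrite /rnorm RRe_real// ger0_real. Qed.

Lemma rnorm_ge0 a : 0 <= rnorm a.
Proof. by rewrite -ler0c -norm_rnorm. Qed.

Lemma rnormD a b : rnorm (a + b) <= rnorm a + rnorm b.
Proof. by rewrite -lecR rmorphD/= -!norm_rnorm ler_normD. Qed.

Lemma rnormN a : rnorm (- a) = rnorm a.
Proof. by rewrite /rnorm normrN. Qed.

Lemma rnormB a b : rnorm (a - b) <= rnorm a + rnorm b.
Proof. by rewrite -(rnormN b); exact: rnormD. Qed.

Lemma rnorm0 : rnorm (0 : A) = 0.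
Proof. by rewrite /rnorm normr0. Qed.

Lemma rnorm0_eq0 a : rnorm a = 0 -> a = 0.
Proof. by move=> h; apply/eqP; rewrite -normr_eq0 norm_rnorm h. Qed.

Lemma rnormZ (c : R[i]) a : rnorm (c *: a) = complex.Re `|c| * rnorm a.
Proof.
apply: complexI; rewrite -norm_rnorm normrZ norm_rnorm rmorphM/=.
by rewrite RRe_real// ger0_real.
Qed.

Lemma rnorm_bmul a b : rnorm (bmul a b) <= rnorm a * rnorm b.
Proof. by rewrite -lecR rmorphM/= -!norm_rnorm norm_bmul. Qed.

Lemma rnorm_sum (I : Type) (r : seq I) (F : I -> A) :
  rnorm (\sum_(i <- r) F i) <= \sum_(i <- r) rnorm (F i).
Proof.
elim: r => [|i r IH]; first by rewrite !big_nil rnorm0.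
by rewrite !big_cons (le_trans (rnormD _ _))// lerD2l.
Qed.

Lemma rnorm_bone_gt0 : 0 < rnorm (bone : A).
Proof.
rewrite lt_neqAle rnorm_ge0 andbT eq_sym; apply/eqP => /rnorm0_eq0 h.
by have := @bone_neq0 _ A; rewrite h eqxx.
Qed.

Lemma rnorm_bone_ge1 : 1 <= rnorm (bone : A).
Proof.
have := rnorm_bmul (bone : A) bone; rewrite bmul1l -{1}(mulr1 (rnorm bone)).
by rewrite ler_pM2l// rnorm_bone_gt0.
Qed.

Lemma rnorm_small a : (forall e : R, 0 < e -> rnorm a <= e) -> a = 0.
Proof.
move=> h; apply: rnorm0_eq0; apply/le_anti; rewrite rnorm_ge0 andbT.
by apply/ler_addgt0Pr => e e0; rewrite add0r h.
Qed.

Lemma bmul0l a : bmul 0 a = 0 :> A.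
Proof. by apply: (addrI (bmul 0 a)); rewrite -bmulDl !addr0. Qed.

Lemma bmul0r a : bmul a 0 = 0 :> A.
Proof. by apply: (addrI (bmul a 0)); rewrite -bmulDr !addr0. Qed.

Lemma bmulNr a b : bmul a (- b) = - bmul a b.
Proof. by apply/eqP; rewrite -subr_eq0 opprK -bmulDr addNr bmul0r. Qed.

Lemma cvg_rnormP (u : nat -> A) l :
  u @ \oo --> l <->
  forall e : R, 0 < e -> exists N : nat, forall n, (N <= n)%N -> rnorm (l - u n) <= e.
Proof.
split=> [/cvgrPdist_le h e e0|h].
  have e0' : 0 < e%:C by rewrite ltcR.
  have [N _ hN] := h _ e0'; exists N => n Nn.
  by have := hN n Nn; rewrite /= norm_rnorm lecR.
apply/cvgrPdist_le => e e0.
have eE : e = (complex.Re e)%:C by rewrite RRe_real// gtr0_real.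
have [|N hN] := h (complex.Re e); first by rewrite -ltcR -eE.
exists N => // n /= Nn; rewrite norm_rnorm eE lecR; exact: hN.
Qed.

Lemma cvg_series_rnorm (F : nat -> A) M :
  (forall n, \sum_(0 <= k < n) rnorm (F k) <= M) -> cvgn (series F).
Proof.
move=> h.
have cr : cvgn (series (fun k => rnorm (F k))).
  apply: nondecreasing_is_cvgn.
    by apply: nondecreasing_series => k _ _; exact: rnorm_ge0.
  by exists M => _ [n _ <-]; exact: h.
apply/cauchy_cvgP/cauchy_seriesP => e e0.
have eE : e = (complex.Re e)%:C by rewrite RRe_real// gtr0_real.
have e0' : 0 < complex.Re e by rewrite -ltcR -eE.
move/cauchy_cvgP/cauchy_seriesP : cr => /(_ _ e0').
apply: filterS => n /=; rewrite eE norm_rnorm ltcR => hn.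
apply: le_lt_trans hn; rewrite ger0_norm ?sumr_ge0//; first exact: rnorm_sum.
by move=> *; exact: rnorm_ge0.
Qed.

End RealNorm.

(** * Absolutely convergent two-sided series *)

Section ZSum.
Context {R : realType} {A : banachAlgType R[i]}.
Implicit Types (a b : A) (F G f g h : int -> A).

Definition l1le f (t : R) : Prop := sumle (fun n => rnorm (f n)) t.

Lemma l1P f : l1 f <-> exists t, l1le f t.
Proof. by apply: esum_lt_pinfty => n; exact: rnorm_ge0. Qed.

Lemma l1le_l1 f t : l1le f t -> l1 f.
Proof. by move=> h; apply/l1P; exists t. Qed.

Lemma l1le_ge0 f t : l1le f t -> 0 <= t.
Proof. by apply: sumle_ge0 => n; exact: rnorm_ge0. Qed.

Lemma l1leD f g s t : l1le f s -> l1le g t -> l1le (fun n => f n + g n) (s + t).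
Proof.
move=> hf hg; apply: (@le_sumle _ _ _ (fun n => rnorm (f n) + rnorm (g n)) (s + t)) => //.
  by move=> n; exact: rnormD.
by apply: sumleD => // n; exact: rnorm_ge0.
Qed.

Lemma l1leN f t : l1le f t -> l1le (fun n => - f n) t.
Proof. by rewrite /l1le => h; under eq_sumle do rewrite rnormN. Qed.

Lemma l1leB f g s t : l1le f s -> l1le g t -> l1le (fun n => f n - g n) (s + t).
Proof. by move=> hf hg; apply: l1leD => //; exact: l1leN. Qed.

Lemma l1leZ (c : R[i]) f t : l1le f t -> l1le (fun n => c *: f n) (complex.Re `|c| * t).
Proof.
rewrite /l1le => h; under eq_sumle do rewrite rnormZ.
apply: sumleZ => // [|n]; last exact: rnorm_ge0.
by rewrite -ler0c RRe_real// ger0_real.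
Qed.

Lemma le_l1le f s t : s <= t -> l1le f s -> l1le f t.
Proof. by move=> st; apply: le_sumle. Qed.

Lemma l1le_le f g t : (forall n, rnorm (f n) <= rnorm (g n)) -> l1le g t -> l1le f t.
Proof. by move=> fg; apply: le_sumle. Qed.

Lemma l1D f g : l1 f -> l1 g -> l1 (fun n => f n + g n).
Proof. by move=> /l1P[s hs] /l1P[t ht]; exact: l1le_l1 (l1leD hs ht). Qed.

Lemma l1N f : l1 f -> l1 (fun n => - f n).
Proof. by move=> /l1P[s hs]; exact: l1le_l1 (l1leN hs). Qed.

Lemma l1B f g : l1 f -> l1 g -> l1 (fun n => f n - g n).
Proof. by move=> hf hg; apply: l1D => //; exact: l1N. Qed.

Lemma l1Z (c : R[i]) f : l1 f -> l1 (fun n => c *: f n).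
Proof. by move=> /l1P[s hs]; exact: l1le_l1 (l1leZ c hs). Qed.

(** The integers from [-n] to [n - 1], which are the indices of the [n]-th partial sums of the two
    halves in [zsum]. *)
Definition zrange (n : nat) : seq int :=
  [seq k%:Z | k <- iota 0 n] ++ [seq - k.+1%:Z | k <- iota 0 n].

Lemma uniq_zrange n : uniq (zrange n).
Proof.
rewrite cat_uniq !map_inj_uniq ?iota_uniq//=; last 2 first.
- by move=> j k /oppr_inj[].
- by move=> j k [].
rewrite andbT; apply/hasPn => k /mapP[j _ ->]; apply/mapP => -[i _].
by lia.
Qed.

Lemma mem_zrange n k : (absz k < n)%N -> k \in zrange n.
Proof.
rewrite mem_cat => kn; apply/orP; case: k kn => k kn; [left|right].
  by apply/mapP; exists k => //; rewrite mem_iota.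
by apply/mapP; exists k; [rewrite mem_iota /=; lia | rewrite NegzE].
Qed.

Definition zpart F n : A := \sum_(k <- zrange n) F k.

Lemma zpartE F n : zpart F n =
  series (fun k : nat => F k%:Z) n + series (fun k : nat => F (- k.+1%:Z)) n.
Proof. by rewrite /zpart big_cat !big_map /series /= /index_iota !subn0. Qed.

Lemma sumle_uniq (x : int -> R) t (s : seq int) : uniq s -> (forall n, 0 <= x n) ->
  sumle x t -> \sum_(k <- s) x k <= t.
Proof.
move=> us x0 h; rewrite -lee_fin (le_trans _ h)// -sumEFin fsbig_seq//.
by apply: fsum_le_esum; exact: finite_seq.
Qed.

Lemma zpart_cvg F : l1 F -> zpart F @ \oo --> zsum F.
Proof.
move=> /l1P[t ht]; rewrite (funext (zpartE F)) /zsum.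
have hb (phi : nat -> int) n : injective phi ->
    \sum_(0 <= k < n) rnorm (F (phi k)) <= t.
  move=> inj; rewrite -(big_map phi predT (fun k => rnorm (F k))).
  apply: sumle_uniq => //; last by move=> k; exact: rnorm_ge0.
  by rewrite map_inj_uniq// iota_uniq.
apply: cvgD.
- have : cvgn (series (fun k : nat => F k%:Z)) => //.
  by apply: (@cvg_series_rnorm _ _ _ t) => n; apply: (hb Posz) => j k [].
- have : cvgn (series (fun k : nat => F (- k.+1%:Z))) => //.
  apply: (@cvg_series_rnorm _ _ _ t) => n.
  by apply: (hb (fun k => - k.+1%:Z)) => j k /oppr_inj[].
Qed.

Lemma zsumP F : l1 F -> forall e : R, 0 < e ->
  exists N : nat, forall n, (N <= n)%N -> rnorm (zsum F - zpart F n) <= e.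
Proof. by move=> /zpart_cvg/cvg_rnormP. Qed.

Lemma zsum_unique F a : l1 F ->
  (forall e : R, 0 < e ->
     exists N : nat, forall n, (N <= n)%N -> rnorm (a - zpart F n) <= e) ->
  zsum F = a.
Proof.
move=> /zpart_cvg hF /cvg_rnormP ha.
exact: (cvg_unique _ hF ha).
Qed.

Lemma rnorm_zpart F t n : l1le F t -> rnorm (zpart F n) <= t.
Proof.
move=> h; apply: le_trans (rnorm_sum _ _) _.
apply: sumle_uniq => //; [exact: uniq_zrange|by move=> k; exact: rnorm_ge0].
Qed.

Lemma rnorm_zsum F t : l1le F t -> rnorm (zsum F) <= t.
Proof.
move=> h; apply/ler_addgt0Pr => e e0.
have [N /(_ N (leqnn _)) hN] := zsumP (l1le_l1 h) e0.
rewrite -(subrK (zpart F N) (zsum F)) addrC.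
by apply: le_trans (rnormD _ _) _; rewrite lerD// rnorm_zpart.
Qed.

Lemma zsumD F G : l1 F -> l1 G -> zsum (fun n => F n + G n) = zsum F + zsum G.
Proof.
move=> hF hG; apply: zsum_unique => [|e e0]; first exact: l1D.
have e20 : 0 < e / 2 by rewrite divr_gt0.
have [N hN] := zsumP hF e20; have [M hM] := zsumP hG e20.
exists (maxn N M) => n; rewrite geq_max => /andP[/hN h1 /hM h2].
rewrite /zpart big_split/= opprD addrACA (le_trans (rnormD _ _))//.
by rewrite (splitr e) lerD.
Qed.

Lemma zsum_comp F (T : A -> A) C : l1 F -> 0 <= C ->
  (forall a b, T (a + b) = T a + T b) -> (forall a, rnorm (T a) <= C * rnorm a) ->
  zsum (fun n => T (F n)) = T (zsum F).
Proof.
move=> hF C0 TD TC.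
have T0 : T 0 = 0 by apply: (addrI (T 0)); rewrite -TD !addr0.
have TN a : T (- a) = - T a by apply/eqP; rewrite -subr_eq0 opprK -TD addNr T0.
apply: zsum_unique => [|e e0].
  have /l1P[t ht] := hF.
  apply: (@l1le_l1 _ (C * t)); apply: (@le_sumle _ _ _ (fun n => C * rnorm (F n)) (C * t)) => //.
  by apply: sumleZ => // n; exact: rnorm_ge0.
have C1 : 0 < C + 1 by rewrite ltr_wpDl.
have [N hN] := zsumP hF (divr_gt0 e0 C1).
exists N => n /hN h.
have -> : zpart (fun n => T (F n)) n = T (zpart F n).
  by rewrite /zpart (big_morph T TD T0).
rewrite -TN -TD (le_trans (TC _))//.
rewrite (le_trans (ler_wpM2l C0 h))// mulrC -mulrA ger_pMr//.
by rewrite mulrC ler_pdivrMr// mul1r lerDl.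
Qed.

Lemma zsum_single F k : (forall n, n != k -> F n = 0) -> zsum F = F k.
Proof.
move=> h; apply: zsum_unique => [|e e0].
  apply: (@l1le_l1 _ (rnorm (F k))).
  by apply: (@sumle_single _ _ k) => [|i /h ->]; rewrite ?rnorm_ge0// rnorm0.
exists (absz k).+1 => n kn; rewrite /zpart (big_rem k) ?mem_zrange//=.
rewrite big_seq big1 ?addr0 ?subrr ?rnorm0 ?ltW// => i.
by rewrite mem_rem_uniq ?uniq_zrange// inE => /andP[/h].
Qed.

Definition single (k : int) a : int -> A := fun n => if n == k then a else 0.

Lemma l1le_single k a : l1le (single k a) (rnorm a).
Proof.
have {2}-> : a = single k a k by rewrite /single eqxx.
apply: (@sumle_single _ _ k (fun n => rnorm (single k a n))); first exact: rnorm_ge0.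
by move=> i /negPf ik; rewrite /single ik rnorm0.
Qed.

Lemma l1_single k a : l1 (single k a).
Proof. exact: l1le_l1 (l1le_single k a). Qed.

Definition trunc (s : seq int) F : int -> A := fun n => if n \in s then F n else 0.

Lemma trunc_ind (Q : (int -> A) -> Prop) : Q (fun=> 0) ->
  (forall F G, Q F -> Q G -> Q (fun n => F n + G n)) ->
  (forall k a, Q (single k a)) -> forall s F, Q (trunc s F).
Proof.
move=> Q0 QD Q1 s F; elim: s => [|k s IH]; first exact: Q0.
(* If [k] occurs again in [s], its coefficient is already counted there and the new term must be
   0. *)
have -> : trunc (k :: s) F = (fun n => single k (if k \in s then 0 else F k) n + trunc s F n).
  apply/funext => n; rewrite /trunc /single inE; have [->|nk] := eqVneq n k.
    by case: ifP; rewrite ?add0r ?addr0.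
  by rewrite add0r.
exact: QD.
Qed.

Lemma l1_trunc F e : l1 F -> 0 < e ->
  exists s : seq int, l1le (fun n => F n - trunc s F n) e.
Proof.
move=> /l1P[t ht] e0; have [D hD] := sumle_tail (fun n => rnorm_ge0 (F n)) ht e0.
exists (zrange D.+1); apply: le_sumle hD => // n; rewrite /trunc; case: ifP => [_|nD].
  by rewrite subrr rnorm0; case: ifP => // _; exact: rnorm_ge0.
by case: ifP => [nD'|_]; [rewrite mem_zrange in nD|rewrite subr0].
Qed.

(* A bounded additive map on l1 is determined by its values on single coefficients. *)
Lemma l1_density (Th : (int -> A) -> A) C : 0 <= C ->
  (forall F G, l1 F -> l1 G -> Th (fun n => F n + G n) = Th F + Th G) ->
  (forall F t, l1le F t -> rnorm (Th F) <= C * t) ->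
  (forall k a, Th (single k a) = 0) -> forall F, l1 F -> Th F = 0.
Proof.
move=> C0 ThD ThC Th1 F hF.
have E0 : (fun=> 0) = single 0 0 by apply/funext => n; rewrite /single if_same.
have [trunc_l1 Thtrunc] : (forall s, l1 (trunc s F)) /\ (forall s, Th (trunc s F) = 0).
  apply/all_and2 => s.
  apply: (@trunc_ind (fun G => l1 G /\ Th G = 0)).
  - by rewrite E0; split; [exact: l1_single|exact: Th1].
  - by move=> G H [hG Th_G] [hH Th_H]; split; [exact: l1D|rewrite ThD// Th_G Th_H addr0].
  - by move=> k a; split; [exact: l1_single|exact: Th1].
apply: rnorm_small => e e0.
have C1 : 0 < C + 1 by rewrite ltr_wpDl.
have [s hs] := l1_trunc hF (divr_gt0 e0 C1).
have -> : F = (fun n => trunc s F n + (F n - trunc s F n)).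
  by apply/funext => n; rewrite addrC subrK.
rewrite ThD ?Thtrunc ?add0r//; last exact: l1le_l1 hs.
rewrite (le_trans (ThC _ _ hs))// mulrC -mulrA ger_pMr//.
by rewrite mulrC ler_pdivrMr// mul1r lerDl.
Qed.

(** Density in the form used for identities such as associativity: it suffices to compare both sides
    on single coefficients. *)
Lemma l1_ext (Phi Psi : (int -> A) -> A) C D : 0 <= C -> 0 <= D ->
  (forall F G, l1 F -> l1 G -> Phi (fun n => F n + G n) = Phi F + Phi G) ->
  (forall F G, l1 F -> l1 G -> Psi (fun n => F n + G n) = Psi F + Psi G) ->
  (forall F t, l1le F t -> rnorm (Phi F) <= C * t) ->
  (forall F t, l1le F t -> rnorm (Psi F) <= D * t) ->
  (forall k a, Phi (single k a) = Psi (single k a)) -> forall F, l1 F -> Phi F = Psi F.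
Proof.
move=> C0 D0 PhiD PsiD PhiC PsiC eqs F hF; apply/eqP; rewrite -subr_eq0; apply/eqP.
apply: (@l1_density (fun G => Phi G - Psi G) (C + D)) => //.
- exact: addr_ge0.
- by move=> G H hG hH; rewrite PhiD// PsiD// opprD addrACA.
- move=> G t hG; rewrite (le_trans (rnormB _ _))// mulrDl lerD//.
    exact: PhiC.
  exact: PsiC.
- by move=> k a; rewrite eqs subrr.
Qed.

(** [zsum] sums along two fixed half-lines, which a reflection does not preserve, so invariance is
    obtained by density. *)
Lemma zsum_reflect F k : l1 F -> zsum (fun n => F (k - n)) = zsum F.
Proof.
have l1r t G : l1le G t -> l1le (fun n => G (k - n)) t.
  by rewrite /l1le (sumle_reflect k (fun n => rnorm (G n))).
have l1r' G : l1 G -> l1 (fun n => G (k - n)).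
  by move=> /l1P[t /l1r]; exact: l1le_l1.
apply: (@l1_ext (fun F => zsum (fun n => F (k - n))) zsum 1 1) => //.
- by move=> G H hG hH; rewrite zsumD//; exact: l1r'.
- exact: zsumD.
- by move=> G t /l1r; rewrite mul1r; exact: rnorm_zsum.
- by move=> G t; rewrite mul1r; exact: rnorm_zsum.
- move=> j a; rewrite (@zsum_single _ (k - j)); last first.
    move=> n nk; rewrite /single; case: eqP => // kj.
    by move: nk; rewrite -kj opprB addrC subrK eqxx.
  rewrite (@zsum_single (single j a) j) /single ?eqxx; last by move=> n /negPf ->.
  by rewrite opprB addrC subrK eqxx.
Qed.

End ZSum.

(** * The convolution algebra l1 *)

Section ConvAlgebra.
Context {R : realType} {A : banachAlgType R[i]}.
Implicit Types (a b : A) (f g h : int -> A) (p : R) (nu : int -> R).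

Lemma l1le_conv_term f g s t n : l1le f s -> l1le g t ->
  l1le (fun m => bmul (f (n - m)) (g m)) (s * t).
Proof.
move=> hf hg; apply: (@le_sumle _ _ _ (fun m => s * rnorm (g m)) (s * t)) => //.
  move=> m; apply: (le_trans (rnorm_bmul _ _)); apply: ler_wpM2r; first exact: rnorm_ge0.
  by apply: (sumle_term _ _ hf) => k; exact: rnorm_ge0.
by apply: sumleZ => //; [exact: l1le_ge0 hf|move=> m; exact: rnorm_ge0].
Qed.

Lemma l1_conv_term f g n : l1 f -> l1 g -> l1 (fun m => bmul (f (n - m)) (g m)).
Proof. by move=> /l1P[s hs] /l1P[t ht]; exact: l1le_l1 (l1le_conv_term n hs ht). Qed.

Lemma rnorm_conv f g n : l1 f -> l1 g ->
  ((rnorm (conv f g n))%:E <=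
   ecv (fun m => rnorm (g m)) (fun m => (rnorm (f m))%:E) n)%E.
Proof.
move=> hf hg; have := l1_conv_term n hf hg.
set F := (fun m => _) => hF.
have F0 m : 0 <= rnorm (F m) by exact: rnorm_ge0.
pose S := (\esum_(m in [set: int]) (rnorm (F m))%:E)%E.
have Sfin : S \is a fin_num by rewrite ge0_fin_numE// esum_ge0// => m _; rewrite lee_fin.
have hS : l1le F (fine S) by rewrite /l1le /sumle fineK.
apply: (@le_trans _ _ S); first by rewrite -(fineK Sfin) lee_fin rnorm_zsum.
by apply: le_esum => m _; rewrite -EFinM lee_fin mulrC rnorm_bmul.
Qed.

Lemma l1le_conv f g s t : l1le f s -> l1le g t -> l1le (conv f g) (s * t).
Proof.
move=> hf hg; have [hf1 hg1] := (l1le_l1 hf, l1le_l1 hg).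
have := @ecv_weighted_l1 R (fun=> 1) (fun m => rnorm (g m))
  (fun m => (rnorm (f m))%:E) t s.
rewrite /l1le /sumle (mulrC s t) => h; apply: (le_trans _ (h _ _ _ _ _ _ _)) => //.
- by apply: le_esum => n _; rewrite mul1e; exact: rnorm_conv.
- by move=> *; rewrite mulr1.
- by move=> n; exact: rnorm_ge0.
- by move=> n; rewrite lee_fin rnorm_ge0.
- exact: l1le_ge0 hf.
- by under eq_esum do rewrite mul1r.
- by under eq_esum do rewrite mul1e.
Qed.

Lemma l1_conv f g : l1 f -> l1 g -> l1 (conv f g).
Proof. by move=> /l1P[s hs] /l1P[t ht]; exact: l1le_l1 (l1le_conv hs ht). Qed.

Lemma convDl f g h : l1 f -> l1 g -> l1 h ->
  conv (fun n => f n + g n) h = (fun n => conv f h n + conv g h n).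
Proof.
move=> hf hg hh; apply/funext => n; rewrite /conv -zsumD; try exact: l1_conv_term.
by congr zsum; apply/funext => m; rewrite bmulDl.
Qed.

Lemma convDr f g h : l1 f -> l1 g -> l1 h ->
  conv h (fun n => f n + g n) = (fun n => conv h f n + conv h g n).
Proof.
move=> hf hg hh; apply/funext => n; rewrite /conv -zsumD; try exact: l1_conv_term.
by congr zsum; apply/funext => m; rewrite bmulDr.
Qed.

Lemma zsumZ (c : R[i]) f : l1 f -> zsum (fun n => c *: f n) = c *: zsum f.
Proof.
move=> hf; apply: (@zsum_comp _ _ f (fun a => c *: a) (complex.Re `|c|)) => //.
- by rewrite -ler0c RRe_real// ger0_real.
- by move=> a b; rewrite scalerDr.
- by move=> a; rewrite rnormZ.
Qed.

Lemma convZl (c : R[i]) f g : l1 f -> l1 g ->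
  conv (fun n => c *: f n) g = (fun n => c *: conv f g n).
Proof.
move=> hf hg; apply/funext => n; rewrite /conv -zsumZ; last exact: l1_conv_term.
by congr zsum; apply/funext => m; rewrite bmulZl.
Qed.

Lemma convZr (c : R[i]) f g : l1 f -> l1 g ->
  conv f (fun n => c *: g n) = (fun n => c *: conv f g n).
Proof.
move=> hf hg; apply/funext => n; rewrite /conv -zsumZ; last exact: l1_conv_term.
by congr zsum; apply/funext => m; rewrite bmulZr.
Qed.

Lemma convNl f g : l1 f -> l1 g -> conv (fun n => - f n) g = (fun n => - conv f g n).
Proof.
move=> hf hg; have := @convZl (-1) f g hf hg.
have -> : (fun n => -1 *: f n) = (fun n => - f n) by apply/funext=> n; rewrite scaleN1r.
by move=> ->; apply/funext=> n; rewrite scaleN1r.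
Qed.

Lemma convNr f g : l1 f -> l1 g -> conv f (fun n => - g n) = (fun n => - conv f g n).
Proof.
move=> hf hg; have := @convZr (-1) f g hf hg.
have -> : (fun n => -1 *: g n) = (fun n => - g n) by apply/funext=> n; rewrite scaleN1r.
by move=> ->; apply/funext=> n; rewrite scaleN1r.
Qed.

Lemma convBl f g h : l1 f -> l1 g -> l1 h ->
  conv (fun n => f n - g n) h = (fun n => conv f h n - conv g h n).
Proof.
by move=> hf hg hh; rewrite (@convDl f (fun n => - g n))//; [rewrite convNl|exact: l1N].
Qed.

Lemma convBr f g h : l1 f -> l1 g -> l1 h ->
  conv h (fun n => f n - g n) = (fun n => conv h f n - conv h g n).
Proof.
by move=> hf hg hh; rewrite (@convDr f (fun n => - g n))//; [rewrite convNr|exact: l1N].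
Qed.

Lemma conv_singlel k a g : conv (single k a) g = fun n => bmul a (g (n - k)).
Proof.
apply/funext => n; rewrite /conv (@zsum_single _ _ _ (n - k)).
  by rewrite /single opprB addrC subrK eqxx.
move=> m mk; rewrite /single; case: eqP => [km|_]; last exact: bmul0l.
by move: mk; rewrite -km opprB addrC subrK eqxx.
Qed.

Lemma conv_singler k a f : conv f (single k a) = fun n => bmul (f (n - k)) a.
Proof.
apply/funext => n; rewrite /conv (@zsum_single _ _ _ k); first by rewrite /single eqxx.
by move=> m /negPf mk; rewrite /single mk bmul0r.
Qed.

Lemma delta0E : delta0 = single 0 (bone : A).
Proof. by []. Qed.

Lemma l1_delta0 : l1 (delta0 : int -> A).
Proof. exact: l1_single. Qed.

Lemma conv1l f : conv delta0 f = f.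
Proof. by rewrite delta0E conv_singlel; apply/funext => n; rewrite subr0 bmul1l. Qed.

Lemma conv1r f : conv f delta0 = f.
Proof. by rewrite delta0E conv_singler; apply/funext => n; rewrite subr0 bmul1r. Qed.

Lemma conv_shiftl k f g n : conv (fun j => f (j - k)) g n = conv f g (n - k).
Proof. by rewrite /conv; congr zsum; apply/funext => m; rewrite addrAC. Qed.

(** Density in the first factor alone: convolving with a single coefficient on the left is a shift
    followed by a bounded left multiplication, which passes through the inner sum. *)
Lemma conv_assoc f g h : l1 f -> l1 g -> l1 h -> conv f (conv g h) = conv (conv f g) h.
Proof.
move=> hf hg hh; apply/funext => n.
have hgh := l1_conv hg hh.
have /l1P[s hs] := hg; have /l1P[t ht] := hh.
have s0 := l1le_ge0 hs; have t0 := l1le_ge0 ht.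
have bound F r : l1le F r -> rnorm (F n) <= r.
  by move=> hF; apply: (sumle_term _ _ hF) => m; exact: rnorm_ge0.
apply: (@l1_ext _ _ (fun F => conv F (conv g h) n) (fun F => conv (conv F g) h n)
  (s * t) (s * t)) => //; do ?exact: mulr_ge0.
- by move=> F G hF hG; rewrite convDl.
- by move=> F G hF hG; rewrite convDl// convDl//; exact: l1_conv.
- by move=> F r hF; rewrite mulrC; apply: bound; apply: l1le_conv => //; exact: l1le_conv.
- by move=> F r hF; rewrite mulrC mulrA; apply: bound; apply: l1le_conv => //; exact: l1le_conv.
- move=> k a; rewrite !conv_singlel.
  rewrite -(@zsum_comp _ _ (fun m => bmul (g (n - k - m)) (h m)) (bmul a) (rnorm a)).
  + by rewrite /conv; congr zsum; apply/funext => m; rewrite bmulA addrAC.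
  + exact: l1_conv_term.
  + exact: rnorm_ge0.
  + by move=> b c; rewrite bmulDr.
  + by move=> b; exact: rnorm_bmul.
Qed.

Lemma conv_inverse_unique f g g' : l1 f -> l1 g -> l1 g' ->
  conv_left_inverse f g -> conv_right_inverse f g' -> g = g'.
Proof. by move=> hf hg hg' gf fg'; rewrite -(conv1r g) -fg' conv_assoc// gf conv1l. Qed.

End ConvAlgebra.

(** * Weighted lp spaces and their intersections *)

Section WeightedSpaces.
Context {R : realType} {A : banachAlgType R[i]}.
Implicit Types (f g : int -> A) (p : R) (nu w : int -> R).

Definition lpsum p nu f (t : R) : Prop := sumle (fun n => (rnorm (f n) * nu n) `^ p) t.

(** The bound is a [p]-th power of a positive number, the form in which Minkowski takes it. *)
Lemma lpwP p nu f : 0 < p -> (forall n, 0 <= nu n) ->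
  lpw p nu f <-> exists2 t, 0 < t & lpsum p nu f (t `^ p).
Proof.
move=> p0 nu0.
have E : (\esum_(n in [set: int]) (rnorm (f n) `^ p * nu n `^ p)%:E =
    \esum_(n in [set: int]) ((rnorm (f n) * nu n) `^ p)%:E)%E.
  by apply: eq_esum => n _; rewrite powRM// rnorm_ge0.
rewrite /lpw /= E; split; last first.
  by move=> [t _ ht]; apply/esum_lt_pinfty => [n|]; [exact: powR_ge0|exists (t `^ p)].
move=> /esum_lt_pinfty[n|t ht]; first exact: powR_ge0.
have tp : 0 < t + 1.
  by rewrite ltr_wpDl//; apply: sumle_ge0 ht => n; exact: powR_ge0.
exists ((t + 1) `^ p^-1); first exact: powR_gt0.
rewrite /lpsum -powRrM mulVf ?gt_eqF// powRr1 ?(ltW tp)//.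
by apply: le_sumle ht => //; rewrite lerDl.
Qed.

End WeightedSpaces.

Section WeightedSpaceAlgebra.
Context {R : realType} {A : banachAlgType R[i]}.
Implicit Types (a : A) (f g : int -> A) (p : R) (nu w : int -> R).

Lemma lpw_le p nu w K : 0 < p -> 0 <= K -> (forall n, 0 <= nu n) -> (forall n, 0 <= w n) ->
  (forall n, nu n <= K * w n) -> lpw p w `<=` (lpw p nu : set (int -> A)).
Proof.
move=> p0 K0 nu0 w0 nuw f /(lpwP _ p0 w0)[t t0 ht].
have h n : (rnorm (f n) * nu n) `^ p <= K `^ p * (rnorm (f n) * w n) `^ p.
  rewrite -powRM ?mulr_ge0 ?rnorm_ge0//; apply: ge0_ler_powR; first exact: ltW.
  - by rewrite nnegrE mulr_ge0 ?rnorm_ge0.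
  - by rewrite nnegrE !mulr_ge0 ?rnorm_ge0.
  - by rewrite mulrCA ler_wpM2l ?rnorm_ge0.
rewrite /lpw /=.
apply: (@le_lt_trans _ _ ((K `^ p * t `^ p)%:E)); last by rewrite ltry.
have := @le_sumle _ _ _ _ (K `^ p * t `^ p) (K `^ p * t `^ p) h (lexx _).
rewrite /sumle => H; apply: le_trans (H _).
- by apply: le_esum => n _; rewrite powRM ?rnorm_ge0.
- by apply: sumleZ => // [|n]; exact: powR_ge0.
Qed.

Lemma lpw_single p nu k a : 0 < p -> (forall n, 0 <= nu n) -> lpw p nu (single k a).
Proof.
move=> p0 nu0; rewrite /lpw /=.
apply/esum_lt_pinfty; first by move=> n; rewrite mulr_ge0 ?powR_ge0.
exists (rnorm (single k a k) `^ p * nu k `^ p).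
apply: (@sumle_single _ _ k (fun n => rnorm (single k a n) `^ p * nu n `^ p)).
  by rewrite mulr_ge0 ?powR_ge0.
by move=> i /negPf ik; rewrite /single ik rnorm0 powR0 ?mul0r// gt_eqF.
Qed.

Lemma lpwD p nu f g : 1 <= p -> (forall n, 0 <= nu n) ->
  lpw p nu f -> lpw p nu g -> lpw p nu (fun n => f n + g n).
Proof.
move=> p1 nu0; have p0 : 0 < p by apply: lt_le_trans p1.
move=> /(lpwP _ p0 nu0)[s s0 hs] /(lpwP _ p0 nu0)[t t0 ht].
apply/(lpwP _ p0 nu0); exists (s + t); first exact: addr_gt0.
apply: (@le_sumle _ _ _ (fun n => (rnorm (f n) * nu n + rnorm (g n) * nu n) `^ p) ((s + t) `^ p)) => //.
  move=> n; apply: ge0_ler_powR; first exact: ltW.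
  - by rewrite nnegrE mulr_ge0 ?rnorm_ge0.
  - by rewrite nnegrE addr_ge0// mulr_ge0 ?rnorm_ge0.
  - by rewrite -mulrDl ler_wpM2r// rnormD.
by apply: sumle_minkowski => // n; rewrite mulr_ge0 ?rnorm_ge0.
Qed.

Lemma lpwZ p nu (c : R[i]) f : 0 < p -> (forall n, 0 <= nu n) ->
  lpw p nu f -> lpw p nu (fun n => c *: f n).
Proof.
move=> p0 nu0 /(lpwP _ p0 nu0)[s s0 hs]; rewrite /lpw /=.
apply/esum_lt_pinfty; first by move=> n; rewrite mulr_ge0 ?powR_ge0.
have c0 : 0 <= complex.Re `|c| by rewrite -ler0c RRe_real// ger0_real.
exists (complex.Re `|c| `^ p * s `^ p).
rewrite (@eq_sumle _ _ _ (fun n => complex.Re `|c| `^ p * (rnorm (f n) * nu n) `^ p)).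
  by apply: sumleZ => // [|n]; exact: powR_ge0.
by move=> n; rewrite rnormZ -!powRM ?mulr_ge0 ?rnorm_ge0// mulrA.
Qed.

Lemma lpw_conv p nu f g : 1 < p -> lp_algebra_weight p nu -> l1 f -> l1 g ->
  lpw p nu f -> lpw p nu g -> lpw p nu (conv f g).
Proof.
move=> p1 nualg hf hg; have [nu1 _] := nualg.
have p0 : 0 < p by apply: lt_trans p1.
have nu0 n : 0 <= nu n by rewrite (le_trans ler01).
move=> /(lpwP _ p0 nu0)[s s0 hs] /(lpwP _ p0 nu0)[t t0 ht].
have maj : lp_majorized nu p (fun n => (rnorm (f n))%:E) s.
  by exists (fun n => rnorm (f n)); split => // n; exact: rnorm_ge0.
have [y [y0 hy yp]] := lp_majorized_ecv p1 nualg (fun n => rnorm_ge0 (g n)) (ltW t0) (ltW s0) ht maj.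
apply/(lpwP _ p0 nu0); exists (t * s); first exact: mulr_gt0.
apply: le_sumle yp => // n; apply: ge0_ler_powR; first exact: ltW.
- by rewrite nnegrE mulr_ge0 ?rnorm_ge0.
- by rewrite nnegrE mulr_ge0.
- rewrite ler_wpM2r//; rewrite -lee_fin; apply: le_trans (hy n).
  exact: rnorm_conv.
Qed.

(** Hoelder against [nu ^-1], whose [q]-th powers are summable. *)
Lemma lpw_l1 p nu : 1 < p -> (forall n, 1 <= nu n) ->
  (\esum_(n in [set: int]) (nu n `^ (- conjugate_index p))%:E < +oo)%E ->
  lpw p nu `<=` (l1 : set (int -> A)).
Proof.
move=> p1 nu1 nus f.
have p0 : 0 < p by apply: lt_trans p1.
have [q0 pq] := conjugate_indexP p1; set q := conjugate_index p in nus q0 pq.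
have nu0 n : 0 < nu n by rewrite (lt_le_trans ltr01).
have nu0w n := ltW (nu0 n).
move=> /(lpwP _ p0 nu0w)[s s0 hs].
move: nus => /esum_lt_pinfty[n|t ht]; first exact: powR_ge0.
have t0 : 0 <= t by apply: sumle_ge0 ht => n; exact: powR_ge0.
apply/l1P; exists (s * t `^ q^-1).
rewrite /l1le (@eq_sumle _ _ _ (fun n => (rnorm (f n) * nu n) * (nu n)^-1)); last first.
  by move=> n; rewrite mulfK// gt_eqF.
apply: (sumle_hoelder p0 q0 pq) => //.
- by move=> n; rewrite mulr_ge0 ?rnorm_ge0.
- by move=> n; rewrite invr_ge0.
- exact: ltW.
- exact: powR_ge0.
- rewrite -powRrM mulVf ?gt_eqF// powRr1//.
  by rewrite (@eq_sumle _ _ _ (fun n => nu n `^ (- q)))// => n; rewrite powR_inv.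
Qed.

Lemma almost_monotone_lp_algebra p w :
  almost_monotone_algebra_weight p w -> lp_algebra_weight p w.
Proof. by case=> [[w1 _] [wc _] _ _]; split. Qed.

Lemma lpw_cap_subalgebra (p : nat -> R) (w : nat -> int -> R) :
  (forall n, 1 < p n) -> (forall n, almost_monotone_algebra_weight (p n) (w n)) ->
  l1_subalgebra A (lpw_cap A p w).
Proof.
move=> p1 aw.
have p0 n : 0 < p n by apply: lt_trans (p1 n).
have w1 n k : 1 <= w n k by case: (aw n) => [[]].
have w0 n k : 0 <= w n k by rewrite (le_trans ler01).
have sub : lpw_cap A p w `<=` l1.
  move=> f hf; apply: (lpw_l1 (p1 0%N) (w1 0%N) _ (hf 0%N I)).
  by case: (aw 0%N) => _ [_ hs] _ _; exact: hs.
split.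
- exact: sub.
- by move=> n _; exact: lpw_single.
- by move=> f g hf hg n _; exact: lpwD (ltW (p1 n)) (w0 n) (hf n I) (hg n I).
- by move=> c f hf n _; exact: lpwZ (p0 n) (w0 n) (hf n I).
- move=> f g hf hg n _.
  exact: lpw_conv (p1 n) (almost_monotone_lp_algebra (aw n)) (sub _ hf) (sub _ hg) (hf n I) (hg n I).
Qed.

End WeightedSpaceAlgebra.

(** * Neumann series *)

Section Neumann.
Context {R : realType} {A : banachAlgType R[i]}.
Implicit Types (a : A) (f g u : int -> A) (p : R) (nu sg : int -> R).

Lemma sumle_finite_support (s : {fset int}) (y : int -> R) : (forall n, 0 <= y n) ->
  sumle (fun n => if n \in s then y n else 0) (\sum_(n <- s) y n).
Proof.
move=> y0; rewrite /sumle -sumEFin.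
rewrite (@eq_esum _ _ _ _ (fun n => if n \in [set` s] then (y n)%:E else 0%E)); last first.
  by move=> n _; rewrite mem_setE; case: ifP.
rewrite -esum_mkcond esum_fset ?fsbig_finite//=; last by move=> *; rewrite lee_fin.
by rewrite set_fsetK.
Qed.

(** A Fatou property: on a finite set of indices some [G L] is uniformly [eta]-close to [g], and
    Minkowski charges this error to the gap [C' - C]. *)
Lemma lpsum_limit p nu (G : nat -> int -> A) g K0 C C' : 1 <= p ->
  (forall n, 0 <= nu n) -> 0 < C -> C < C' ->
  (forall n, (fun K => G K n) @ \oo --> g n) ->
  (forall K, (K0 <= K)%N -> lpsum p nu (G K) (C `^ p)) -> lpsum p nu g (C' `^ p).
Proof.
move=> p1 nu0 C0 CC' Gg hG; apply: sumle_fsetP => s.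
have p0 : 0 < p by apply: lt_le_trans p1.
pose V := \sum_(n <- s) nu n.
have V0 : 0 <= V by apply: sumr_ge0.
have V1 : 0 < 1 + V by rewrite ltr_wpDr.
have d0 : 0 < C' - C by rewrite subr_gt0.
(* The error [eta * nu] sums to at most [C' - C] over [s]; the 1 in the denominator avoids division
   by zero. *)
pose eta := (C' - C) / (1 + V).
have eta0 : 0 < eta by rewrite divr_gt0.
have [L [LK hL]] : exists L, (K0 <= L)%N /\
    forall n, n \in (s : seq int) -> rnorm (g n - G L n) <= eta.
  suff [L hL] : exists L0, forall L, (L0 <= L)%N ->
      forall n, n \in (s : seq int) -> rnorm (g n - G L n) <= eta.
    by exists (maxn K0 L); split; [exact: leq_maxl|apply: hL; exact: leq_maxr].
  elim: (s : seq int) => [|k r [L hL]]; first by exists 0%N.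
  have [N hN] := (cvg_rnormP _ _).1 (Gg k) eta eta0.
  exists (maxn L N) => M; rewrite geq_max => /andP[/hL h1 /hN h2] n.
  by rewrite inE => /predU1P[->|/h1].
pose x n := if n \in s then rnorm (G L n) * nu n else 0.
pose y n := if n \in s then eta * nu n else 0.
have x0 n : 0 <= x n by rewrite /x; case: ifP => // _; rewrite mulr_ge0 ?rnorm_ge0.
have y0 n : 0 <= y n by rewrite /y; case: ifP => // _; rewrite mulr_ge0 // ltW.
have hx : sumle (fun n => x n `^ p) (C `^ p).
  apply: le_sumle (hG L LK) => // n; rewrite /x; case: ifP => // _.
  by rewrite powR0 ?powR_ge0// gt_eqF.
have hy : sumle (fun n => y n `^ p) ((C' - C) `^ p).
  apply: sumle_powR => //.
  apply: (@le_sumle _ _ _ _ (\sum_(n <- s) eta * nu n)); last first.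
  - by apply: (@sumle_finite_support s (fun n => eta * nu n)) => n; rewrite mulr_ge0// ltW.
  - rewrite -mulr_sumr -/V /eta mulrAC ler_pdivrMr// ler_wpM2l ?(ltW d0)//.
    by rewrite lerDr.
  - by [].
have := sumle_minkowski p1 x0 y0 C0 d0 hx hy.
rewrite addrC subrK => /(sumle_fset s); apply: le_trans.
rewrite big_seq [leRHS]big_seq; apply: ler_sum => n ns.
apply: ge0_ler_powR; first exact: ltW.
- by rewrite nnegrE mulr_ge0 ?rnorm_ge0.
- by rewrite nnegrE addr_ge0.
- rewrite /x /y ns -mulrDl ler_wpM2r// -{1}(subrK (G L n) (g n)) addrC.
  by rewrite (le_trans (rnormD _ _))// lerD2l hL.
Qed.

(** Lets the limit lemma for lp serve in l1. *)
Lemma lpsum1E f t : lpsum 1 (fun=> 1) f t <-> l1le f t.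
Proof.
rewrite /lpsum /l1le (@eq_sumle _ _ _ (fun n => rnorm (f n)))// => n.
by rewrite mulr1 powRr1// rnorm_ge0.
Qed.

Definition cpow u (k : nat) : int -> A := iter k (fun f => conv f u) delta0.

Definition cpow_sum u (K : nat) (n : int) : A := \sum_(k < K) cpow u k n.

Lemma cpow_sumS u K : cpow_sum u K.+1 = (fun n => cpow_sum u K n + cpow u K n).
Proof. by apply/funext => n; rewrite /cpow_sum big_ord_recr. Qed.

Lemma cpow_sum0 u : cpow_sum u 0 = (fun=> 0).
Proof. by apply/funext => n; rewrite /cpow_sum big_ord0. Qed.

Lemma l1le_cpow u t k : l1le u t -> l1le (cpow u k) (rnorm (bone : A) * t ^+ k).
Proof.
move=> hu; elim: k => [|k IH]; first by rewrite mulr1; exact: l1le_single.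
by rewrite exprSr mulrA; exact: l1le_conv.
Qed.

Lemma l1_cpow u k : l1 u -> l1 (cpow u k).
Proof. by move=> /l1P[t /(@l1le_cpow _ _ k)]; exact: l1le_l1. Qed.

Lemma l1_zero : l1 (fun=> 0 : A).
Proof.
by apply: (@l1le_l1 _ _ _ 0); rewrite /l1le; under eq_sumle do rewrite rnorm0; exact: sumle0.
Qed.

Lemma l1_cpow_sum u K : l1 u -> l1 (cpow_sum u K).
Proof.
move=> hu; elim: K => [|K IH]; first by rewrite cpow_sum0; exact: l1_zero.
by rewrite cpow_sumS; apply: l1D => //; exact: l1_cpow.
Qed.

Lemma cpow_comm u k : l1 u -> conv u (cpow u k) = conv (cpow u k) u.
Proof.
move=> hu; elim: k => [|k IH]; first by rewrite /= conv1r conv1l.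
by rewrite /= conv_assoc// ?IH//; exact: l1_cpow.
Qed.

Lemma conv0l f : conv (fun=> 0 : A) f = (fun=> 0).
Proof.
have -> : (fun=> 0 : A) = single 0 0 by apply/funext => n; rewrite /single if_same.
by rewrite conv_singlel; apply/funext => n; rewrite bmul0l /single if_same.
Qed.

Lemma conv0r f : conv f (fun=> 0 : A) = (fun=> 0).
Proof.
have -> : (fun=> 0 : A) = single 0 0 by apply/funext => n; rewrite /single if_same.
by rewrite conv_singler; apply/funext => n; rewrite bmul0r /single if_same.
Qed.

Lemma cpow_sum_telescope_l u K : l1 u ->
  conv (cpow_sum u K) (fun n => delta0 n - u n) = (fun n => delta0 n - cpow u K n).
Proof.
move=> hu; have hd := @l1_delta0 R A; have hdu := l1B hd hu.
elim: K => [|K IH].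
  by rewrite cpow_sum0 conv0l; apply/funext => n; rewrite subrr.
rewrite cpow_sumS convDl ?IH//; [|exact: l1_cpow_sum|exact: l1_cpow].
rewrite convBr//; last exact: l1_cpow.
by rewrite conv1r; apply/funext => n; rewrite addrA subrK.
Qed.

Lemma cpow_sum_telescope_r u K : l1 u ->
  conv (fun n => delta0 n - u n) (cpow_sum u K) = (fun n => delta0 n - cpow u K n).
Proof.
move=> hu; have hd := @l1_delta0 R A; have hdu := l1B hd hu.
elim: K => [|K IH].
  by rewrite cpow_sum0 conv0r; apply/funext => n; rewrite subrr.
rewrite cpow_sumS convDr ?IH//; [|exact: l1_cpow_sum|exact: l1_cpow].
rewrite convBl//; last exact: l1_cpow.
by rewrite conv1l cpow_comm//; apply/funext => n; rewrite addrA subrK.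
Qed.

(** The bound is the finite geometric sum itself, so the induction step is an equality of bounds. *)
Lemma l1le_cpow_tail u K L : l1le u (1 / 4) ->
  l1le (fun n => cpow_sum u (K + L) n - cpow_sum u K n)
    (rnorm (bone : A) * (1 / 4) ^+ K * (4 / 3 * (1 - (1 / 4) ^+ L))).
Proof.
set e := rnorm _; move=> hu; elim: L => [|L IH].
  have -> : (fun n => cpow_sum u (K + 0) n - cpow_sum u K n) = (fun=> 0).
    by apply/funext => n; rewrite addn0 subrr.
  apply: (@le_l1le _ _ _ 0); last by rewrite /l1le; under eq_sumle do rewrite rnorm0; exact: sumle0.
  by rewrite expr0 subrr !mulr0.
have -> : (fun n => cpow_sum u (K + L.+1) n - cpow_sum u K n) =
    (fun n => (cpow_sum u (K + L) n - cpow_sum u K n) + cpow u (K + L) n).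
  by apply/funext => n; rewrite addnS cpow_sumS addrAC.
apply: le_l1le (l1leD IH (l1le_cpow (K + L) hu)).
by rewrite -/e exprD exprS le_eqVlt; apply/orP; left; apply/eqP; field.
Qed.

Lemma cpow_sum_cvg u : l1le u (1 / 4) -> exists g : int -> A,
  (forall n, (fun K => cpow_sum u K n) @ \oo --> g n) /\
  forall K, l1le (fun n => g n - cpow_sum u K n) (3 * rnorm (bone : A) * (1 / 4) ^+ K).
Proof.
move=> hu; have e0 := @rnorm_bone_gt0 R A; set e := rnorm _ in e0 *.
have q0 k : 0 < (1 / 4 : R) ^+ k by rewrite exprn_gt0//; lra.
have cv n : cvgn (fun K => cpow_sum u K n).
  have -> : (fun K => cpow_sum u K n) = series (fun k => cpow u k n).
    by apply/funext => K; rewrite /cpow_sum /series /= big_mkord.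
  apply: (@cvg_series_rnorm _ _ _ (2 * e)) => K.
  have : \sum_(0 <= k < K) rnorm (cpow u k n) <= \sum_(0 <= k < K) e * (1 / 4) ^+ k.
    apply: ler_sum => k _; apply: (sumle_term _ _ (l1le_cpow k hu)) => m.
    exact: rnorm_ge0.
  move=> /le_trans; apply.
  have -> : \sum_(0 <= k < K) e * (1 / 4) ^+ k = e * (4 / 3) * (1 - (1 / 4) ^+ K).
    elim: K => [|K IH]; first by rewrite big_geq// expr0 subrr mulr0.
    by rewrite big_nat_recr//= IH exprS; field.
  by have := q0 K; nra.
exists (fun n => limn (fun K => cpow_sum u K n)); split=> [n|K]; first exact: cv.
have B0 : 0 <= 3 * e * (1 / 4) ^+ K by rewrite !mulr_ge0// ltW.
apply: (lpsum1E _ _).1; rewrite -(powRr1 B0).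
(* The geometric tails are at most 4/3, rounded up to 2; passing to the limit needs a strictly
   larger constant, hence 3. *)
apply: (@lpsum_limit 1 _ (fun L n => cpow_sum u L n - cpow_sum u K n) _ K
  (2 * e * (1 / 4) ^+ K)) => //.
- by rewrite !mulr_gt0.
- by have := q0 K; nra.
- move=> n; apply: cvgB; [exact: cv|exact: cvg_cst].
- move=> L KL; rewrite powRr1; last by rewrite !mulr_ge0// ltW.
  apply/lpsum1E; rewrite -(subnKC KL); apply: le_l1le (l1le_cpow_tail K (L - K) hu).
  rewrite -/e; have := q0 K; have := q0 (L - K)%N => h1 h2.
  have h3 : 0 <= e * (1 / 4) ^+ K * (1 / 4) ^+ (L - K) by rewrite !mulr_ge0// ltW.
  by nra.
Qed.

Lemma expr_quarter_small (C e : R) : 0 < e -> exists K, C * (1 / 4) ^+ K <= e.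
Proof.
move=> e0; have [N hN] : exists N : nat, C / e <= N%:R.
  by exists (Num.truncn (C / e)).+1; rewrite ltW// truncnS_gt.
exists N; have h : N%:R * (1 / 4 : R) ^+ N <= 1.
  elim: N {hN} => [|N IH]; first by rewrite mul0r.
  rewrite exprS -[N.+1]addn1 natrD.
  have : 0 <= (1 / 4 : R) ^+ N by rewrite exprn_ge0//; lra.
  have : (1 / 4 : R) ^+ N <= 1 by rewrite exprn_ile1//; lra.
  by nra.
rewrite ler_pdivrMr// in hN.
have q0 : 0 <= (1 / 4 : R) ^+ N by rewrite exprn_ge0//; lra.
apply: (le_trans (ler_wpM2r q0 hN)); rewrite mulrAC.
by rewrite ger_pMl.
Qed.

Lemma rnorm_cpow u k n : l1 u ->
  ((rnorm (cpow u k n))%:E <=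
   iter k (ecv (fun m => rnorm (u m))) (edelta (rnorm (bone : A))) n)%E.
Proof.
move=> hu; elim: k n => [|k IH] n.
  by rewrite /= /delta0 /edelta; case: ifP => //; rewrite rnorm0.
apply: le_trans (rnorm_conv n (l1_cpow k hu) hu) _.
by apply: le_ecv => // m; exact: rnorm_ge0.
Qed.

Lemma lpsum_cpow_sum p nu sg u : 1 < p -> lp_algebra_weight p nu ->
  (forall n, 1 <= sg n) -> (forall m n, sg (m + n) <= sg m * sg n) ->
  tempered nu sg -> l1 u -> sumle (fun n => sg n * rnorm (u n)) (1 / 4) ->
  lpw p nu u ->
  exists2 C : R, 0 < C & forall K, lpsum p nu (cpow_sum u K) (C `^ p).
Proof.
move=> p1 nualg sg1 sgM temp hu husg.
have p0 : 0 < p by apply: lt_trans p1.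
have [nu1 _] := nualg.
have nu0 n : 0 <= nu n by rewrite (le_trans ler01).
move=> /lpwP[]// t _ ht.
have [C C0 hC] := iter_ecv_lp p1 nualg sg1 sgM temp (fun n => rnorm_ge0 (u n)) husg ht
  (@rnorm_bone_gt0 R A).
exists (5 * C); first by rewrite mulr_gt0.
move=> K.
have q0 k : 0 < (3 / 4 : R) ^+ k by rewrite exprn_gt0//; lra.
have q1 k : (3 / 4 : R) ^+ k <= 1 by rewrite exprn_ile1//; lra.
(* The first [K] powers of 3/4 add up to [4 - 4 (3/4)^K]; one more unit keeps the bound positive at
   [K = 0]. *)
have [] : lp_majorized nu p (fun n => (rnorm (cpow_sum u K n))%:E)
    (C * (5 - 4 * (3 / 4) ^+ K)).
  elim: K => [|K [y [y0 hy yp]]].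
    exists (fun=> 0); split => //; first by move=> n; rewrite cpow_sum0 rnorm0.
    rewrite (@eq_sumle _ _ _ (fun=> 0)).
      by apply: le_sumle (@sumle0 _ _) => //; exact: powR_ge0.
    by move=> n; rewrite mul0r powR0// gt_eqF.
  have -> : C * (5 - 4 * (3 / 4) ^+ K.+1) =
      C * (5 - 4 * (3 / 4) ^+ K) + C * (3 / 4) ^+ K by rewrite exprS; field.
  have [z [z0 hz zp]] : lp_majorized nu p
      (fun n => (y n)%:E + iter K (ecv (fun m => rnorm (u m))) (edelta (rnorm (bone : A))) n)%E
      (C * (5 - 4 * (3 / 4) ^+ K) + C * (3 / 4) ^+ K).
    apply: lp_majorizedD => //; first exact: ltW.
    - by rewrite mulr_gt0//; have := q1 K; lra.
    - by rewrite mulr_gt0.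
    - by exists y.
  exists z; split => // n; apply: le_trans (hz n); rewrite cpow_sumS.
  apply: (@le_trans _ _ ((rnorm (cpow_sum u K n))%:E + (rnorm (cpow u K n))%:E)%E).
    by rewrite -EFinD lee_fin rnormD.
  by apply: leeD => //; exact: rnorm_cpow.
move=> y [y0 hy yp].
apply: (@le_sumle _ _ _ (fun n => (y n * nu n) `^ p) ((C * (5 - 4 * (3 / 4) ^+ K)) `^ p)) => //.
- move=> n; apply: ge0_ler_powR; first exact: ltW.
  + by rewrite nnegrE mulr_ge0 ?rnorm_ge0.
  + by rewrite nnegrE mulr_ge0.
  + by rewrite ler_wpM2r// -lee_fin.
- apply: ge0_ler_powR; first exact: ltW.
  + by rewrite nnegrE mulr_ge0 ?(ltW C0)//; have := q1 K; lra.
  + by rewrite nnegrE mulr_ge0 ?(ltW C0).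
  + by rewrite mulrC ler_pM2r//; have := q0 K; lra.
Qed.

(** The inverse is obtained once, in l1, and the weighted bounds are proved for it afterwards, so a
    single [g] serves all the weights of an intersection. *)
Lemma neumann u : l1le u (1 / 4) -> exists g : int -> A,
  [/\ l1le g (3 * rnorm (bone : A)),
      conv_inverse (fun n => delta0 n - u n) g
    & forall p nu sg, 1 < p -> lp_algebra_weight p nu ->
      (forall n, 1 <= sg n) -> (forall m n, sg (m + n) <= sg m * sg n) ->
      tempered nu sg -> sumle (fun n => sg n * rnorm (u n)) (1 / 4) ->
      lpw p nu u -> lpw p nu g].
Proof.
move=> hu; have [g [gcv gtail]] := cpow_sum_cvg hu.
have hul := l1le_l1 hu.
have e0 := @rnorm_bone_gt0 R A; set e := rnorm _ in gtail e0 *.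
have hg : l1le g (3 * e).
  have := gtail 0%N; rewrite cpow_sum0 expr0 mulr1 /l1le.
  by under eq_sumle do rewrite subr0.
have hgl := l1le_l1 hg.
have hd := @l1_delta0 R A; have hdu := l1B hd hul.
have hdule : l1le (fun n => delta0 n - u n) (e + 1 / 4).
  by apply: l1leB => //; exact: l1le_single.
have term (F : int -> A) n t : l1le F t -> rnorm (F n) <= t.
  by move=> hF; apply: (sumle_term _ _ hF) => m; exact: rnorm_ge0.
(* Each product differs from [delta0] by a tail convolved with [delta0 - u], minus [cpow u K]; the
   constant adds the two bounds. *)
have small (x : A) : (forall K, rnorm x <= (3 * e * (e + 1 / 4) + e) * (1 / 4) ^+ K) -> x = 0.
  move=> h; apply: rnorm_small => d d0.
  have [K hK] := expr_quarter_small (3 * e * (e + 1 / 4) + e) d0.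
  exact: le_trans (h K) hK.
exists g; split => //; first split.
- apply/funext => n; apply/eqP; rewrite -subr_eq0; apply/eqP; apply: small => K.
  have hs := l1_cpow_sum K hul.
  have -> : conv g (fun n => delta0 n - u n) n - delta0 n =
      conv (fun n => g n - cpow_sum u K n) (fun n => delta0 n - u n) n - cpow u K n.
    by rewrite convBl// cpow_sum_telescope_l// opprB addrA addrAC addrK.
  apply: le_trans (rnormB _ _) _; rewrite mulrDl; apply: lerD.
    apply: le_trans (term _ n _ (l1le_conv (gtail K) hdule)) _.
    by rewrite mulrAC.
  exact: term (l1le_cpow K hu).
- apply/funext => n; apply/eqP; rewrite -subr_eq0; apply/eqP; apply: small => K.
  have hs := l1_cpow_sum K hul.
  have -> : conv (fun n => delta0 n - u n) g n - delta0 n =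
      conv (fun n => delta0 n - u n) (fun n => g n - cpow_sum u K n) n - cpow u K n.
    by rewrite convBr// cpow_sum_telescope_r// opprB addrA addrAC addrK.
  apply: le_trans (rnormB _ _) _; rewrite mulrDl; apply: lerD.
    apply: le_trans (term _ n _ (l1le_conv hdule (gtail K))) _.
    by rewrite mulrA (mulrC (e + _)).
  exact: term (l1le_cpow K hu).
- move=> p nu sg p1 nualg sg1 sgM temp husg hup.
  have p0 : 0 < p by apply: lt_trans p1.
  have nu0 n : 0 <= nu n by case: nualg => nu1 _; rewrite (le_trans ler01).
  have [C C0 hC] := lpsum_cpow_sum p1 nualg sg1 sgM temp hul husg hup.
  apply/lpwP => //; exists (C + 1); first by rewrite addr_gt0.
  apply: (@lpsum_limit p nu (cpow_sum u) g 0 C) => //; first exact: ltW.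
  by rewrite ltrDl.
Qed.

End Neumann.

(** * Wiener's lemma *)

(* Linear identities in a module, decided by comparing coefficients in the scalar
   ring; [ring] does not apply to modules. *)
Section LinearNormalization.
Context {K : comPzRingType} {V : lmodType K}.

Inductive linexp : Type :=
  | LVar of nat | LZero | LAdd of linexp & linexp | LOpp of linexp | LScale of K & linexp.

Fixpoint lin_eval (env : seq V) (e : linexp) : V :=
  match e with
  | LVar n => nth 0 env n
  | LZero => 0
  | LAdd e1 e2 => lin_eval env e1 + lin_eval env e2
  | LOpp e1 => - lin_eval env e1
  | LScale c e1 => c *: lin_eval env e1
  end.

Fixpoint lin_coef (i : nat) (e : linexp) : K :=
  match e with
  | LVar n => if eqn n i then 1 else 0
  | LZero => 0
  | LAdd e1 e2 => lin_coef i e1 + lin_coef i e2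
  | LOpp e1 => - lin_coef i e1
  | LScale c e1 => c * lin_coef i e1
  end.

Fixpoint lin_agree (n : nat) (e1 e2 : linexp) : Prop :=
  if n is m.+1 then lin_coef m e1 = lin_coef m e2 /\ lin_agree m e1 e2 else True.

Lemma lin_evalE env e : lin_eval env e = \sum_(i < size env) lin_coef i e *: nth 0 env i.
Proof.
elim: e => [n||e1 IH1 e2 IH2|e IH|c e IH] /=.
- have [nlt|nge] := ltnP n (size env).
    rewrite (bigD1 (Ordinal nlt))//= (introT eqnP erefl) scale1r big1 ?addr0// => i ni.
    have /negPf-> : ~~ eqn n i.
      by apply: contra ni => /eqnP ni; apply/eqP/val_inj.
    by rewrite scale0r.
  rewrite nth_default// big1// => i _.
  have /negPf-> : ~~ eqn n i.
    by apply/negP => /eqnP ni; have := ltn_ord i; rewrite -ni ltnNge nge.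
  by rewrite scale0r.
- by rewrite big1// => i _; rewrite scale0r.
- by rewrite IH1 IH2 -big_split; apply: eq_bigr => i _; rewrite scalerDl.
- by rewrite IH -sumrN; apply: eq_bigr => i _; rewrite scaleNr.
- by rewrite IH scaler_sumr; apply: eq_bigr => i _; rewrite scalerA.
Qed.

Lemma lin_agree_eval env e1 e2 :
  lin_agree (size env) e1 e2 -> lin_eval env e1 = lin_eval env e2.
Proof.
move=> h; rewrite !lin_evalE; apply: eq_bigr => i _; congr (_ *: _).
elim: (size env) i h => [[]//|n IH] i /= [h1 h2].
have [->//|ni] := eqVneq (i : nat) n.
have il : (i < n)%N by rewrite ltn_neqAle ni -ltnS ltn_ord.
exact: (IH (Ordinal il) h2).
Qed.

End LinearNormalization.

Ltac lin_atoms t env :=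
  lazymatch t with
  | (?a + ?b)%R => let env := lin_atoms a env in lin_atoms b env
  | (- ?a)%R => lin_atoms a env
  | (?c *: ?a)%R => lin_atoms a env
  | (0)%R => env
  | _ => match env with
         | context [cons t _] => env
         | _ => constr:(cons t env)
         end
  end.

Ltac lin_index t env :=
  lazymatch env with
  | cons t _ => constr:(O)
  | cons _ ?l => let n := lin_index t l in constr:(S n)
  end.

Ltac lin_reify K t env :=
  lazymatch t with
  | (?a + ?b)%R => let x := lin_reify K a env in let y := lin_reify K b env in
                   constr:(@LAdd K x y)
  | (- ?a)%R => let x := lin_reify K a env in constr:(@LOpp K x)
  | (?c *: ?a)%R => let x := lin_reify K a env in constr:(@LScale K c x)
  | (0)%R => constr:(@LZero K)
  | _ => let n := lin_index t env in constr:(@LVar K n)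
  end.

Ltac linear_over K :=
  cbv beta;
  lazymatch goal with
  | |- @eq ?V ?a ?b =>
    let env := lin_atoms a (@nil V) in
    let env := lin_atoms b env in
    let x := lin_reify K a env in
    let y := lin_reify K b env in
    refine (@lin_agree_eval K _ env x y _); simpl lin_agree; simpl lin_coef;
    repeat (apply: conj; first by ring); exact I
  end.

(** * The unit circle and sums over roots of unity *)

Section UnitCircle.
Context {R : realType}.
Local Open Scope complex_scope.
Implicit Types (t : R) (z : R[i]).

Definition cis t : R[i] := cos t +i* sin t.

Lemma cisD s t : cis (s + t) = cis s * cis t.
Proof. by rewrite /cis cosD sinD; simpc; congr (_ +i* _); rewrite addrC. Qed.

Lemma cis0 : cis 0 = 1.
Proof. by rewrite /cis cos0 sin0. Qed.

Lemma cis_exp t n : cis t ^+ n = cis (n%:R * t).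
Proof.
elim: n => [|n IH]; first by rewrite expr0 mul0r cis0.
by rewrite exprS IH -cisD -[n.+1]add1n natrD mulrDl mul1r.
Qed.

Lemma norm_cis t : `|cis t| = 1.
Proof. by rewrite normc_def /= cos2Dsin2 sqrtr1. Qed.

Lemma cis_pi : cis pi = -1.
Proof. by rewrite /cis cospi sinpi; simpc. Qed.

Lemma lipschitz1 (f f' : R -> R) : (forall x : R, is_derive x 1 f (f' x)) ->
  (forall x, `|f' x| <= 1) -> forall s t, `|f s - f t| <= `|s - t|.
Proof.
move=> df f1 s t; wlog st : s t / t <= s.
  move=> H; have [|/ltW] := leP t s; first exact: H.
  by rewrite distrC (distrC s); exact: H.
have dcont x : {for x, continuous f}.
  by apply: differentiable_continuous; apply/derivable1_diffP; exact: (@ex_derive _ _ _ _ _ _ _ (df x)).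
have [|c _ ->] := @MVT_segment _ f f' t s st (fun x _ => df x).
  by apply: continuous_subspaceT => x; exact: dcont.
by rewrite normrM ler_piMl.
Qed.

(** Both coordinates are 1-Lipschitz, which gives the square root of 2, rounded up to 2. *)
Lemma cis_lipschitz s t : complex.Re `|cis s - cis t| <= 2 * `|s - t|.
Proof.
have hc : `|cos s - cos t| <= `|s - t|.
  apply: (@lipschitz1 cos (fun x => - sin x)) => x.
  by rewrite normrN sin_max.
have hs : `|sin s - sin t| <= `|s - t|.
  apply: (@lipschitz1 sin cos) => x.
  by rewrite cos_max.
have -> : cis s - cis t = (cos s - cos t) +i* (sin s - sin t) by rewrite /cis; simpc.
rewrite normc_def /= -[leRHS]ger0_norm; last by rewrite mulr_ge0.
rewrite -sqrtr_sqr ler_sqrt ?sqr_ge0// exprMn real_normK ?num_real//.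
have h2 : (cos s - cos t) ^+ 2 <= (s - t) ^+ 2.
  by rewrite -real_normK ?num_real// -[leRHS]real_normK ?num_real// lerXn2r ?nnegrE.
have h3 : (sin s - sin t) ^+ 2 <= (s - t) ^+ 2.
  by rewrite -real_normK ?num_real// -[leRHS]real_normK ?num_real// lerXn2r ?nnegrE.
by have := sqr_ge0 (s - t); lra.
Qed.

(** A geometric sum whose ratio [q] satisfies [q ^ n = 1]. It differs from 1 because [q] is the
    square of [z ^ k], whose imaginary part [sin (k pi / n)] is positive. *)
Lemma cis_root_sum n k : (0 < k < n)%N ->
  \sum_(j < n) (cis (pi / n%:R) ^+ (2 * k)) ^+ j = 0.
Proof.
move=> /andP[k0 kn]; have n0 : 0 < n%:R :> R by rewrite ltr0n; lia.
set z := cis (pi / n%:R); pose q := z ^+ (2 * k).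
have zk : z ^+ k = cis (k%:R * (pi / n%:R)) by rewrite cis_exp.
have spos : 0 < sin (k%:R * (pi / n%:R) : R).
  apply: sin_gt0_pi; rewrite mulr_gt0 ?ltr0n// ?divr_gt0 ?pi_gt0//=.
  by rewrite mulrCA gtr_pMr ?pi_gt0// ltr_pdivrMr// mul1r ltr_nat.
have q1 : q - 1 != 0.
  rewrite subr_eq0 /q mulnC exprM sqrf_eq1 zk /cis; apply/norP; split;
    rewrite eq_complex /=; apply/negP => /andP[_]; rewrite ?oppr0 => /eqP h;
    by rewrite h ltxx in spos.
have z2n : z ^+ (2 * n) = 1.
  by rewrite mulnC exprM cis_exp mulrC divfK ?gt_eqF// cis_pi sqrrN expr1n.
have qn : q ^+ n = 1 by rewrite /q -exprM mulnAC exprM z2n expr1n.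
by apply: (mulfI q1); rewrite mulr0 -subrX1 qn subrr.
Qed.

End UnitCircle.

(** * Congruences modulo the left ideal of [f]; local resolvents *)

Section Wiener.
Context {R : realType} {A : banachAlgType R[i]}.
Implicit Types (a b : A) (f g h x y : int -> A) (z : R[i]).
Local Open Scope complex_scope.

Notation cnorm z := (complex.Re `|z|).

Lemma norm_expz_unit z (n : int) : `|z| = 1 -> `|z ^ n| = 1.
Proof.
move=> z1; case: n => n; first by rewrite -exprnP normrX z1 expr1n.
by rewrite NegzE -exprnN normfV normrX z1 expr1n invr1.
Qed.

Lemma l1le_unimodular f t z : `|z| = 1 -> l1le f t -> l1le (fun n => z ^ n *: f n) t.
Proof.
move=> z1; apply: l1le_le => n.
by rewrite rnormZ norm_expz_unit// mul1r.
Qed.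

Lemma l1_unimodular f z : `|z| = 1 -> l1 f -> l1 (fun n => z ^ n *: f n).
Proof. by move=> z1 /l1P[t ht]; exact: l1le_l1 (l1le_unimodular z1 ht). Qed.

Lemma rnorm_fourier f t z : `|z| = 1 -> l1le f t -> rnorm (fourier f z) <= t.
Proof. by move=> z1 hf; apply: rnorm_zsum; exact: l1le_unimodular. Qed.

Lemma fourierD f g z : `|z| = 1 -> l1 f -> l1 g ->
  fourier (fun n => f n + g n) z = fourier f z + fourier g z.
Proof.
move=> z1 hf hg; rewrite /fourier -zsumD; try exact: l1_unimodular.
by congr zsum; apply/funext => n; rewrite scalerDr.
Qed.

Lemma fourier_single k a z : fourier (single k a) z = z ^ k *: a.
Proof.
rewrite /fourier (@zsum_single _ _ _ k); first by rewrite /single eqxx.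
by move=> n /negPf nk; rewrite /single nk scaler0.
Qed.

Lemma l1_shift f k : l1 f -> l1 (fun n => f (n - k)).
Proof.
move=> /l1P[t ht]; apply: (@l1le_l1 _ _ _ t).
by rewrite /l1le (sumle_shift (- k) (fun n => rnorm (f n))).
Qed.

(* Modulo the image of [tau - z], where [tau] is the shift, [f] is the constant
   [fourier f z]. *)
Definition divisible_at z f := exists2 Y, l1 Y &
  forall n, f n - single 0 (fourier f z) n = Y (n - 1) - z *: Y n.

(** [tau^k - z^k] is a multiple of [tau - z], for negative [k] too since [z] is invertible; the
    induction runs in both directions. *)
Lemma divisible_at_single z k a : `|z| = 1 -> divisible_at z (single k a).
Proof.
move=> z1; have z0 : z != 0 by rewrite -normr_eq0 z1 oner_eq0.
rewrite /divisible_at fourier_single; elim/int_ind: k => [|k [Y hY YE]|k [Y hY YE]].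
- exists (fun=> 0); first exact: l1_zero.
  by move=> n; rewrite expr0z scale1r scaler0 !subrr.
- exists (fun n => Y (n - 1) + single 0 (z ^ k *: a) n).
    by apply: l1D; [exact: l1_shift|exact: l1_single].
  move=> n; rewrite exprSz.
  have -> : single k.+1 a n = single k a (n - 1).
    by rewrite /single; congr (if _ then _ else _); lia.
  have -> : single k a (n - 1) =
      Y (n - 1 - 1) - z *: Y (n - 1) + single 0 (z ^ k *: a) (n - 1).
    by rewrite -YE subrK.
  have -> : single 0 ((z * z ^ k) *: a) n = z *: single 0 (z ^ k *: a) n.
    by rewrite /single; case: ifP; rewrite ?scaler0// scalerA.
  rewrite /=; set p := Y (n - 1 - 1); set q := Y (n - 1).
  set x := single 0 _ n; set x' := single 0 _ (n - 1).
  linear_over R[i].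
- exists (fun n => Y (n + 1) - z^-1 *: single (-1) (z ^ (- k%:Z) *: a) n).
    apply: l1B; last by apply: l1Z; exact: l1_single.
    by have := @l1_shift Y (-1) hY; congr l1; apply/funext => n; rewrite opprK.
  move=> n; rewrite subrK.
  have -> : single (- k.+1%:Z) a n = single (- k%:Z) a (n + 1).
    by rewrite /single; congr (if _ then _ else _); lia.
  have -> : single (- k%:Z) a (n + 1) =
      Y n - z *: Y (n + 1) + single 0 (z ^ (- k%:Z) *: a) (n + 1).
    by have := YE (n + 1); rewrite addrK => <-; rewrite subrK.
  have -> : single (-1) (z ^ (- k%:Z) *: a) n = single 0 (z ^ (- k%:Z) *: a) (n + 1).
    by rewrite /single; congr (if _ then _ else _); lia.
  have -> : single (-1) (z ^ (- k%:Z) *: a) (n - 1) = single 0 (z ^ (- k%:Z) *: a) n.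
    by rewrite /single; congr (if _ then _ else _); lia.
  have -> : - k.+1%:Z = - k%:Z - 1 by lia.
  have -> : single 0 (z ^ (- k%:Z - 1) *: a) n = z^-1 *: single 0 (z ^ (- k%:Z) *: a) n.
    rewrite /single; case: ifP => _; rewrite ?scaler0// scalerA expfzDr//.
    by rewrite mulrC exprN1.
  set x := single _ _ (n + 1).
  rewrite /= [z *: (_ - _)]scalerBr scalerA mulfV// scale1r.
  set x2 := single 0 _ n; set p := Y n; set q := Y (n + 1).
  linear_over R[i].
Qed.

(** Divisibility is exact for a truncation of [f]. The tail, of norm [e / 2], goes into [E] together
    with its transform, of norm at most [e / 2]. *)
Lemma divisible_at_approx z f e : `|z| = 1 -> l1 f -> 0 < e ->
  exists Y E, [/\ l1 Y, l1le E e &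
    forall n, f n - single 0 (fourier f z) n = Y (n - 1) - z *: Y n + E n].
Proof.
move=> z1 hf e0; have e20 : 0 < e / 2 by rewrite divr_gt0.
have [s hs] := l1_trunc hf e20.
have [htr [Y hY YE]] : l1 (trunc s f) /\ divisible_at z (trunc s f).
  apply: (@trunc_ind _ _ (fun g => l1 g /\ divisible_at z g)).
  - have E0 : (fun=> 0) = single 0 (0 : A).
      by apply/funext => n; rewrite /single if_same.
    by rewrite E0; split; [exact: l1_single|exact: divisible_at_single].
  - move=> F G [hF [Y hY YE]] [hG [Z hZ ZE]]; split; first exact: l1D.
    exists (fun n => Y n + Z n); first exact: l1D.
    move=> n; rewrite fourierD// -[F n](subrK (single 0 (fourier F z) n)) YE.
    rewrite -[G n](subrK (single 0 (fourier G z) n)) ZE.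
    have -> : single 0 (fourier F z + fourier G z) n =
        single 0 (fourier F z) n + single 0 (fourier G z) n.
      by rewrite /single; case: ifP; rewrite ?addr0.
    linear_over R[i].
  - by move=> k a; split; [exact: l1_single|exact: divisible_at_single].
pose G n := f n - trunc s f n.
exists Y, (fun n => G n - single 0 (fourier G z) n); split => //.
  rewrite [e]splitr; apply: l1leB => //.
  by apply: le_l1le (l1le_single _ _); exact: rnorm_fourier.
move=> n; rewrite -YE.
have -> : fourier f z = fourier (trunc s f) z + fourier G z.
  rewrite -fourierD//; last exact: l1le_l1 hs.
  by congr fourier; apply/funext => m; rewrite /G addrC subrK.
have -> : single 0 (fourier (trunc s f) z + fourier G z) n =
    single 0 (fourier (trunc s f) z) n + single 0 (fourier G z) n.
  by rewrite /single; case: ifP; rewrite ?addr0.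
rewrite /G; linear_over R[i].
Qed.

Definition left_ideal f x := exists2 h, l1 h & forall n, x n = conv h f n.

Lemma left_idealD f x y : l1 f -> left_ideal f x -> left_ideal f y ->
  left_ideal f (fun n => x n + y n).
Proof.
move=> hf [h hh hx] [k hk ky]; exists (fun n => h n + k n); first exact: l1D.
by move=> n; rewrite convDl// hx ky.
Qed.

Lemma left_idealZ f (c : R[i]) x : l1 f -> left_ideal f x -> left_ideal f (fun n => c *: x n).
Proof.
move=> hf [h hh hx]; exists (fun n => c *: h n); first exact: l1Z.
by move=> n; rewrite convZl// hx.
Qed.

Lemma left_ideal_shift f x k : left_ideal f x -> left_ideal f (fun n => x (n - k)).
Proof.
move=> [h hh hx]; exists (fun n => h (n - k)); first exact: l1_shift.
by move=> n; rewrite conv_shiftl hx.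
Qed.

Lemma left_idealB f x y : l1 f -> left_ideal f x -> left_ideal f y ->
  left_ideal f (fun n => x n - y n).
Proof.
move=> hf hx hy; have := left_idealD hf hx (left_idealZ (-1) hf hy).
by congr left_ideal; apply/funext => n; rewrite scaleN1r.
Qed.

Lemma left_ideal0 f : left_ideal f (fun=> 0).
Proof. by exists (fun=> 0); [exact: l1_zero|move=> n; rewrite conv0l]. Qed.

Lemma left_ideal_sum f (I : Type) (r : seq I) (F : I -> int -> A) : l1 f ->
  (forall i, left_ideal f (F i)) -> left_ideal f (fun n => \sum_(i <- r) F i n).
Proof.
move=> hf hF; elim: r => [|i r IH].
  by under eq_fun do rewrite big_nil; exact: left_ideal0.
by under eq_fun do rewrite big_cons; exact: left_idealD.
Qed.

Definition resolvent_at f z g :=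
  left_ideal f (fun n => delta0 n - (g (n - 1) - z *: g n)).

(** Lipschitz dependence is asserted for one pair of points at a time, so different pairs may use
    different representatives at the same point. *)
Definition resolvent_pair f (K : R) z z' := exists g g' : int -> A,
  [/\ l1le g K, l1le g' K, l1le (fun n => g n - g' n) (K * cnorm (z - z')),
      resolvent_at f z g & resolvent_at f z' g'].

Lemma cnorm_ge0 z : 0 <= cnorm z.
Proof. by rewrite -ler0c RRe_real// ger0_real. Qed.

Lemma conv_shiftr f g k n : l1 f -> l1 g ->
  conv f (fun j => g (j - k)) n = conv f g (n - k).
Proof.
move=> hf hg.
have shiftE x : (fun j => x (j - k)) = conv x (single k (bone : A)).
  by rewrite conv_singler; apply/funext => j; rewrite bmul1r.
rewrite (shiftE g) conv_assoc//; last exact: l1_single.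
by rewrite conv_singler bmul1r.
Qed.

(* Near a point [z0] where [fourier f z0] has a left inverse [b], the element
   [delta0 - u z] with [u z] small is congruent to [(tau - z) y]; Neumann inversion of
   it makes the congruence exact, with Lipschitz dependence on [z]. *)
Lemma local_resolvent f z0 : l1 f -> `|z0| = 1 -> left_invertible (fourier f z0) ->
  exists r K : R, [/\ 0 < r, 0 < K &
    forall z z', cnorm (z - z0) <= r -> cnorm (z' - z0) <= r -> resolvent_pair f K z z'].
Proof.
move=> hf z01 [b bf].
have b1 : 0 < rnorm b + 1 by rewrite ltr_wpDl ?rnorm_ge0.
have [Y [E [hY hE fE]]] := divisible_at_approx z01 hf (divr_gt0 (divr_gt0 ltr01 (ltr0Sn R 7)) b1).
set eta := _ / (rnorm b + 1) in hE.
have beta : rnorm b * eta <= 1 / 8.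
  rewrite /eta mulrA ler_pdivrMr// mulrC ler_wpM2l ?lerDl//; lra.
(* Multiplying the approximate division of [f] by [b] gives [delta0 + E' = (tau - z0) y + b f], with
   the minus sign inside [y]. *)
pose y n := - bmul b (Y n); pose E' n := bmul b (E n).
have hE' : l1le E' (1 / 8).
  apply: le_l1le beta _.
  apply: (@le_sumle _ _ _ (fun n => rnorm b * rnorm (E n)) (rnorm b * eta)) => //.
    by move=> n; exact: rnorm_bmul.
  by apply: sumleZ => // [|n]; exact: rnorm_ge0.
have [t ht] : exists t, l1le y t.
  have /l1P[t ht] := hY; exists (rnorm b * t); apply: l1leN.
  apply: (@le_sumle _ _ _ (fun n => rnorm b * rnorm (Y n)) (rnorm b * t)) => //.
    by move=> n; exact: rnorm_bmul.
  by apply: sumleZ => // [|n]; exact: rnorm_ge0.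
have t0 := l1le_ge0 ht; have hy := l1le_l1 ht; have hE'1 := l1le_l1 hE'.
have t1 : 0 < t + 1 by rewrite ltr_wpDl.
have key n : delta0 n + E' n = y (n - 1) - z0 *: y n + conv (single 0 b) f n.
  rewrite conv_singlel subr0 /y /E'.
  have := congr1 (bmul b) (fE n); rewrite !(bmulDr, bmulNr) bmulZr.
  have -> : bmul b (single 0 (fourier f z0) n) = delta0 n.
    by rewrite /single /delta0; case: ifP; rewrite ?bf ?bmul0r.
  move=> h; have -> : bmul b (f n) = bmul b (f n) - delta0 n + delta0 n by rewrite subrK.
  rewrite h; linear_over R[i].
(* For [|z - z0| <= r] the term [(z - z0) y] has norm at most 1/8; with the 1/8 of [E'] this makes
   1/4, the threshold for the Neumann series. *)
pose r := 1 / 8 / (t + 1).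
have r0 : 0 < r by rewrite divr_gt0//; lra.
pose u z n := (z - z0) *: y n - E' n.
have hu z : cnorm (z - z0) <= r -> l1le (u z) (1 / 4).
  move=> zr; apply: le_l1le (l1leB (l1leZ (z - z0) ht) hE').
  have : cnorm (z - z0) * t <= r * (t + 1).
    by apply: ler_pM => //; [exact: cnorm_ge0|rewrite lerDl].
  rewrite /r divfK ?gt_eqF//; lra.
have e0 := @rnorm_bone_gt0 R A; set e := rnorm _ in e0.
(* [3 e t] bounds the resolvents, the second term is the Lipschitz constant found below, and 1 makes
   [K] positive. *)
pose K := 3 * e * t + 3 * e * t * (3 * e) * t + 1.
have et0 : 0 <= 3 * e * t by rewrite !mulr_ge0// ltW.
have eet0 : 0 <= 3 * e * t * (3 * e) * t by rewrite !mulr_ge0// ltW.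
have K0 : 0 < K by rewrite ltr_wpDl// addr_ge0.
have hd := @l1_delta0 R A; have hsb := @l1_single R A 0 b.
have res z : cnorm (z - z0) <= r -> exists v, [/\ l1le v (3 * e),
    conv_inverse (fun n => delta0 n - u z n) v & resolvent_at f z (conv v y)].
  move=> zr; have huz := l1le_l1 (hu z zr).
  have [v [hv [vu uv] _]] := neumann (hu z zr); exists v; split => //.
  have hv1 := l1le_l1 hv.
  exists (conv v (single 0 b)); first exact: l1_conv.
  move=> n; rewrite -(conv_shiftr 1 n hv1 hy) -[in delta0 n]vu.
  have -> : (fun n => delta0 n - u z n) =
      (fun n => (y (n - 1) - z *: y n) + conv (single 0 b) f n).
    apply/funext => m.
    have -> : y (m - 1) - z *: y m + conv (single 0 b) f m =
        delta0 m + E' m + (z0 - z) *: y m.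
      rewrite key; set p := y (m - 1); set q := conv _ _ _.
      by linear_over R[i].
    rewrite /u; set p := y m; linear_over R[i].
  have hsy : l1 (fun n => y (n - 1)) by exact: l1_shift.
  have hzy : l1 (fun n => z *: y n) by exact: l1Z.
  rewrite convDr//; [|exact: l1B|exact: l1_conv].
  rewrite convBr// convZr// -conv_assoc//.
  set p := conv v _ n; set q := conv v y n; set s := conv v _ n.
  by linear_over R[i].
exists r, K; split => // z z' zr zr'.
have [v [hv [vu _] resv]] := res z zr.
have [v' [hv' [vu' uv'] resv']] := res z' zr'.
have [hv1 hv1'] := (l1le_l1 hv, l1le_l1 hv').
have [huz huz'] := (l1le_l1 (hu z zr), l1le_l1 (hu z' zr')).
exists (conv v y), (conv v' y); split => //.
- by apply: le_l1le (l1le_conv hv ht); rewrite /K -addrA lerDl addr_ge0.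
- by apply: le_l1le (l1le_conv hv' ht); rewrite /K -addrA lerDl addr_ge0.
pose w n := (z - z') *: y n.
have hw : l1le w (cnorm (z - z') * t) by exact: l1leZ.
have hw1 := l1le_l1 hw.
have hvw : l1 (conv v w) by exact: l1_conv.
have hdu : l1 (fun n => delta0 n - u z n) by exact: l1B.
have hdu' : l1 (fun n => delta0 n - u z' n) by exact: l1B.
(* The resolvent identity [v - v' = v w v'] with [w = u z - u z'], which is proportional to
   [z - z']. *)
have vE : v = (fun n => v' n + conv (conv v w) v' n).
  rewrite -[in LHS](conv1r v) -[in conv v delta0]uv' conv_assoc//.
  have -> : (fun n => delta0 n - u z' n) = (fun n => (delta0 n - u z n) + w n).
    apply/funext => n; rewrite /u /w; set p := y n; set q := E' n; set d := delta0 n.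
    by linear_over R[i].
  rewrite convDr//; have -> : conv v (fun n => delta0 n - u z n) = delta0 by exact: vu.
  by rewrite convDl// conv1l.
have -> : (fun n => conv v y n - conv v' y n) = conv (conv (conv v w) v') y.
  apply/funext => n; rewrite {1}vE convDl//; last exact: l1_conv.
  by rewrite addrAC subrr add0r.
have := l1le_conv (l1le_conv (l1le_conv hv hw) hv') ht.
apply: le_l1le; have := cnorm_ge0 (z - z').
set c := cnorm _ => c0.
have -> : 3 * e * (c * t) * (3 * e) * t = 3 * e * t * (3 * e) * t * c by ring.
by apply: ler_wpM2r => //; rewrite /K; lra.
Qed.

(** One index [k] encodes both the radius [1 / (k + 1)] and the bound [k + 1], so a single
    application of compactness makes both uniform. *)
Lemma compact_resolvent f : l1 f ->
  (forall z, `|z| = 1 -> left_invertible (fourier f z)) ->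
  exists (d K : R), [/\ 0 < d, 0 < K & forall s t, 0 <= s <= 2 * pi -> `|t - s| <= d ->
    resolvent_pair f K (cis s) (cis t)].
Proof.
move=> hf inv.
pose P (k : nat) (s : R) := forall t, `|t - s| <= k.+1%:R^-1 ->
  resolvent_pair f k.+1%:R (cis s) (cis t).
have pairW K K' z z' : K <= K' -> resolvent_pair f K z z' -> resolvent_pair f K' z z'.
  move=> KK' [g [g' [hg hg' hgg' r1 r2]]]; exists g, g'; split => //.
  - exact: le_l1le hg.
  - exact: le_l1le hg'.
  - by apply: le_l1le hgg'; rewrite ler_wpM2r// cnorm_ge0.
have cpt : compact `[0 : R, 2 * pi] by exact: segment_compact.
have : \forall k \near \oo, `[0 : R, 2 * pi] `<=` P k.
  apply: (compact_near_coveringP _).1 => // s0 _.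
  have [r [K [r0 K0 H]]] := local_resolvent hf (norm_cis s0) (inv _ (norm_cis s0)).
  (* Two distances of [r / 4] in the angle become at most [r] on the circle, as [cis] has Lipschitz
     constant 2. *)
  have r4 : 0 < r / 4 by rewrite divr_gt0.
  have near_k : \forall k \near \oo, k.+1%:R^-1 <= r / 4 /\ K <= k.+1%:R.
    near=> k; split.
      rewrite -[leRHS]invrK lef_pV2 ?posrE ?invr_gt0 ?ltr0Sn//.
      rewrite ltW//; apply: le_lt_trans (_ : k%:R < _); last by rewrite ltr_nat.
      near: k; exact: nbhs_infty_ger.
    rewrite ltW//; apply: le_lt_trans (_ : k%:R < _); last by rewrite ltr_nat.
    near: k; exact: nbhs_infty_ger.
  have near_s : \forall s \near s0, `|s0 - s| <= r / 4.
    exact: (@cvgr_dist_le _ _ _ (nbhs s0) _ id s0 _ (r / 4) r4).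
  near=> s k => t ts.
  have [kr kK] : k.+1%:R^-1 <= r / 4 /\ K <= k.+1%:R by near: k.
  have sr : `|s0 - s| <= r / 4 by near: s.
  apply: (pairW K) => //; apply: H; apply: le_trans (cis_lipschitz _ _) _.
    by rewrite distrC; lra.
  have : `|t - s0| <= `|t - s| + `|s - s0|.
    by rewrite -[t - s0](subrKA s) ler_normD.
  have := le_trans ts kr; rewrite (distrC s s0); lra.
move=> [k _ /(_ k (leqnn _)) hk].
exists k.+1%:R^-1, k.+1%:R; split; [by rewrite invr_gt0|by []|].
by move=> s t s01 ts; apply: (hk s) => //=; rewrite in_itv.
Unshelve. all: by end_near.
Qed.

End Wiener.

(** * Averaging resolvents over roots of unity *)

Section WienerApprox.
Context {R : realType} {A : banachAlgType R[i]}.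
Implicit Types (f g h x y : int -> A) (z : R[i]).
Notation cnorm z := (complex.Re `|z|).

(** Applying [tau^n - z^n = (tau - z) (z^(n-1) + z^(n-2) tau + ... + tau^(n-1))] to the congruence
    [delta0 = (tau - z) g]. *)
Lemma resolvent_iter f z g n : l1 f -> resolvent_at f z g ->
  left_ideal f (fun m => \sum_(k < n) z ^+ (n - k.+1) *: delta0 (m - k%:Z)
    - (g (m - n%:Z) - z ^+ n *: g m)).
Proof.
move=> hf hg; elim: n => [|n IH].
  have -> : (fun m : int => \sum_(k < 0) z ^+ (0 - k.+1) *: delta0 (m - k%:Z)
      - (g (m - 0%:Z) - z ^+ 0 *: g m)) = (fun=> 0).
    by apply/funext => m; rewrite big_ord0 subr0 scale1r subrr subr0.
  exact: left_ideal0.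
have := left_idealD hf (left_ideal_shift n%:Z hg) (left_idealZ z hf IH).
congr left_ideal; apply/funext => m.
rewrite big_ord_recr /= subnn expr0 scale1r.
have -> : \sum_(i < n) z ^+ (n.+1 - i.+1) *: delta0 (m - i%:Z) =
    z *: \sum_(i < n) z ^+ (n - i.+1) *: delta0 (m - i%:Z) :> A.
  rewrite scaler_sumr; apply: eq_bigr => i _; rewrite scalerA -exprS.
  by congr (_ ^+ _ *: _); have := ltn_ord i; lia.
have -> : m - n.+1%:Z = m - n%:Z - 1 by lia.
rewrite exprS; set p := \sum_(i < n) _; set d := delta0 _; set a := g (m - n%:Z - 1).
set b := g (m - n%:Z); set c := g m; linear_over R[i].
Qed.

(** After multiplication by [z j], the coefficient of [tau^k] is the sum of the [z j ^ (n - k)]: it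
    vanishes for [0 < k < n] and equals [n s] for [k = 0]. *)
Lemma resolvent_family f (n : nat) (z : 'I_n -> R[i]) (g : 'I_n -> int -> A) (s : R[i]) :
  l1 f -> (0 < n)%N -> (forall j, z j ^+ n = s) ->
  (forall k, (0 < k < n)%N -> \sum_j z j ^+ k = 0) ->
  (forall j, resolvent_at f (z j) (g j)) ->
  let S m := \sum_j z j *: g j m in
  left_ideal f (fun m => (n%:R * s) *: delta0 m - (S (m - n%:Z) - s *: S m)).
Proof.
move=> hf n0 zn zk hg S.
have := left_ideal_sum (index_enum 'I_n) hf
  (fun j => left_idealZ (z j) hf (resolvent_iter n hf (hg j))).
congr left_ideal; apply/funext => m.
under eq_bigr => j _ do rewrite zn !scalerBr scalerA (mulrC (z j)) -scalerA.
rewrite !sumrB -scaler_sumr; congr (_ - _).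
under eq_bigr => j _ do rewrite scaler_sumr.
rewrite exchange_big /=; case: n n0 z g zn zk hg S => // n _ z g zn zk hg S.
have E (k : 'I_n.+1) : \sum_(i < n.+1) z i *: (z i ^+ (n.+1 - k.+1) *: delta0 (m - k%:Z))
    = (\sum_(i < n.+1) z i ^+ (n.+1 - k)) *: delta0 (m - k%:Z) :> A.
  rewrite scaler_suml; apply: eq_bigr => i _; rewrite scalerA -exprS.
  by congr (_ ^+ _ *: _); have := ltn_ord k; lia.
rewrite (eq_bigr _ (fun k _ => E k)) big_ord_recl /= subr0 subn0.
rewrite (eq_bigr _ (fun j _ => zn j)) sumr_const card_ord -[s *+ _]mulr_natl.
rewrite big1 ?addr0// => k _; rewrite zk ?scale0r//.
by have := ltn_ord k; rewrite /= /bump /=; lia.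
Qed.

Lemma l1le_sum (n : nat) (F : 'I_n -> int -> A) (t : R) :
  (forall j, l1le (F j) t) -> l1le (fun m => \sum_j F j m) (n%:R * t).
Proof.
elim: n F => [|n IH] F hF.
  rewrite mul0r /l1le; under eq_sumle do rewrite big_ord0 rnorm0; exact: sumle0.
have -> : (fun m => \sum_j F j m) =
    (fun m => \sum_(j < n) F (widen_ord (leqnSn n) j) m + F ord_max m).
  by apply/funext => m; rewrite big_ord_recr.
have -> : n.+1%:R * t = n%:R * t + t by rewrite -addn1 natrD mulrDl mul1r.
by apply: l1leD => //; exact: IH.
Qed.

(* Averaging the resolvents over the n-th roots of 1 and of -1 gives S and S' with
   (tau^n - 1) S = n and (tau^n + 1) S' = -n modulo the left ideal of [f], hence
   (tau^(2n) - 1) (S - S') = 2 n tau^n, while S - S' stays bounded as n grows. *)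
Lemma wiener_approx f (e : R) : l1 f ->
  (forall z, `|z| = 1 -> left_invertible (fourier f z)) -> 0 < e ->
  exists2 h : int -> A, l1 h & l1le (fun n => delta0 n - conv h f n) e.
Proof.
move=> hf inv e0; have [d [K [d0 K0 H]]] := compact_resolvent hf inv.
have pi0 := pi_gt0 R.
have [n [n0 nd ne]] : exists n : nat, [/\ (0 < n)%N, pi / n%:R <= d & 4 * pi * K / n%:R <= e].
  pose N := maxn (Num.truncn (pi / d)).+1 (Num.truncn (4 * pi * K / e)).+1.
  exists N; have N0 : (0 < N)%N by rewrite leq_max.
  have N0' : 0 < N%:R :> R by rewrite ltr0n.
  have big (x : R) M : (M.+1 <= N)%N -> M = Num.truncn x -> x <= N%:R.
    move=> MN Mx; rewrite ltW// (lt_le_trans (truncnS_gt x))// -Mx ler_nat//.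
  split => //.
    rewrite ler_pdivrMr// (mulrC d) -ler_pdivrMr//.
    by apply: (big _ (Num.truncn (pi / d))) => //; rewrite leq_maxl.
  rewrite ler_pdivrMr// (mulrC e) -ler_pdivrMr//.
  by apply: (big _ (Num.truncn (4 * pi * K / e))) => //; rewrite leq_maxr.
have n0' : 0 < n%:R :> R by rewrite ltr0n.
pose zeta : R[i] := cis (pi / n%:R).
have zetan : zeta ^+ n = -1 by rewrite cis_exp mulrC divfK ?gt_eqF// cis_pi.
(* Even powers of [zeta] are the n-th roots of 1, odd powers those of -1; [z j] and [z' j] are
   neighbours at angle [pi / n]. *)
pose z (j : 'I_n) := zeta ^+ (2 * j); pose z' (j : 'I_n) := zeta ^+ (2 * j).+1.
have zdist j : cnorm (z j - z' j) <= 2 * (pi / n%:R).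
  rewrite /z /z' !cis_exp; apply: le_trans (cis_lipschitz _ _) _.
  rewrite -mulrBl -(addn1 (2 * j)) natrD opprD addrA subrr sub0r mulN1r normrN.
  by rewrite ger0_norm// divr_ge0 ?ltW.
have /choice[G hG] : forall j : 'I_n, exists gg : (int -> A) * (int -> A),
    [/\ l1le gg.1 K, l1le gg.2 K,
      l1le (fun m => gg.1 m - gg.2 m) (K * cnorm (z j - z' j)),
      resolvent_at f (z j) gg.1 & resolvent_at f (z' j) gg.2].
  move=> j; have [||g [g' hgg]] := H ((2 * j)%:R * (pi / n%:R)) ((2 * j).+1%:R * (pi / n%:R)).
  - have pn : 0 < pi / n%:R :> R by rewrite divr_gt0.
    rewrite mulr_ge0 ?(ltW pn)//= natrM.
    have -> : 2 * pi = 2 * n%:R * (pi / n%:R) :> R by field; rewrite gt_eqF.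
    by rewrite ler_wpM2r ?(ltW pn)// ler_wpM2l// ler_nat ltnW.
  - rewrite -mulrBl -(addn1 (2 * j)) natrD addrAC subrr add0r mul1r ger0_norm//.
    by rewrite divr_ge0 ?ltW.
  - by exists (g, g'); rewrite /z /z' !cis_exp.
pose S m := \sum_j z j *: (G j).1 m; pose S' m := \sum_j z' j *: (G j).2 m.
have zn j : z j ^+ n = 1.
  by rewrite /z -exprM mulnC exprM zetan exprM sqrrN !expr1n.
have zn' j : z' j ^+ n = -1.
  by rewrite /z' -exprM mulnC exprM zetan exprS exprM sqrrN !expr1n mulr1.
have zk k : (0 < k < n)%N -> \sum_j z j ^+ k = 0.
  move=> kn; rewrite -[RHS](@cis_root_sum R n k kn); apply: eq_bigr => j _.
  by rewrite /z -!exprM; congr (_ ^+ _); lia.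
have zk' k : (0 < k < n)%N -> \sum_j z' j ^+ k = 0.
  move=> kn; rewrite -[RHS](mulr0 (zeta ^+ k)) -[X in _ * X](@cis_root_sum R n k kn) mulr_sumr.
  apply: eq_bigr => j _; rewrite /z' -!exprM -exprD; congr (_ ^+ _); lia.
have res1 j : resolvent_at f (z j) (G j).1 by case: (hG j).
have res2 j : resolvent_at f (z' j) (G j).2 by case: (hG j).
have L1 : left_ideal f (fun m => (n%:R * 1) *: delta0 m - (S (m - n%:Z) - 1 *: S m)).
  exact: resolvent_family hf n0 zn zk res1.
have L2 : left_ideal f (fun m => (n%:R * -1) *: delta0 m - (S' (m - n%:Z) - -1 *: S' m)).
  exact: resolvent_family hf n0 zn' zk' res2.
(* With the relations shifted by [tau^-n], this combination is
   [2 n delta0 - (tau^n - tau^-n) (S - S')], divided by [2 n]. *)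
have [h hh hE] := left_idealZ ((2 * n%:R)^-1) hf (left_idealD hf
  (left_idealD hf L1 (left_ideal_shift (- n%:Z) L1))
  (left_idealB hf (left_ideal_shift (- n%:Z) L2) L2)).
exists h => //.
pose D m := S m - S' m.
(* Each of the [n] terms splits as [z (g - g') + (z - z') g'], and both parts are bounded by
   [2 pi K / n]. *)
have hD : l1le D (4 * pi * K).
  have -> : D = (fun m => \sum_j (z j *: ((G j).1 m - (G j).2 m) + (z j - z' j) *: (G j).2 m)).
    apply/funext => m; rewrite /D /S /S' -sumrB; apply: eq_bigr => j _.
    set p := (G j).1 m; set q := (G j).2 m; linear_over R[i].
  have -> : 4 * pi * K = n%:R * (K * (2 * (pi / n%:R)) + (2 * (pi / n%:R)) * K).
    by field; rewrite gt_eqF.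
  apply: l1le_sum => j; have [h1 h2 h3 _ _] := hG j.
  apply: l1leD.
    apply: le_l1le (l1leZ (z j) h3).
    rewrite /z normrX norm_cis expr1n mul1r ler_wpM2l ?(ltW K0)//; exact: zdist.
  by apply: le_l1le (l1leZ (z j - z' j) h2); rewrite ler_wpM2r ?(ltW K0)// zdist.
have -> : (fun m => delta0 m - conv h f m) =
    (fun m => (2 * n%:R)^-1 *: (D (m - n%:Z) - D (m + n%:Z))).
  apply/funext => m; rewrite -hE !opprK addrK /D.
  set a := S (m - n%:Z); set b := S m; set c := S (m + n%:Z).
  set a' := S' (m - n%:Z); set b' := S' m; set c' := S' (m + n%:Z).
  set d1 := delta0 m; set d2 := delta0 _.
  have {1}-> : d1 = (2 * n%:R)^-1 *: ((2 * n%:R) *: d1).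
    by rewrite scalerA mulVf ?scale1r// mulf_neq0// pnatr_eq0// -lt0n.
  linear_over R[i].
have hD1 : l1le (fun m => D (m - n%:Z)) (4 * pi * K).
  by rewrite /l1le (sumle_shift (- n%:Z) (fun m => rnorm (D m))).
have hD2 : l1le (fun m => D (m + n%:Z)) (4 * pi * K).
  by rewrite /l1le (sumle_shift n%:Z (fun m => rnorm (D m))).
apply: le_l1le (l1leZ _ (l1leB hD1 hD2)).
apply: le_trans ne; rewrite normfV ger0_norm; last by rewrite mulr_ge0.
have -> : (2 * n%:R)^-1 = (((2 * n%:R)^-1 : R)%:C)%C :> R[i].
  by rewrite fmorphV rmorphM /= !rmorph_nat.
rewrite /= le_eqVlt; apply/orP; left; apply/eqP; field; rewrite gt_eqF//.
Qed.

End WienerApprox.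

(** * Construction of weights *)

Section OneSidedGrowth.
Context {R : realType}.
Implicit Types (V : nat -> R) (w nu : int -> R) (x : int -> R).

Lemma bernoulli (s : R) n : 1 <= s -> 1 + n%:R * (s - 1) <= s ^+ n.
Proof.
move=> s1; elim: n => [|n IH]; first by rewrite mul0r addr0 expr0.
rewrite exprS -addn1 natrD.
have := ler_wpM2l (le_trans ler01 s1) IH.
have : 0 <= n%:R * (s - 1) ^+ 2 by rewrite mulr_ge0 ?sqr_ge0.
by rewrite expr2; nra.
Qed.

Lemma expr_unbounded (s B : R) : 1 < s -> exists N : nat, forall n, (N <= n)%N -> B <= s ^+ n.
Proof.
move=> s1; have s10 : 0 < s - 1 by rewrite subr_gt0.
exists (Num.truncn (B / (s - 1))).+1 => n Nn.
have h1 : B / (s - 1) <= n%:R.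
  by rewrite ltW// (lt_le_trans (truncnS_gt _))// ler_nat.
have := bernoulli n (ltW s1); rewrite ler_pdivrMr// in h1; lra.
Qed.

Lemma eventually_bound V (l : R) N : 1 < l -> (forall n, 0 <= V n) ->
  (forall n, (N <= n)%N -> V n <= l ^+ n) ->
  exists2 M, 0 < M & forall n, V n <= M * l ^+ n.
Proof.
move=> l1 V0 h; have S0 : 0 <= \sum_(i < N) V i by apply: sumr_ge0.
have ln k : 1 <= l ^+ k by rewrite exprn_ege1// ltW.
exists (1 + \sum_(i < N) V i); first by rewrite ltr_wpDr.
move=> n; have [/h|nN] := leqP N n.
  move=> /le_trans; apply; apply: ler_peMl; last by rewrite lerDl.
  by rewrite (le_trans ler01).
apply: (@le_trans _ _ (1 + \sum_(i < N) V i)).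
  rewrite (bigD1 (Ordinal nN))//= addrCA lerDl.
  by rewrite addr_ge0// sumr_ge0.
by apply: ler_peMr => //; rewrite addr_ge0.
Qed.

(** Fekete's argument: divide [n] by a [d] with [V d < l ^ d]; the finitely many remainders go into
    the constant. *)
Lemma subexp_of_small V : (forall n, 1 <= V n) -> (forall m n, V (m + n)%N <= V m * V n) ->
  (forall l : R, 1 < l -> exists n, V n < l ^+ n) ->
  forall l : R, 1 < l -> exists2 M, 0 < M & forall n, V n <= M * l ^+ n.
Proof.
move=> V1 VM small l l1; have [d dl] := small l l1.
have V0 n : 0 <= V n by rewrite (le_trans ler01).
have l0 : 0 <= l by rewrite (le_trans ler01)// ltW.
have d0 : (0 < d)%N by rewrite lt0n; apply/eqP => d0; move: dl; rewrite d0 expr0 ltNge V1.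
have Vq q : V (q * d)%N <= V 0%N * l ^+ (q * d).
  elim: q => [|q IH]; first by rewrite mul0n expr0 mulr1.
  rewrite mulSn addnC; apply: le_trans (VM _ _) _.
  rewrite exprD mulrA; apply: ler_pM => //; exact: ltW.
pose M := 1 + \sum_(i < d) V i.
have hM r : (r < d)%N -> V r <= M.
  move=> rd; rewrite /M (bigD1 (Ordinal rd))//= addrCA lerDl.
  by rewrite addr_ge0// sumr_ge0.
have M0 : 0 < M by rewrite ltr_wpDr// sumr_ge0.
exists (V 0%N * M) => [|n]; first by rewrite mulr_gt0// (lt_le_trans ltr01).
rewrite {1}(divn_eq n d); apply: le_trans (VM _ _) _.
rewrite mulrAC; apply: ler_pM => //; last by apply: hM; rewrite ltn_mod.
apply: le_trans (Vq _) _; apply: ler_wpM2l => //.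
by rewrite ler_weXn2l ?(ltW l1)// {2}(divn_eq n d) leq_addr.
Qed.

(** Whether the infimum of the roots [V n ^ (1/n)] exceeds 1 or equals it, phrased without roots. *)
Lemma exponential_or_small V : (forall n, 1 <= V n) ->
  (exists2 S : R, 1 < S & forall n, S ^+ n <= V n) \/
  (forall l : R, 1 < l -> exists n, V n < l ^+ n).
Proof.
move=> V1; have [|h] := pselect (exists2 S : R, 1 < S & forall n, S ^+ n <= V n).
  by left.
right => l l1; apply: contrapT => hn; apply: h; exists l => // n.
by rewrite leNgt; apply/negP => hl; apply: hn; exists n.
Qed.

Lemma powR_root_le (x l : R) n : (0 < n)%N -> 0 <= x -> 0 <= l ->
  (x `^ n%:R^-1 <= l) = (x <= l ^+ n).
Proof.
move=> n0 x0 l0; have n0' : 0 < n%:R :> R by rewrite ltr0n.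
have E : x = (x `^ n%:R^-1) ^+ n.
  by rewrite -powR_mulrn ?powR_ge0// -powRrM mulVf ?gt_eqF// powRr1.
by rewrite [in RHS]E ler_pXn2r ?nnegrE ?powR_ge0// -lt0n.
Qed.

Lemma powR_root_ge (x l : R) n : (0 < n)%N -> 0 <= x -> 0 <= l ->
  (l <= x `^ n%:R^-1) = (l ^+ n <= x).
Proof.
move=> n0 x0 l0; have n0' : 0 < n%:R :> R by rewrite ltr0n.
have E : x = (x `^ n%:R^-1) ^+ n.
  by rewrite -powR_mulrn ?powR_ge0// -powRrM mulVf ?gt_eqF// powRr1.
by rewrite [in RHS]E ler_pXn2r ?nnegrE ?powR_ge0// -lt0n.
Qed.

Lemma admissible_eventually w (k : int) (l : R) : (forall n, 1 <= w n) -> admissible w ->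
  1 < l -> exists N, forall n, (N <= n)%N -> w (n%:Z * k) <= l ^+ n.
Proof.
move=> w1 /(_ k)/cvgrPdist_le/(_ (l - 1)) h l1.
have [|N _ hN] := h; first by rewrite subr_gt0.
exists N.+1 => n Nn; have n0 : (0 < n)%N by apply: leq_trans Nn.
rewrite -powR_root_le ?(le_trans ler01)//; last exact: ltW.
have := hN n (ltnW Nn); rewrite /= distrC => /(le_trans (ler_norm _)); lra.
Qed.

Lemma admissible_tempered w : (forall n, 1 <= w n) -> admissible w -> tempered w (fun=> 1).
Proof.
move=> w1 adm l l1.
have w0 n : 0 <= w n by rewrite (le_trans ler01).
have [N1 h1] := admissible_eventually 1 w1 adm l1.
have [N2 h2] := admissible_eventually (-1) w1 adm l1.
have [M1 M10 hM1] := eventually_bound l1 (fun n => w0 (n%:Z * 1)) h1.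
have [M2 M20 hM2] := eventually_bound l1 (fun n => w0 (n%:Z * -1)) h2.
have l0 k : 0 <= l ^+ k by rewrite exprn_ge0// (le_trans ler01)// ltW.
exists (M1 + M2) => [|n]; first exact: addr_gt0.
rewrite mulr1 mulrDl; have [n0|n0] := leP 0 n.
  have -> : n = (absz n)%:Z * 1 by lia.
  apply: le_trans (hM1 _) _; rewrite mulr1 absz_nat lerDl mulr_ge0// ltW//.
have -> : n = (absz n)%:Z * -1 by lia.
apply: le_trans (hM2 _) _.
have -> : absz ((absz n)%:Z * -1) = absz n by lia.
by rewrite lerDr mulr_ge0// ltW.
Qed.

Lemma admissible_not_exponential w (k : int) (S : R) : (forall n, 1 <= w n) -> 1 < S ->
  (forall n : nat, S ^+ n <= w (n%:Z * k)) -> nonadmissible w.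
Proof.
move=> w1 S1 wS adm; pose l := (1 + S) / 2.
have l1 : 1 < l by rewrite /l; lra.
have lS : l < S by rewrite /l; lra.
have [N hN] := admissible_eventually k w1 adm l1.
have := le_trans (wS N.+1) (hN N.+1 (leqnSn N)).
by apply/negP; rewrite -ltNge ltr_pXn2r// nnegrE; lra.
Qed.

Lemma tempered_admissible w : (forall n, 1 <= w n) -> tempered w (fun=> 1) -> admissible w.
Proof.
move=> w1 temp k; apply/cvgrPdist_le => e e0.
have w0 n : 0 <= w n by rewrite (le_trans ler01).
(* [1 + e] is the square of [s = l ^ (|k| + 1)]: for large [n] one factor [s ^ n] absorbs the
   constant [M], the other the growth [l ^ (n |k|)]. *)
pose l : R := (1 + e) `^ ((2 * (absz k).+1)%:R)^-1.
have e1 : 1 < 1 + e by rewrite ltrDl.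
have l1 : 1 < l.
  have : 1 `^ ((2 * (absz k).+1)%:R)^-1 < l.
    by apply: gt0_ltr_powR; rewrite ?nnegrE ?invr_gt0 ?ltr0n//; lra.
  by rewrite powR1.
have le : l ^+ (2 * (absz k).+1) = 1 + e.
  by rewrite -powR_mulrn ?powR_ge0// -powRrM mulVf ?pnatr_eq0// powRr1//; lra.
pose s := l ^+ (absz k).+1.
have s1 : 1 < s by rewrite exprn_egt1.
have ss : s ^+ 2 = 1 + e by rewrite -exprM mulnC le.
have [M M0 hM] := temp l l1.
have [N hN] := expr_unbounded M s1.
exists N.+1 => // n /= Nn; have n0 : (0 < n)%N by apply: leq_trans Nn.
have ge1 : 1 <= w (n%:Z * k) `^ n%:R^-1 by rewrite powR_root_ge// expr1n.
rewrite distrC ger0_norm ?subr_ge0// lerBlDr addrC powR_root_le//; last lra.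
apply: le_trans (hM _) _; rewrite mulr1 -ss -exprM mul2n -addnn exprD.
apply: ler_pM; [exact: ltW| by rewrite exprn_ge0//; lra| by apply: hN; exact: ltnW|].
rewrite /s -exprM; apply: ler_weXn2l; first exact: ltW.
by rewrite abszM absz_nat mulnC leq_mul2r leqnSn orbT.
Qed.

(** With its mirror image below, this turns small values of [w] into the premise of an almost
    monotonicity clause. *)
Lemma rho2_eq1 w : (forall n, 1 <= w n) ->
  (forall l : R, 1 < l -> exists n : nat, w n%:Z < l ^+ n) -> rho2 w = 1.
Proof.
move=> w1 small; have w0 n : 0 <= w n by rewrite (le_trans ler01).
have rootE (n : int) : 0 < n -> w n `^ (n%:~R)^-1 = w n `^ ((absz n)%:R)^-1.
  by case: n.
have lb1 : lbound [set w n `^ (n%:~R)^-1 | n in [set n : int | 0 < n]] 1.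
  move=> _ [n /= n0 <-]; rewrite rootE// powR_root_ge ?expr1n//.
  by rewrite absz_gt0 gt_eqF.
have ne : [set w n `^ (n%:~R)^-1 | n in [set n : int | 0 < n]] !=set0.
  by exists (w 1 `^ (1%:~R)^-1), 1.
apply/le_anti/andP; split; last by apply: lb_le_inf.
apply/ler_addgt0Pr => e e0; have [|n hn] := small (1 + e); first by rewrite ltrDl.
have n0 : (0 < n)%N.
  by rewrite lt0n; apply/eqP => n0; move: hn; rewrite n0 expr0 ltNge w1.
apply: (@le_trans _ _ (w n%:Z `^ (n%:Z%:~R)^-1)).
  by apply: ge_inf; [exists 1|exists n%:Z].
rewrite rootE// absz_nat powR_root_le//; first exact: ltW.
by rewrite addr_ge0// ltW.
Qed.

(** For [n < 0] the exponent [1 / n] inverts the root of order [|n|], so small values of [w] push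
    the supremum up to 1, through [(1 + e)^-1 >= 1 - e]. *)
Lemma rho1_eq1 w : (forall n, 1 <= w n) ->
  (forall l : R, 1 < l -> exists n : nat, w (- n%:Z) < l ^+ n) -> rho1 w = 1.
Proof.
move=> w1 small; have w0 n : 0 <= w n by rewrite (le_trans ler01).
have rootE (n : int) : n < 0 -> w n `^ (n%:~R)^-1 = (w n `^ ((absz n)%:R)^-1)^-1.
  by case: n => // m _; rewrite -powRN -invrN.
have ub1 : ubound [set w n `^ (n%:~R)^-1 | n in [set n : int | n < 0]] 1.
  move=> _ [n /= n0 <-]; rewrite rootE// invf_le1; last first.
    by rewrite powR_gt0// (lt_le_trans ltr01).
  by rewrite powR_root_ge ?expr1n// absz_gt0 lt_eqF.
have ne : [set w n `^ (n%:~R)^-1 | n in [set n : int | n < 0]] !=set0.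
  by exists (w (-1) `^ ((-1)%:~R)^-1), (-1).
apply/le_anti/andP; split; first by apply: ge_sup.
apply/ler_addgt0Pr => e e0; have [|n hn] := small (1 + e); first by rewrite ltrDl.
have n0 : (0 < n)%N.
  by rewrite lt0n; apply/eqP => n0; move: hn; rewrite n0 expr0 ltNge w1.
have nn : - n%:Z < 0 by rewrite oppr_lt0.
apply: (@le_trans _ _ (w (- n%:Z) `^ ((- n%:Z)%:~R)^-1 + e)); last first.
  by rewrite lerD2r; apply: ub_le_sup; [exists 1|exists (- n%:Z)].
have e1 : 0 < 1 + e by rewrite addr_gt0.
have root_gt0 : 0 < w (- n%:Z) `^ (n%:R)^-1 by rewrite powR_gt0// (lt_le_trans ltr01).
rewrite rootE// abszN absz_nat -lerBlDr.
apply: (@le_trans _ _ (1 + e)^-1).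
  by rewrite -[(1 + e)^-1]mul1r ler_pdivlMr//; have := sqr_ge0 e; rewrite expr2; nra.
by rewrite lef_pV2 ?posrE// powR_root_le//; exact: ltW.
Qed.

Lemma sumle_seq (s : seq int) x : (forall n, 0 <= x n) ->
  (forall n, n \notin s -> x n = 0) -> sumle x (\sum_(k <- s) x k).
Proof.
elim: s x => [|k s IH] x x0 xs.
  rewrite big_nil (@eq_sumle _ _ _ (fun=> 0)); first exact: sumle0.
  by move=> n; rewrite xs.
pose y n := if n == k then 0 else x n.
have y0 n : 0 <= y n by rewrite /y; case: ifP.
have hy : sumle y (\sum_(j <- s) y j).
  apply: IH => // n ns; rewrite /y; case: ifP => // nk.
  by apply: xs; rewrite inE nk.
have hk := @sumle_single R _ k (fun n => if n == k then x n else 0).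
rewrite /= eqxx in hk.
have {}hk : sumle (fun n => if n == k then x n else 0) (x k).
  by apply: hk => // i /negPf ->.
rewrite big_cons; have := sumleD _ _ hk hy.
move=> H; apply: le_sumle (H _ y0).
- by move=> n; rewrite /y; case: ifP; rewrite ?addr0 ?add0r.
- by rewrite lerD2l; apply: ler_sum => j _; rewrite /y; case: ifP.
- by move=> n; case: ifP.
Qed.

Lemma sumr_subset (s s' : seq int) x : (forall n, 0 <= x n) -> uniq s -> uniq s' ->
  {subset s <= s'} -> \sum_(k <- s) x k <= \sum_(k <- s') x k.
Proof.
move=> x0; elim: s s' => [|k s IH] s' /=; first by move=> *; rewrite big_nil sumr_ge0.
move=> /andP[ks us] us' sub.
rewrite big_cons [leRHS](big_rem k) /=; last exact/sub/mem_head.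
rewrite lerD2l; apply: IH => //; first exact: rem_uniq.
move=> j js; rewrite mem_rem_uniq// inE sub ?inE ?js ?orbT// andbT.
by apply: contraNneq ks => <-.
Qed.

Lemma sumle_zrange x t : (forall n, 0 <= x n) ->
  (forall N, \sum_(k <- zrange N) x k <= t) -> sumle x t.
Proof.
move=> x0 h; apply: sumle_fsetP => s.
pose N := (\sum_(k <- s) absz k).+1.
apply: le_trans (h N); apply: sumr_subset; [exact: x0|exact: fset_uniq|exact: uniq_zrange|].
move=> k ks; apply: mem_zrange; rewrite ltnS /N.
by rewrite (big_rem k)//= leq_addr.
Qed.

Lemma big_iota (F : nat -> R) N : \sum_(j <- iota 0 N) F j = \sum_(i < N) F i.
Proof. by rewrite -[N in iota _ N]subn0 -/(index_iota 0 N) big_mkord. Qed.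

Lemma sumle_halves x (tR tL : R) : (forall n, 0 <= x n) ->
  (forall N, \sum_(i < N) x i%:Z <= tR) -> (forall N, \sum_(i < N) x (- i.+1%:Z) <= tL) ->
  sumle x (tR + tL).
Proof.
move=> x0 hR hL; apply: sumle_zrange => // N.
rewrite /zrange big_cat !big_map /=.
by rewrite !big_iota lerD.
Qed.

End OneSidedGrowth.

(** * Weights on a half-line *)

Section Gluing.
Context {R : realType}.
Implicit Types (V P : nat -> R) (w nu : int -> R) (p q s : R).

(* Half of a weight: what is needed to glue two halves into an almost monotone algebra
   weight, [s] being an upper bound for the exponential growth rate. *)
Record profile q s P : Prop := Profile {
  profile_ge1 : forall n, 1 <= P n;
  profileM : forall m n, P (m + n)%N <= P m * P n;
  profile_mono : exists2 K, 1 <= K & forall m n, P m <= K * P (m + n)%N;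
  profile_conv : exists2 C, 0 <= C & forall k,
    \sum_(i < k.+1) P (k - i)%N `^ (- q) * P i `^ (- q) <= C * P k `^ (- q);
  profile_summable : exists t, forall N, \sum_(i < N) P i `^ (- q) <= t;
  profile_rate : forall l : R, 1 < l -> exists2 M, 0 < M & forall n, P n <= M * s ^+ n * l ^+ n
}.

Lemma sum_inv_sqr N : \sum_(i < N) ((i.+1%:R) ^+ 2)^-1 <= 2 :> R.
Proof.
case: N => [|N]; first by rewrite big_ord0.
(* Strengthened so that the induction telescopes. *)
suff H : \sum_(i < N.+1) ((i.+1%:R) ^+ 2)^-1 <= 2 - (N.+1%:R)^-1 :> R.
  by apply: le_trans H _; rewrite gerBl.
elim: N => [|N IH]; first by rewrite big_ord1 expr1n invr1; lra.
rewrite big_ord_recr /=; apply: le_trans (lerD IH (lexx _)) _.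
have a0 : 0 < N.+1%:R :> R by [].
have -> : N.+2%:R = N.+1%:R + 1 :> R by rewrite -natr1.
set a := N.+1%:R in a0 *.
rewrite -subr_ge0.
have -> : 2 - (a + 1)^-1 - (2 - a^-1 + ((a + 1) ^+ 2)^-1) = (a * (a + 1) ^+ 2)^-1.
  by field; rewrite !gt_eqF//; lra.
by rewrite invr_ge0 mulr_ge0 ?sqr_ge0 ?ltW.
Qed.

Lemma ler_powRN (x y q : R) : 0 <= q -> 0 < x -> x <= y -> y `^ (- q) <= x `^ (- q).
Proof.
move=> q0 x0 xy; have y0 := lt_le_trans x0 xy.
by rewrite !powRN lef_pV2 ?posrE ?powR_gt0// ge0_ler_powR// nnegrE ltW.
Qed.

(** With [l = t^4] and [d = t - 1], Bernoulli gives [t^n >= 1 + n d], whose square exceeds [n + 1]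
    once [n d^2 >= 1]; squaring again gives the claim. *)
Lemma sqr_small (l : R) : 1 < l -> exists n : nat, n.+1%:R ^+ 2 < l ^+ n.
Proof.
move=> l1; pose t := l `^ 4^-1.
have l0 : 0 <= l by rewrite (le_trans ler01)// ltW.
have tl : t ^+ 4 = l.
  by rewrite -powR_mulrn ?powR_ge0// -powRrM mulVf ?powRr1// pnatr_eq0.
have t1 : 1 < t.
  have : 1 `^ 4^-1 < t by apply: gt0_ltr_powR; rewrite ?nnegrE ?invr_gt0.
  by rewrite powR1.
pose d := t - 1; have d0 : 0 < d by rewrite subr_gt0.
have [n nd] : exists n : nat, 1 <= n%:R * d ^+ 2.
  exists (Num.truncn (d ^+ 2)^-1).+1.
  rewrite -ler_pdivrMr ?exprn_gt0// div1r; apply/ltW; exact: truncnS_gt.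
exists n; have -> : l ^+ n = ((t ^+ n) ^+ 2) ^+ 2.
  by rewrite -tl -!exprM; congr (_ ^+ _); lia.
have h := bernoulli n (ltW t1); rewrite -/d in h.
have n1 : 0 < n%:R :> R.
  rewrite lt_neqAle ler0n andbT; apply/eqP => n0.
  by move: nd; rewrite -n0 mul0r ler10.
have nd0 : 0 < n%:R * d by rewrite mulr_gt0.
rewrite -(natr1 n); set m := n%:R in nd h n1 nd0 *.
rewrite ltr_pXn2r ?nnegrE ?exprn_ge0 ?powR_ge0 ?addr_ge0 ?(ltW n1)//.
apply: (@lt_le_trans _ _ ((1 + m * d) ^+ 2)).
  have : m * 1 <= m * (m * d ^+ 2) by rewrite ler_pM2l.
  by rewrite !expr2; nra.
by rewrite ler_pXn2r ?nnegrE ?exprn_ge0 ?powR_ge0//; lra.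
Qed.

(** For [s^n] alone the [k + 1] terms of the convolution are all equal and no constant bounds their
    sum. With the square factor, [(i + j + 1)^2 <= 4 (i + 1)^2] for the larger index [i], which
    leaves the summable [(j + 1)^-2] for the smaller one. *)
Lemma profile_polyexp q s : 1 <= q -> 1 <= s -> profile q s (fun n => s ^+ n * n.+1%:R ^+ 2).
Proof.
move=> q1 s1; have q0 : 0 <= q by rewrite (le_trans ler01).
have sn n : 1 <= s ^+ n by rewrite exprn_ege1.
have sn0 n : 0 < s ^+ n by rewrite (lt_le_trans ltr01).
pose b (n : nat) : R := n.+1%:R ^+ 2.
have b1 n : 1 <= b n by rewrite /b exprn_ege1// ler1n.
have b0 n : 0 < b n by rewrite (lt_le_trans ltr01).
have bmono m n : (m <= n)%N -> b m <= b n.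
  by move=> mn; rewrite /b ler_pXn2r ?nnegrE// ler_nat ltnS.
have bM m n : b (m + n)%N <= b m * b n.
  by rewrite /b -exprMn ler_pXn2r ?nnegrE// -natrM ler_nat; nia.
have P1 n : 1 <= s ^+ n * b n by rewrite -[1]mulr1 ler_pM.
have P0 n : 0 < s ^+ n * b n by rewrite mulr_gt0.
have bq n : (b n) `^ (- q) <= (n.+1%:R ^+ 2)^-1.
  rewrite -/(b n) -powR_inv1 ?(ltW (b0 n))//; apply: ler_powR => //; lra.
split.
- exact: P1.
- move=> m n; rewrite exprD [leRHS]mulrACA; apply: ler_wpM2l; first by rewrite mulr_ge0// ltW.
  exact: bM.
- exists 1 => // m n; rewrite mul1r; apply: ler_pM; rewrite ?(ltW (sn0 _)) ?(ltW (b0 _))//.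
    by apply: ler_weXn2l => //; exact: leq_addr.
  by apply: bmono; exact: leq_addr.
(* [4^q] comes from comparing [i + j] with the larger index; the other 4 is twice the bound 2 on the
   sum of inverse squares, since either index may be the smaller. *)
- exists (4 `^ q * 4) => [|k]; first by rewrite mulr_ge0 ?powR_ge0.
  pose B (i : nat) : R := (i.+1%:R ^+ 2)^-1.
  have B0 i : 0 <= B i by rewrite invr_ge0 sqr_ge0.
  have E4 Z : 0 <= Z -> 4 `^ q * (4 * Z) `^ (- q) = Z `^ (- q).
    by move=> Z0; rewrite powRM// mulrA (powRN 4) divff ?mul1r// gt_eqF// powR_gt0.
  have step i j : (j <= i)%N -> (s ^+ i * b i) `^ (- q) * (s ^+ j * b j) `^ (- q) <=
      4 `^ q * (s ^+ (i + j) * b (i + j)%N) `^ (- q) * B j.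
    move=> ji.
    have h : s ^+ (i + j) * b (i + j)%N * b j <= 4 * ((s ^+ i * b i) * (s ^+ j * b j)).
      have -> : 4 * (s ^+ i * b i * (s ^+ j * b j)) = s ^+ (i + j) * (4 * b i) * b j.
        by rewrite exprD; ring.
      apply: ler_wpM2r; first exact: ltW.
      apply: ler_wpM2l; first exact: ltW.
      have -> : 4 * b i = (2 * i.+1%:R) ^+ 2 by rewrite exprMn; congr (_ * _); ring.
      by rewrite /b ler_pXn2r ?nnegrE ?mulr_ge0// -natrM ler_nat; lia.
    rewrite -powRM ?(ltW (P0 _))//.
    apply: (@le_trans _ _ (4 `^ q * (4 * ((s ^+ i * b i) * (s ^+ j * b j))) `^ (- q))).
      by rewrite E4// mulr_ge0// ltW.
    rewrite -[leRHS]mulrA; apply: ler_wpM2l; first exact: powR_ge0.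
    apply: le_trans (ler_powRN q0 _ h) _; first exact: mulr_gt0.
    rewrite (powRM _ (ltW (P0 _)) (ltW (b0 _))); apply: ler_wpM2l; first exact: powR_ge0.
    exact: bq.
  have pw k' : 0 <= (s ^+ k' * b k') `^ (- q) by exact: powR_ge0.
  have term (i : 'I_k.+1) : (s ^+ (k - i) * b (k - i)%N) `^ (- q) * (s ^+ i * b i) `^ (- q) <=
      4 `^ q * (s ^+ k * b k) `^ (- q) * (B i + B (k - i)%N).
    have ik : (i <= k)%N by rewrite -ltnS.
    have [h|/ltnW h] := leqP i (k - i).
      apply: le_trans (step _ _ h) _; rewrite subnK//.
      by rewrite ler_wpM2l ?mulr_ge0 ?powR_ge0// lerDl.
    rewrite mulrC; apply: le_trans (step _ _ h) _; rewrite subnKC//.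
    by rewrite ler_wpM2l ?mulr_ge0 ?powR_ge0// lerDr.
  apply: le_trans (ler_sum (index_enum 'I_k.+1) (fun i _ => term i)) _.
  rewrite -mulr_sumr big_split /= [leRHS]mulrAC.
  apply: ler_wpM2l; first by rewrite mulr_ge0 ?powR_ge0.
  have -> : \sum_(i < k.+1) B (k - i)%N = \sum_(i < k.+1) B i.
    rewrite (reindex_inj rev_ord_inj) /=; apply: eq_bigr => i _; congr B.
    by have := ltn_ord i; lia.
  have := sum_inv_sqr k.+1; rewrite -/(B _) => h.
  have -> : 4 = 2 + 2 :> R by lra.
  exact: lerD.
- exists 2 => N; apply: le_trans (sum_inv_sqr N); apply: ler_sum => i _.
  apply: le_trans (bq i); apply: ler_powRN => //.
  by rewrite -/(b i); apply: ler_peMl => //; exact: ltW.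
- move=> l l1.
  have [M M0 hM] := subexp_of_small b1 bM sqr_small l1.
  by exists M => // n; rewrite -/(b n) mulrAC [leRHS]mulrC ler_wpM2l// ltW.
Qed.

End Gluing.

(** * Gluing two half-line weights *)

Section GluedWeights.
Context {R : realType}.
Implicit Types (V P : nat -> R) (w nu : int -> R) (p q s : R).

(** The convolution over a half-line is a part of the one over Z, so its constant is 1; [e] selects
    the half-line. *)
Lemma profile_weight q w (e : int) : 0 <= q -> weight w ->
  (forall n, (nonneg_conv (fun k => w k `^ (- q))%R (fun k => w k `^ (- q))%R n
     <= (w n `^ (- q))%:E)%E) ->
  (\esum_(n in [set: int]) (w n `^ (- q))%:E < +oo)%E ->
  e = 1 \/ e = -1 ->
  (exists2 K, 0 < K & forall m n : nat, w (m%:Z * e) <= K * w ((m + n)%:Z * e)) ->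
  (forall l : R, 1 < l -> exists n : nat, w (n%:Z * e) < l ^+ n) ->
  profile q 1 (fun n => w (n%:Z * e)).
Proof.
move=> q0 [w1 wM] wc ws e1 [K K0 hK] small.
have einj : injective (fun i : nat => i%:Z * e).
  by move=> i j; case: e1 => ->; lia.
have wq0 n : 0 <= w n `^ (- q) by exact: powR_ge0.
have VM m n : w ((m + n)%:Z * e) <= w (m%:Z * e) * w (n%:Z * e).
  by rewrite PoszD mulrDl; exact: wM.
split.
- by move=> n; exact: w1.
- exact: VM.
- exists (K + 1) => [|m n]; first by rewrite lerDr ltW.
  apply: le_trans (hK m n) _; rewrite ler_wpM2r ?lerDl//.
  by rewrite (le_trans ler01).
- exists 1 => // k; rewrite mul1r.
  have h : sumle (fun m => w (k%:Z * e - m) `^ (- q) * w m `^ (- q)) (w (k%:Z * e) `^ (- q)).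
    exact: wc.
  pose s : seq int := [seq i%:Z * e | i <- iota 0 k.+1].
  have us : uniq s by rewrite map_inj_uniq// iota_uniq.
  have := sumle_uniq us (fun n => mulr_ge0 (wq0 _) (wq0 n)) h.
  rewrite big_map big_iota.
  apply: le_trans; rewrite le_eqVlt; apply/orP; left; apply/eqP.
  apply: eq_bigr => i _; congr (w _ `^ _ * _).
  by have := ltn_ord i; case: e1 => ->; lia.
- have [t ht] := (esum_lt_pinfty wq0).1 ws; exists t => N.
  pose s : seq int := [seq i%:Z * e | i <- iota 0 N].
  have us : uniq s by rewrite map_inj_uniq// iota_uniq.
  have := sumle_uniq us wq0 ht.
  by rewrite big_map big_iota.
- move=> l l1; have [M M0 hM] := subexp_of_small (fun n => w1 (n%:Z * e)) VM small l1.
  by exists M => // n; rewrite expr1n mulr1.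
Qed.

Definition two_sided P V (n : int) : R := if 0 <= n then P (absz n) else V (absz n).

(** For equal signs the halves are submultiplicative. For opposite signs [m + n] lies on the side of
    one argument and is no larger in modulus, so almost monotonicity bounds it and [c] absorbs
    [K]. *)
Lemma glue_submult P V c K :
  (forall n, 1 <= P n) -> (forall n, 1 <= V n) ->
  (forall m n, P (m + n)%N <= P m * P n) -> (forall m n, V (m + n)%N <= V m * V n) ->
  (forall m n, P m <= K * P (m + n)%N) -> (forall m n, V m <= K * V (m + n)%N) ->
  1 <= c -> K <= c ->
  forall m n, c * two_sided P V (m + n) <= (c * two_sided P V m) * (c * two_sided P V n).
Proof.
move=> P1 V1 PM VM PK VK c1 Kc m n.
have c0 : 0 <= c by rewrite (le_trans ler01).
have P0 k : 0 <= P k by rewrite (le_trans ler01).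
have V0 k : 0 <= V k by rewrite (le_trans ler01).
rewrite -mulrA; apply: ler_wpM2l => //.
wlog mn : m n / n <= m.
  move=> H; have [/H//|/ltW/H] := leP n m.
  by rewrite addrC (_ : two_sided P V n * _ = two_sided P V m * (c * two_sided P V n))//; ring.
have cle x y : 0 <= x -> 0 <= y -> x <= K * y -> forall z, 1 <= z -> x <= c * (y * z).
  move=> x0 y0 h z z1; apply: le_trans h _; rewrite mulrA.
  apply: (@le_trans _ _ (c * y)); first exact: ler_wpM2r.
  by apply: ler_peMr => //; exact: mulr_ge0.
have one x y : 0 <= y -> x <= y -> x <= c * y.
  by move=> y0 h; apply: le_trans h _; exact: ler_peMl.
rewrite /two_sided mulrCA; case: (leP 0 m) => m0; case: (leP 0 n) => n0.
- have -> : 0 <= m + n by lia.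
  have -> : absz (m + n) = (absz m + absz n)%N by lia.
  by apply: one; [exact: mulr_ge0|exact: PM].
- case: (leP 0 (m + n)) => mn0.
    apply: cle => //; have := PK (absz (m + n)) (absz n).
    by have -> : (absz (m + n)%R + absz n)%N = absz m by lia.
  rewrite [P _ * _]mulrC; apply: cle => //; have := VK (absz (m + n)) (absz m).
  by have -> : (absz (m + n)%R + absz m)%N = absz n by lia.
- by exfalso; lia.
- have -> : 0 <= m + n = false by apply/negbTE; rewrite -ltNge; lia.
  have -> : absz (m + n) = (absz m + absz n)%N by lia.
  by apply: one; [exact: mulr_ge0|exact: VM].
Qed.

Lemma glue_summable q P V sP sV : profile q sP P -> profile q sV V ->
  exists T, sumle (fun n => two_sided P V n `^ (- q)) T.
Proof.
move=> [_ _ _ _ [tP hP] _] [_ _ _ _ [tV hV] _]; exists (tP + tV).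
apply: sumle_halves => [n||N]; [exact: powR_ge0|exact: hP|].
(* The negative half starts at index 1, so [V 0] is split off from one longer sum. *)
apply: le_trans (hV N.+1); rewrite big_ord_recl /=.
apply: (@le_trans _ _ (\sum_(i < N) V (lift ord0 i) `^ (- q))).
  by apply: ler_sum => i _; rewrite /two_sided.
by rewrite lerDr powR_ge0.
Qed.

(** For [m] between 0 and [k] the sum is a half-line convolution. Otherwise [m] or [k - m] lies
    beyond [k] on the same side, its factor is at most [K v k], and the other factor is summable. *)
Lemma glue_conv q P V sP sV : 0 <= q -> profile q sP P -> profile q sV V ->
  exists2 C, 0 <= C & forall k : int,
    sumle (fun m => two_sided P V (k - m) `^ (- q) * two_sided P V m `^ (- q)) (C * two_sided P V k `^ (- q)).
Proof.
move=> q0 prP prV; have [T hv] := glue_summable prP prV; move: prP prV.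
move=> [P1 PM [KP KP1 hKP] [CP CP0 hCP] _ _] [V1 VM [KV KV1 hKV] [CV CV0 hCV] _ _].
pose v n := two_sided P V n `^ (- q).
have v0 n : 0 <= v n by exact: powR_ge0.
have gt0P n : 0 < P n by rewrite (lt_le_trans ltr01).
have gt0V n : 0 < V n by rewrite (lt_le_trans ltr01).
have T0 : 0 <= T := sumle_ge0 v0 hv.
pose K := KP `^ q + KV `^ q.
have Kq k : 1 <= k -> 1 <= k `^ q.
  by move=> k1; rewrite -(powRr0 k); apply: ler_powR.
have K1 : 1 <= K by rewrite /K; have := Kq _ KP1; have := Kq _ KV1; lra.
have monoP m n : P (m + n)%N `^ (- q) <= K * P m `^ (- q).
  have KP0 : 0 < KP by rewrite (lt_le_trans ltr01).
  have : P m / KP <= P (m + n)%N by rewrite ler_pdivrMr// mulrC.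
  move=> /(ler_powRN q0) h; apply: le_trans (h _) _; first exact: divr_gt0.
  rewrite powRM ?invr_ge0 ?(ltW KP0) ?(ltW (gt0P _))// powR_inv ?(ltW KP0)// opprK mulrC.
  by apply: ler_wpM2r; rewrite ?powR_ge0// lerDl powR_ge0.
have monoV m n : V (m + n)%N `^ (- q) <= K * V m `^ (- q).
  have KV0 : 0 < KV by rewrite (lt_le_trans ltr01).
  have : V m / KV <= V (m + n)%N by rewrite ler_pdivrMr// mulrC.
  move=> /(ler_powRN q0) h; apply: le_trans (h _) _; first exact: divr_gt0.
  rewrite powRM ?invr_ge0 ?(ltW KV0) ?(ltW (gt0V _))// powR_inv ?(ltW KV0)// opprK mulrC.
  by apply: ler_wpM2r; rewrite ?powR_ge0// lerDr powR_ge0.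
have K0 : 0 <= K := le_trans ler01 K1.
exists (K * (2 * T) + (CP + CV)) => [|k].
  exact: addr_ge0 (mulr_ge0 K0 (mulr_ge0 (ler0n _ 2) T0)) (addr_ge0 CP0 CV0).
(* For [k < 0] the endpoints are excluded: there [m] or [k - m] is 0, where the glued weight is
   [P 0] and not [V 0]. *)
pose inside (m : int) := if 0 <= k then 0 <= m <= k else k < m < 0.
pose chi m := if inside m then v (k - m) * v m else 0.
have chi0 m : 0 <= chi m by rewrite /chi; case: ifP => // _; exact: mulr_ge0.
rewrite -/(v k).
have Kv0 : 0 <= K * v k := mulr_ge0 K0 (v0 k).
have far m : ~~ inside m -> v (k - m) * v m <= K * v k * (v (k - m) + v m).
  move=> out.
  suff [h|h] : v (k - m) <= K * v k \/ v m <= K * v k.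
  - rewrite mulrDr; apply: le_trans (ler_wpM2r (v0 m) h) _.
    by rewrite lerDr; exact: mulr_ge0 Kv0 (v0 _).
  - rewrite mulrDr mulrC; apply: le_trans (ler_wpM2r (v0 _) h) _.
    by rewrite lerDl; exact: mulr_ge0 Kv0 (v0 _).
  rewrite /inside in out; rewrite /v /two_sided; move: out.
  have [k0|k0] := leP 0 k => out.
    have [m0|m0] := leP 0 m.
      right; have := monoP (absz k) (absz m - absz k)%N.
      by have -> : (absz k + (absz m - absz k))%N = absz m by lia.
    left; have -> : 0 <= k - m by lia.
    have := monoP (absz k) (absz m).
    by have -> : (absz k + absz m)%N = absz (k - m) by lia.
  have [m0|m0] := leP 0 m.
    left; have -> : 0 <= k - m = false by apply/negbTE; rewrite -ltNge; lia.
    have := monoV (absz k) (absz m).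
    by have -> : (absz k + absz m)%N = absz (k - m) by lia.
  right; have := monoV (absz k) (absz m - absz k)%N.
  by have -> : (absz k + (absz m - absz k))%N = absz m by lia.
have hchi : sumle chi ((CP + CV) * v k).
  have [k0|k0] := leP 0 k.
    pose s : seq int := [seq i%:Z | i <- iota 0 (absz k).+1].
    apply: (@le_sumle _ _ _ chi (\sum_(m <- s) chi m)) => //; last first.
      apply: sumle_seq => // m ms; rewrite /chi ifF//; apply/negP.
      rewrite /inside k0 => /andP[m0 mk]; move: ms; apply/negP; rewrite negbK.
      by apply/mapP; exists (absz m); [rewrite mem_iota; lia|lia].
    rewrite big_map big_iota; apply: (@le_trans _ _ (CP * v k)); last first.
      by rewrite ler_wpM2r// lerDl.
    have := hCP (absz k); have <- : v k = P (absz k) `^ (- q) by rewrite /v /two_sided k0.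
    apply: le_trans; apply: ler_sum => i _; rewrite /chi; have ik := ltn_ord i.
    rewrite ifT; last by rewrite /inside k0; lia.
    rewrite /v /two_sided /=; have -> : 0 <= k - i%:Z by lia.
    by have -> : absz (k - i%:Z) = (absz k - i)%N by lia.
  pose s : seq int := [seq - i%:Z | i <- iota 0 (absz k).+1].
  apply: (@le_sumle _ _ _ chi (\sum_(m <- s) chi m)) => //; last first.
    apply: sumle_seq => // m ms; rewrite /chi ifF//; apply/negP.
    rewrite /inside leNgt k0 /= => /andP[m0 mk]; move: ms; apply/negP; rewrite negbK.
    by apply/mapP; exists (absz m); [rewrite mem_iota; lia|lia].
  rewrite big_map big_iota; apply: (@le_trans _ _ (CV * v k)); last first.
    by rewrite ler_wpM2r// lerDr.
  have := hCV (absz k); have <- : v k = V (absz k) `^ (- q) by rewrite /v /two_sided leNgt k0.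
  apply: le_trans; apply: ler_sum => i _; rewrite /chi; have ik := ltn_ord i.
  case: ifP => [|_]; last by rewrite mulr_ge0 ?powR_ge0.
  rewrite /inside leNgt k0 /= => ins.
  rewrite /v /two_sided; have -> : 0 <= k - - i%:Z = false by apply/negbTE; rewrite -ltNge; lia.
  have -> : 0 <= - i%:Z = false by apply/negbTE; rewrite -ltNge; lia.
  have -> : absz (k - - i%:Z) = (absz k - i)%N by lia.
  by rewrite abszN absz_nat.
have hfar : sumle (fun m => K * v k * (v (k - m) + v m)) (K * v k * (T + T)).
  apply: sumleZ; [exact: Kv0|by move=> m; rewrite addr_ge0|].
  by apply: sumleD => //; rewrite sumle_reflect.
apply: (@le_sumle _ _ _ (fun m => K * v k * (v (k - m) + v m) + chi m)
  (K * v k * (T + T) + (CP + CV) * v k)); last first.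
- by apply: sumleD => // m; exact: mulr_ge0 Kv0 (addr_ge0 (v0 _) (v0 _)).
- by rewrite le_eqVlt; apply/orP; left; apply/eqP; ring.
- move=> m; rewrite -/(v m) -/(v (k - m)) /chi; case: ifP => [_|/negbT/far out].
    by rewrite lerDr; exact: mulr_ge0 Kv0 (addr_ge0 (v0 _) (v0 _)).
  by rewrite addr0.
Qed.

End GluedWeights.

(** * Weights adapted to a given weight and a given element *)

Section WeightConstruction.
Context {R : realType}.
Implicit Types (V P : nat -> R) (w nu : int -> R) (p q s : R).

Lemma glued_weight p P V sP sV : 1 < p ->
  profile (conjugate_index p) sP P -> profile (conjugate_index p) sV V ->
  0 <= sP -> 0 <= sV ->
  exists2 c, 1 <= c & almost_monotone_algebra_weight p (fun n => c * two_sided P V n) /\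
    tempered (fun n => c * two_sided P V n) (two_sided (fun n => sP ^+ n) (fun n => sV ^+ n)).
Proof.
move=> p1; have [q0 _] := conjugate_indexP p1; set q := conjugate_index p in q0 *.
move=> prP prV sP0 sV0.
have [C C0 hC] := glue_conv (ltW q0) prP prV.
have [T hT] := glue_summable prP prV.
have [P1 PM [KP KP1 hKP] _ _ rP] := prP; have [V1 VM [KV KV1 hKV] _ _ rV] := prV.
pose D := C `^ q^-1; have D0 : 0 <= D by exact: powR_ge0.
(* [KP + KV] serves submultiplicativity. [D^q = C] gives [c^q >= C]: the convolution carries
   [c^(-2q)] against [c^(-q)] on the right, and the spare factor absorbs [C]. *)
pose c := KP + KV + D.
have KP0 := le_trans ler01 KP1; have KV0 := le_trans ler01 KV1.
have c1 : 1 <= c by rewrite /c; lra.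
have c0 : 0 < c by rewrite (lt_le_trans ltr01).
have glue1 n : 1 <= two_sided P V n by rewrite /two_sided; case: ifP.
have glue0 n : 0 <= two_sided P V n by rewrite (le_trans ler01).
have cC : C <= c `^ q.
  have -> : C = D `^ q by rewrite /D -powRrM mulVf ?gt_eqF// powRr1.
  by apply: ge0_ler_powR; rewrite ?nnegrE ?(ltW q0)// /c; lra.
have hKP' m n : P m <= (KP + KV) * P (m + n)%N.
  apply: le_trans (hKP m n) _; rewrite ler_wpM2r ?lerDl//; exact: le_trans ler01 _.
have hKV' m n : V m <= (KP + KV) * V (m + n)%N.
  apply: le_trans (hKV m n) _; rewrite ler_wpM2r ?lerDr//; exact: le_trans ler01 _.
pose cq := c `^ (- q); have cq0 : 0 < cq by rewrite powR_gt0.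
have uE n : (c * two_sided P V n) `^ (- q) = cq * two_sided P V n `^ (- q).
  by rewrite powRM// ltW.
exists c => //; split; first split.
- split=> [n|m n]; first by rewrite -[1]mulr1 ler_pM.
  by apply: glue_submult hKP' hKV' c1 _ m n => //; rewrite /c; lra.
- split=> [n|].
    rewrite /nonneg_conv uE.
    have := sumleZ (ltW (mulr_gt0 cq0 cq0)) _ (hC n).
    rewrite /sumle => H; apply: (@le_trans _ _ ((cq * cq * (C * two_sided P V n `^ (- q)))%:E)).
      apply: le_trans (H _); last by move=> m; rewrite mulr_ge0 ?powR_ge0.
      by apply: le_esum => m _; rewrite lee_fin !uE le_eqVlt; apply/orP; left; apply/eqP; ring.
    rewrite lee_fin mulrA; apply: ler_wpM2r; first exact: powR_ge0.
    rewrite -mulrA -[leRHS]mulr1; apply: ler_wpM2l; first exact: ltW.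
    rewrite /cq powRN mulrC ler_pdivrMr ?mul1r//; exact: powR_gt0.
  apply/esum_lt_pinfty => [n|]; first exact: powR_ge0.
  exists (cq * T); rewrite (@eq_sumle _ _ _ (fun n => cq * two_sided P V n `^ (- q))).
    by apply: sumleZ => // [|n]; [exact: ltW|exact: powR_ge0].
  by move=> n; rewrite uE.
- move=> _; exists KV => [|n k n0 k0]; first by rewrite (lt_le_trans ltr01).
  have [nk absnk] : n + k < 0 /\ absz (n + k) = (absz n + absz k)%N.
    by move: n0 k0; clear; lia.
  rewrite mulrCA; apply: ler_wpM2l; first exact: ltW.
  by rewrite /two_sided (leNgt 0 n) (leNgt 0 (n + k)) n0 nk /= absnk; exact: hKV.
- move=> _; exists KP => [|n k n0 k0]; first by rewrite (lt_le_trans ltr01).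
  have [nk absnk] : 0 <= n + k /\ absz (n + k) = (absz n + absz k)%N.
    by move: n0 k0; clear; lia.
  rewrite mulrCA; apply: ler_wpM2l; first exact: ltW.
  by rewrite /two_sided n0 nk absnk; exact: hKP.
- move=> l l1; have [MP MP0 hMP] := rP l l1; have [MV MV0 hMV] := rV l l1.
  have l0 k : 0 <= l ^+ k by rewrite exprn_ge0// (le_trans ler01)// ltW.
  exists (c * (MP + MV)) => [|n]; first by rewrite mulr_gt0// addr_gt0.
  rewrite -!mulrA; apply: ler_wpM2l; first exact: ltW.
  rewrite mulrA /two_sided; case: ifP => _.
    apply: le_trans (hMP _) _; apply: ler_wpM2r => //; apply: ler_wpM2r; first exact: exprn_ge0.
    by rewrite lerDl ltW.
  apply: le_trans (hMV _) _; apply: ler_wpM2r => //; apply: ler_wpM2r; first exact: exprn_ge0.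
  by rewrite lerDr ltW.
Qed.

(** A smaller exponent has a larger conjugate index; with the ratio [r >= 1], a sum of [r]-th powers
    is at most the [r]-th power of the sum. Hence a weight built for [p 0] serves every [p n]. *)
Lemma almost_monotone_exponent p p0 nu : 1 < p -> p <= p0 ->
  almost_monotone_algebra_weight p0 nu -> almost_monotone_algebra_weight p nu.
Proof.
move=> p1 pp0 [wnu [wc ws] m1 m2].
have p01 := lt_le_trans p1 pp0.
have [q0 _] := conjugate_indexP p1; have [q00 _] := conjugate_indexP p01.
have qq : conjugate_index p0 <= conjugate_index p.
  have pp : 0 < p by rewrite (lt_trans _ p1).
  have pp0' : 0 < p0 by rewrite (lt_trans _ p01).
  rewrite /conjugate_index lef_pV2 ?posrE ?subr_gt0 ?invf_lt1// lerD2l lerN2.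
  by rewrite lef_pV2 ?posrE.
set q := conjugate_index p in q0 qq *; set q' := conjugate_index p0 in q00 qq wc ws *.
pose r := q / q'.
have r1 : 1 <= r by rewrite /r ler_pdivlMr// mul1r.
have uE n : nu n `^ (- q) = (nu n `^ (- q')) `^ r.
  by rewrite -powRrM /r mulNr mulrC divfK// gt_eqF.
split => //; split=> [n|].
  have := @sumle_powR R int r (fun m => nu (n - m) `^ (- q') * nu m `^ (- q')) (nu n `^ (- q')) r1.
  rewrite /sumle => H; rewrite /nonneg_conv uE; apply: le_trans (H _ (wc n)).
    by apply: le_esum => m _; rewrite !uE powRM ?powR_ge0.
  by move=> m; rewrite mulr_ge0 ?powR_ge0.
have [t ht] := (esum_lt_pinfty (fun n => powR_ge0 (nu n) (- q'))).1 ws.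
apply/esum_lt_pinfty => [n|]; first exact: powR_ge0.
exists (t `^ r); rewrite (eq_sumle _ uE).
by apply: sumle_powR => // n; exact: powR_ge0.
Qed.

(** Where [w] grows exponentially its almost monotonicity clause is silent, and [(n + 1)^2] takes
    its place; elsewhere the rate is 1, the clause applies, and [w] itself is kept. *)
Lemma side_profile p w (e : int) : 1 < p -> almost_monotone_algebra_weight p w ->
  e = 1 \/ e = -1 -> exists2 P, profile (conjugate_index p) 1 P &
    exists2 K, 0 < K & forall n : nat, P n <= K * w (n%:Z * e).
Proof.
move=> p1 [[w1 wM] [wc ws] m1 m2] e1.
have [q0 pq] := conjugate_indexP p1; set q := conjugate_index p in q0 pq wc ws *.
have q1 : 1 <= q.
  have p0 : 0 < p^-1 by rewrite invr_gt0 (lt_trans _ p1).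
  have q1' : q^-1 <= 1 by rewrite -[X in _ <= X]pq lerDr ltW.
  by have := ler_wpM2r (ltW q0) q1'; rewrite mulVf ?gt_eqF// mul1r.
have w0 n : 0 <= w n by rewrite (le_trans ler01).
have [[S S1 hS]|small] := exponential_or_small (fun n : nat => w1 (n%:Z * e)).
  have pr := profile_polyexp q1 (lexx 1).
  exists (fun n => 1 ^+ n * n.+1%:R ^+ 2) => //.
  have [M M0 hM] := profile_rate pr S1; exists M => // n.
  apply: le_trans (hM n) _; rewrite expr1n mulr1; apply: ler_wpM2l => //; exact: ltW.
exists (fun n => w (n%:Z * e)); last by exists 1 => // n; rewrite mul1r.
apply: (profile_weight (ltW q0) _ wc ws e1 _ small) => //.
case: e1 small => -> small.
  have [|K K0 hK] := m2 _.
    by apply: rho2_eq1 => // l /small[n]; rewrite mulr1; exists n.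
  by exists K => // m n; rewrite !mulr1 PoszD; exact: hK.
have [|K K0 hK] := m1 _.
  by apply: rho1_eq1 => // l /small[n]; rewrite mulrN1; exists n.
(* The clause speaks of strictly negative arguments: [w 0] takes care of [m = 0] and 1 of
   [n = 0]. *)
have K1 : 0 < K + w 0 + 1 by have := w0 0; lra.
have big x y : 0 <= x -> y <= K + w 0 + 1 -> y * x <= (K + w 0 + 1) * x.
  by move=> x0 yK; exact: ler_wpM2r.
exists (K + w 0 + 1) => // m n; have w00 := w0 0.
rewrite !mulrN1; have [->|m0] := posnP m.
  rewrite oppr0 add0n; apply: (@le_trans _ _ (w 0 * w (- n%:Z))); first exact: ler_peMr.
  by apply: big => //; lra.
have [->|n0] := posnP n.
  by rewrite addn0; apply: ler_peMl => //; lra.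
apply: (@le_trans _ _ (K * w (- (m + n)%:Z))); last by apply: big => //; lra.
rewrite PoszD opprD; apply: hK; lia.
Qed.

Lemma sumle_geometric (r : R) : 0 <= r -> r < 1 ->
  sumle (fun n : int => r ^+ absz n) (2 / (1 - r)).
Proof.
move=> r0 r1.
have rp : 0 < 1 - r by rewrite subr_gt0.
have geo N : \sum_(i < N) r ^+ i <= (1 - r)^-1.
  suff -> : \sum_(i < N) r ^+ i = (1 - r ^+ N) / (1 - r).
    by rewrite ler_pdivrMr// mulVf ?gt_eqF// gerBl exprn_ge0.
  elim: N => [|N IH]; first by rewrite big_ord0 expr0 subrr mul0r.
  by rewrite big_ord_recr /= IH exprS; field; rewrite gt_eqF.
have -> : 2 / (1 - r) = (1 - r)^-1 + (1 - r)^-1 by field; rewrite gt_eqF.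
apply: sumle_halves => [n|N|N]; first exact: exprn_ge0.
  exact: geo.
apply: le_trans (geo N); apply: ler_sum => i _ /=.
by rewrite exprS; apply: ler_piMl; [exact: exprn_ge0|exact: ltW].
Qed.

(** Membership in lp gives [|u n| <= t / S^|n|] on the exponential side, hence a finite mass [B] at
    the rate [s1 < S]. Interpolating between rate 1, of mass 1/8, and rate [s1] brings the mass
    below 1/4. *)
Lemma small_rate {A : banachAlgType R[i]} (u : int -> A) p w (e : int) (S s1 : R) :
  0 < p -> (forall n, 1 <= w n) -> lpw p w u -> e = 1 \/ e = -1 ->
  (forall n : nat, S ^+ n <= w (n%:Z * e)) -> l1le u (1 / 8) -> 1 < s1 -> s1 < S ->
  exists s, [/\ 1 < s, s <= s1 &
    sumle (fun n => (if 0 <= n * e then s ^+ absz n else 1) * rnorm (u n)) (1 / 4)].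
Proof.
move=> p0 w1 uw e1 hS hu s11 s1S.
have w0 n : 0 <= w n by rewrite (le_trans ler01).
have [t t0 ht] := (lpwP u p0 w0).1 uw.
have S0 : 0 < S by rewrite (lt_trans _ s1S)// (lt_trans ltr01).
have s10 : 0 < s1 by rewrite (lt_trans ltr01).
pose sg s n : R := if 0 <= n * e then s ^+ absz n else 1.
have r0 n := rnorm_ge0 (u n).
have uwt n : rnorm (u n) * w n <= t.
  rewrite leNgt; apply/negP => h.
  have : (rnorm (u n) * w n) `^ p <= t `^ p.
    by apply: (sumle_term (x := fun n => (rnorm (u n) * w n) `^ p)) ht => m; exact: powR_ge0.
  apply/negP; rewrite -ltNge; apply: gt0_ltr_powR => //; rewrite ?nnegrE ?mulr_ge0//; exact: ltW.
have rS0 : 0 <= s1 / S by rewrite divr_ge0 ?ltW.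
have rS1 : s1 / S < 1 by rewrite ltr_pdivrMr// mul1r.
pose B := 1 / 8 + t * (2 / (1 - s1 / S)).
have hB : sumle (fun n => sg s1 n * rnorm (u n)) B.
  have hg := sumleZ (ltW t0) (fun n => exprn_ge0 _ rS0) (sumle_geometric rS0 rS1).
  apply: le_sumle (sumleD r0 _ hu hg) => // [n|n]; last first.
    by rewrite mulr_ge0 ?exprn_ge0// ltW.
  rewrite /sg; case: ifP => [ne|_]; last first.
    by rewrite mul1r lerDl mulr_ge0 ?exprn_ge0// ltW.
  apply: (@le_trans _ _ (t * (s1 / S) ^+ absz n)); last by rewrite lerDr.
  have Sn0 : 0 < S ^+ absz n by rewrite exprn_gt0.
  rewrite expr_div_n mulrCA; apply: ler_wpM2l; first by rewrite exprn_ge0// ltW.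
  rewrite ler_pdivlMr//; apply: le_trans (uwt n).
  apply: ler_wpM2l => //; have := hS (absz n).
  by have -> : (absz n)%:Z * e = n by case: e1 ne => ->; lia.
have sg10 s n : 0 < s -> 0 <= sg s n.
  by move=> s0; rewrite /sg; case: ifP => // _; rewrite exprn_ge0// ltW.
have B0 : 0 <= B.
  by apply: sumle_ge0 hB => n; rewrite mulr_ge0// sg10.
(* Makes [th * B <= 1 / 8], the share granted to the exponential factor. *)
pose th : R := 1 / 8 / (B + 1).
have B1 : 0 < B + 1 by lra.
have th0 : 0 < th by rewrite /th divr_gt0.
have thB : th * B <= 1 / 8.
  by rewrite /th mulrAC ler_pdivrMr// ler_wpM2l//; lra.
have th1 : th <= 1 by rewrite /th ler_pdivrMr//; lra.
pose s := 1 + th * (s1 - 1).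
have s_gt1 : 1 < s by rewrite /s ltrDl mulr_gt0// subr_gt0.
exists s; split => //.
  have h : th * (s1 - 1) <= 1 * (s1 - 1) by apply: ler_wpM2r => //; lra.
  by rewrite /s; lra.
(* convexity of x |-> x^k at s = (1 - th) * 1 + th * s1 *)
have conv_s k : s ^+ k <= 1 - th + th * s1 ^+ k.
  elim: k => [|k IH]; first by rewrite !expr0; lra.
  have a1 : 1 <= s1 ^+ k by rewrite exprn_ege1// ltW.
  rewrite !exprS; apply: le_trans (ler_wpM2l _ IH) _; first by lra.
  rewrite -subr_ge0; set a := s1 ^+ k in a1 *.
  have -> : 1 - th + th * (s1 * a) - s * (1 - th + th * a) =
     th * (1 - th) * ((s1 - 1) * (a - 1)) by rewrite /s; ring.
  by apply: mulr_ge0; apply: mulr_ge0; lra.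
have hth := sumleZ (ltW th0) (fun n => mulr_ge0 (sg10 s1 n s10) (r0 n)) hB.
apply: le_sumle (sumleD r0 _ hu hth) => [n||n].
- rewrite mulrA -[X in X + _]mul1r -mulrDl; apply: ler_wpM2r => //.
  rewrite /sg; case: ifP => _; last by rewrite mulr1 lerDl ltW.
  by apply: le_trans (conv_s _) _; lra.
- by lra.
- by rewrite mulr_ge0 ?(ltW th0)// mulr_ge0// sg10.
Qed.

End WeightConstruction.

(** * The theorem *)

Section Opposite.
Context {R : realType}.

(** Turns right inverses into left ones. Space and norm are unchanged, so l1, the weighted spaces
    and [fourier] are the same over both algebras. *)
Definition opposite (A : banachAlgType R[i]) : Type := A.

HB.instance Definition _ (A : banachAlgType R[i]) :=
  CompleteNormedModule.on (opposite A).

Section OppositeAlgebra.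
Variable A : banachAlgType R[i].
Let omul (x y : opposite A) : opposite A := bmul (y : A) (x : A).
Let omulA : associative omul. Proof. by move=> x y z; rewrite /omul bmulA. Qed.
Let omul1l : left_id (bone : A) omul. Proof. by move=> x; rewrite /omul bmul1r. Qed.
Let omul1r : right_id (bone : A) omul. Proof. by move=> x; rewrite /omul bmul1l. Qed.
Let omulDl : left_distributive omul +%R. Proof. by move=> x y z; rewrite /omul bmulDr. Qed.
Let omulDr : right_distributive omul +%R. Proof. by move=> x y z; rewrite /omul bmulDl. Qed.
Let omulZl (c : R[i]) x y : omul (c *: x) y = c *: omul x y.
Proof. by rewrite /omul bmulZr. Qed.
Let omulZr (c : R[i]) x y : omul x (c *: y) = c *: omul x y.
Proof. by rewrite /omul bmulZl. Qed.
Let norm_omul (x y : opposite A) : `|omul x y| <= `|x| * `|y|.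
Proof. by rewrite mulrC; exact: norm_bmul. Qed.

HB.instance Definition _ := NormedModule_isBanachAlgebra.Build R[i] (opposite A)
  omulA omul1l omul1r omulDl omulDr omulZl omulZr (@bone_neq0 _ A) norm_omul.
End OppositeAlgebra.

(** Substituting [n - m] for [m] exchanges the arguments of the two factors. *)
Lemma conv_opposite (A : banachAlgType R[i]) (f g : int -> A) : l1 f -> l1 g ->
  conv (f : int -> opposite A) g = conv g f.
Proof.
move=> hf hg; apply/funext => n.
rewrite -[RHS](@zsum_reflect _ _ (fun m => bmul (g (n - m)) (f m)) n); last exact: l1_conv_term.
congr (@zsum R A _); apply/funext => m.
by have -> : n - (n - m) = m by rewrite opprB addrC subrK.
Qed.

End Opposite.

(** * The weight for the nonadmissible case *)

Section MainConstruction.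
Context {R : realType}.
Implicit Types (A : banachAlgType R[i]) (w nu sg : int -> R) (p : R).

(** If both half-lines had rate 1, [w] would be tempered relative to 1, hence admissible. *)
Lemma nonadmissible_side p w : almost_monotone_algebra_weight p w -> nonadmissible w ->
  exists e : int, (e = 1 \/ e = -1) /\
    exists2 S : R, 1 < S & forall n : nat, S ^+ n <= w (n%:Z * e).
Proof.
move=> [[w1 wM] _ _ _] nadm.
have w0 n : 0 <= w n by rewrite (le_trans ler01).
have VM e (m n : nat) : w ((m + n)%:Z * e) <= w (m%:Z * e) * w (n%:Z * e).
  by rewrite PoszD mulrDl; exact: wM.
have [h|small1] := exponential_or_small (fun n : nat => w1 (n%:Z * 1)).
  by exists 1; split; [left|].
have [h|small2] := exponential_or_small (fun n : nat => w1 (n%:Z * -1)).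
  by exists (-1); split; [right|].
exfalso; apply: nadm; apply: tempered_admissible => // l l1.
have [M1 M10 hM1] := subexp_of_small (fun n => w1 (n%:Z * 1)) (VM 1) small1 l1.
have [M2 M20 hM2] := subexp_of_small (fun n => w1 (n%:Z * -1)) (VM (-1)) small2 l1.
have l0 k : 0 <= l ^+ k by rewrite exprn_ge0// (le_trans ler01)// ltW.
exists (M1 + M2) => [|n]; first exact: addr_gt0.
rewrite mulr1; have [n0|n0] := leP 0 n.
  have {1}-> : n = (absz n)%:Z * 1 by move: n0; clear; lia.
  by apply: le_trans (hM1 _) _; rewrite ler_wpM2r// lerDl ltW.
have {1}-> : n = (absz n)%:Z * -1 by move: n0; clear; lia.
by apply: le_trans (hM2 _) _; rewrite ler_wpM2r// lerDr ltW.
Qed.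

(** The exponential side of [w] is replaced by the rate [s] adapted to [u], and [s > 1] keeps [nu]
    nonadmissible. The other side receives a tempered profile below [w]. The two signs of [e] are
    mirror images. *)
Lemma weight_below A (u : int -> A) p w : 1 < p -> almost_monotone_algebra_weight p w ->
  nonadmissible w -> lpw p w u -> l1le u (1 / 8) ->
  exists nu sg, [/\ almost_monotone_algebra_weight p nu, nonadmissible nu,
    exists2 K, 1 < K & weight_le nu (fun k => K * w k),
    (forall n, 1 <= sg n) /\ (forall m n, sg (m + n) <= sg m * sg n)
    & tempered nu sg /\ sumle (fun n => sg n * rnorm (u n)) (1 / 4)].
Proof.
move=> p1 aw nadm uw hu.
have p0 : 0 < p by apply: lt_trans p1.
have [[w1 wM] _ _ _] := aw.
have w0 n : 0 <= w n by rewrite (le_trans ler01).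
have [e [e1 [S S1 hS]]] := nonadmissible_side aw nadm.
have [s1 [s11 s1S]] : exists s1, 1 < s1 /\ s1 < S by exists ((1 + S) / 2); split; lra.
have s10 : 0 < s1 by rewrite (lt_trans ltr01).
have [s [s_gt1 ss1 hs]] := small_rate p0 w1 uw e1 hS hu s11 s1S.
have s0 : 0 < s by rewrite (lt_trans ltr01).
have e1' : - e = 1 \/ - e = -1 by case: e1 => ->; [right|left]; rewrite ?opprK.
have [Q prQ [KQ KQ0 hKQ]] := side_profile p1 aw e1'.
have [q0 pq] := conjugate_indexP p1.
have q1 : 1 <= conjugate_index p.
  have pv0 : 0 < p^-1 by rewrite invr_gt0.
  have q1' : (conjugate_index p)^-1 <= 1 by rewrite -[X in _ <= X]pq lerDr ltW.
  by have := ler_wpM2r (ltW q0) q1'; rewrite mulVf ?gt_eqF// mul1r.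
have prP := profile_polyexp q1 (ltW s_gt1); set P := (fun n => _) in prP.
have Pge n : s ^+ n <= P n.
  by rewrite /P; apply: ler_peMr; [rewrite exprn_ge0// ltW|rewrite exprn_ege1// ler1n].
(* The gap between [s1] and [S] absorbs the polynomial factor: [(n + 1)^2 <= M (S / s1)^n]. *)
have [M M0 hM] : exists2 M, 0 < M & forall n : nat, P n <= M * w (n%:Z * e).
  have l1 : 1 < S / s1 by rewrite ltr_pdivlMr// mul1r.
  have [M M0 hM] := profile_rate (profile_polyexp q1 (lexx 1)) l1.
  exists M => // n; apply: (@le_trans _ _ (M * S ^+ n)); last by rewrite ler_pM2l.
  have := hM n; rewrite expr1n mul1r mulr1 => hn.
  apply: (@le_trans _ _ (s1 ^+ n * (M * (S / s1) ^+ n))).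
    apply: ler_pM => //; first by rewrite exprn_ge0// ltW.
    by apply: lerXn2r; rewrite // nnegrE ltW.
  have : s1 ^+ n != 0 by rewrite expf_neq0// gt_eqF.
  rewrite expr_div_n; set x := s1 ^+ n; set y := S ^+ n => x0.
  by have -> : x * (M * (y / x)) = M * (y / x * x); [ring|rewrite divfK].
have s1w : 0 <= s by exact: ltW.
pose K0 := M + KQ; have K00 : 0 < K0 by rewrite addr_gt0.
have spow n : 1 <= s ^+ n by rewrite exprn_ege1// ltW.
have smono m n : s ^+ m <= 1 * s ^+ (m + n).
  by rewrite mul1r; apply: ler_weXn2l; [exact: ltW|exact: leq_addr].
have onemono (m n : nat) : (1 : R) ^+ m <= 1 * 1 ^+ (m + n) by rewrite !expr1n mulr1.
have spowM m n : s ^+ (m + n) <= s ^+ m * s ^+ n by rewrite exprD.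
have onepowM (m n : nat) : (1 : R) ^+ (m + n) <= 1 ^+ m * 1 ^+ n by rewrite !expr1n mulr1.
have one1 (n : nat) : 1 <= (1 : R) ^+ n by rewrite expr1n.
case: e1 => ee; rewrite ee in hS hM hs hKQ.
  have [c c1 [anu tnu]] := glued_weight p1 prP prQ s1w ler01.
  have c0 : 0 < c by rewrite (lt_le_trans ltr01).
  exists (fun n => c * two_sided P Q n), (two_sided (fun n => s ^+ n) (fun n => 1 ^+ n)).
  split => //.
  - case: anu => [[nu1 _] _ _ _].
    apply: (admissible_not_exponential nu1 (k := 1) s_gt1) => n.
    rewrite mulr1 /two_sided /=; apply: le_trans (Pge n) _; apply: ler_peMl => //.
    by rewrite (le_trans _ (Pge n))// exprn_ge0.
  - exists (c * K0 + 1) => [|n]; first by rewrite ltrDr mulr_gt0.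
    apply: (@le_trans _ _ (c * K0 * w n)); last by rewrite ler_wpM2r// lerDl.
    rewrite -mulrA; apply: ler_wpM2l; first exact: ltW.
    rewrite /two_sided; have [n0|n0] := leP 0 n.
      have {2}-> : n = (absz n)%:Z * 1 by move: n0; clear; lia.
      by apply: le_trans (hM _) _; rewrite ler_wpM2r// lerDl ltW.
    have {2}-> : n = (absz n)%:Z * -1 by move: n0; clear; lia.
    by apply: le_trans (hKQ _) _; rewrite ler_wpM2r// lerDr ltW.
  - split=> [n|m n]; first by rewrite /two_sided; case: ifP.
    have := glue_submult (K := 1) spow one1 spowM onepowM smono onemono (lexx 1) (lexx 1) m n.
    by rewrite !mul1r.
  - split => //; apply: le_sumle hs => // n; rewrite mulr1 /two_sided.
    by case: ifP; rewrite ?expr1n.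
have [c c1 [anu tnu]] := glued_weight p1 prQ prP ler01 s1w.
have c0 : 0 < c by rewrite (lt_le_trans ltr01).
exists (fun n => c * two_sided Q P n), (two_sided (fun n => 1 ^+ n) (fun n => s ^+ n)).
split => //.
- case: anu => [[nu1 nuM] _ _ _].
  apply: (admissible_not_exponential nu1 (k := -1) s_gt1) => n.
  have [->|n0] := posnP n; first by rewrite expr0.
  have [h1 h2] : (0 <= n%:Z * -1) = false /\ absz (n%:Z * -1) = n.
    by move: n0; clear; lia.
  rewrite /two_sided h1 h2; apply: le_trans (Pge n) _; apply: ler_peMl => //.
  by rewrite (le_trans _ (Pge n))// exprn_ge0.
- exists (c * K0 + 1) => [|n]; first by rewrite ltrDr mulr_gt0.
  apply: (@le_trans _ _ (c * K0 * w n)); last by rewrite ler_wpM2r// lerDl.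
  rewrite -mulrA; apply: ler_wpM2l; first exact: ltW.
  rewrite /two_sided; have [n0|n0] := leP 0 n.
    have {2}-> : n = (absz n)%:Z * - -1 by move: n0; clear; lia.
    by apply: le_trans (hKQ _) _; rewrite ler_wpM2r// lerDr ltW.
  have {2}-> : n = (absz n)%:Z * -1 by move: n0; clear; lia.
  by apply: le_trans (hM _) _; rewrite ler_wpM2r// lerDl ltW.
- split=> [n|m n]; first by rewrite /two_sided; case: ifP.
  have := glue_submult (K := 1) one1 spow onepowM spowM onemono smono (lexx 1) (lexx 1) m n.
  by rewrite !mul1r.
- split => //; apply: le_sumle hs => // n; rewrite /two_sided.
  apply: ler_wpM2r; first exact: rnorm_ge0.
  have [n0|n0] := leP 0 n.
    by rewrite expr1n; case: ifP.
  by rewrite ifT//; move: n0; clear; lia.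
Qed.

End MainConstruction.

(** * Inverses in the intersection of weighted spaces *)

Section InverseInIntersection.
Context {R : realType}.
Implicit Types (A : banachAlgType R[i]) (p : nat -> R) (w nu : nat -> int -> R).

Lemma controlled_type_I_algebra A p w nu : type_I p w -> controlled_weights p w nu ->
  type_I_algebra A p nu.
Proof.
move=> [p1 pS _ _] cw; split; last first.
  by apply: lpw_cap_subalgebra => // n; case: (cw n).
split => // n; first by case: (cw n) => _ [].
by case: (cw n).
Qed.

Lemma trunc_lpw_cap A p w (s : seq int) (h : int -> A) :
  l1_subalgebra A (lpw_cap A p w) -> (forall n, 1 < p n) -> (forall n k, 0 <= w n k) ->
  lpw_cap A p w (trunc s h).
Proof.
move=> [_ _ capD _ _] p1 w0.
have cap1 k a : lpw_cap A p w (single k a).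
  by move=> n _; apply: lpw_single; [exact: lt_trans (p1 n)|exact: w0].
apply: trunc_ind => //; have -> : (fun=> 0) = single 0 (0 : A).
  by apply/funext => n; rewrite /single if_same.
exact: cap1.
Qed.

(** The error 1/8, half of what the Neumann series tolerates, leaves room for the exponential
    factor. *)
Lemma finite_approx_left_inverse A (f h : int -> A) : l1 f -> l1 h ->
  l1le (fun n => delta0 n - conv h f n) (1 / 16) ->
  exists s : seq int, l1le (fun n => delta0 n - conv (trunc s h) f n) (1 / 8).
Proof.
move=> hf hh hE; have /l1P[t ht] := hf; have t0 := l1le_ge0 ht.
have t1 : 0 < t + 1 by rewrite ltr_wpDl.
have [s hs] := l1_trunc hh (divr_gt0 (divr_gt0 ltr01 (ltr0Sn R 15)) t1).
exists s; have htr : l1 (trunc s h).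
  have := l1B hh (l1le_l1 hs); congr l1; apply/funext => n.
  by rewrite opprB addrC subrK.
have -> : (fun n => delta0 n - conv (trunc s h) f n) =
    (fun n => (delta0 n - conv h f n) + conv (fun m => h m - trunc s h m) f n).
  by apply/funext => n; rewrite convBl// addrA subrK.
apply: le_l1le (l1leD hE (l1le_conv hs ht)).
have : 1 / 16 / (t + 1) * t <= 1 / 16 by rewrite mulrAC ler_pdivrMr// ler_wpM2l//; lra.
by lra.
Qed.

(* [conv h f = delta0 - u] with [u] small and in the intersection, so inverting it by a
   Neumann series and composing with [h] gives a left inverse. *)
Lemma left_inverse_from_neumann A p w (s : seq int) (f h g : int -> A) :
  l1_subalgebra A (lpw_cap A p w) -> (forall n, 1 < p n) -> (forall n k, 0 <= w n k) ->
  l1 f -> lpw_cap A p w g -> conv g (conv (trunc s h) f) = delta0 ->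
  exists2 k, lpw_cap A p w k & conv_left_inverse f k.
Proof.
move=> sub p1 w0 hf hg gE; have htr := trunc_lpw_cap s h sub p1 w0.
have [capl1 _ _ _ capM] := sub.
exists (conv g (trunc s h)); first exact: capM.
rewrite /conv_left_inverse -conv_assoc//; exact: capl1.
Qed.

(** Assuming an approximate inverse in l1, and nothing on the transform, covers both Wiener's
    approximation and the exact l1 inverse given in inverse-closedness. *)
Lemma left_inverse_admissible A p w (f h : int -> A) :
  (forall n, 1 < p n) -> (forall n, almost_monotone_algebra_weight (p n) (w n)) ->
  (forall n, admissible (w n)) -> lpw_cap A p w f -> l1 h ->
  l1le (fun n => delta0 n - conv h f n) (1 / 16) ->
  exists2 k, lpw_cap A p w k & conv_left_inverse f k.
Proof.
move=> p1 aw adm fcap hh hE.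
have w1 n k : 1 <= w n k by case: (aw n) => [[]].
have w0 n k : 0 <= w n k by rewrite (le_trans ler01).
have sub := lpw_cap_subalgebra (A := A) p1 aw; have [capl1 cap1 capD capZ capM] := sub.
have hf := capl1 _ fcap.
have [s hs] := finite_approx_left_inverse hf hh hE.
pose u n := delta0 n - conv (trunc s h) f n.
have ucap : lpw_cap A p w u.
  have := capD _ _ cap1 (capZ (-1) _ (capM _ _ (trunc_lpw_cap s h sub p1 w0) fcap)).
  by congr lpw_cap; apply/funext => n; rewrite scaleN1r.
have hu4 : l1le u (1 / 4) by apply: le_l1le hs; lra.
have [g [_ [gu _] gcap]] := neumann hu4.
apply: (left_inverse_from_neumann (s := s) (h := h) (g := g) sub p1 w0 hf).
  move=> n _; apply: (gcap (p n) (w n) (fun=> 1)) => //.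
  - exact: almost_monotone_lp_algebra.
  - by move=> *; rewrite mulr1.
  - exact: admissible_tempered.
  - by under eq_sumle do rewrite mul1r.
  - exact: ucap.
by rewrite -[RHS]gu; congr conv; apply/funext => n; rewrite /u opprB addrC subrK.
Qed.

Lemma left_inverse_controlled A p w (f : int -> A) : type_I p w ->
  (forall n, almost_monotone_algebra_weight (p n) (w n)) ->
  (forall n, admissible (w n)) \/ (forall n, nonadmissible (w n)) -> lpw_cap A p w f ->
  (forall z : R[i], `|z| = 1 -> left_invertible (fourier f z)) ->
  exists2 nu, controlled_weights p w nu &
    exists2 g, lpw_cap A p nu g & conv_left_inverse f g.
Proof.
move=> [p1 pS _ wS] aw dich fcap inv.
have w1 n k : 1 <= w n k by case: (aw n) => [[]].
have w0 n k : 0 <= w n k by rewrite (le_trans ler01).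
have sub := lpw_cap_subalgebra (A := A) p1 aw; have [capl1 cap1 capD capZ capM] := sub.
have hf := capl1 _ fcap.
have [h hh hE] := wiener_approx hf inv (divr_gt0 ltr01 (ltr0Sn R 15)).
case: dich => [adm|nadm].
  exists w; last exact: left_inverse_admissible hh hE.
  move=> n; split; [|exact: aw|by []|by []|exact: wS].
  (* Here [nu = w], but the constant has to exceed 1. *)
  exists 2 => [|k]; first by rewrite ltr1n.
  by rewrite ler_peMl// ler1n.
have [s hs] := finite_approx_left_inverse hf hh hE.
pose u n := delta0 n - conv (trunc s h) f n.
have ucap : lpw_cap A p w u.
  have := capD _ _ cap1 (capZ (-1) _ (capM _ _ (trunc_lpw_cap s h sub p1 w0) fcap)).
  by congr lpw_cap; apply/funext => n; rewrite scaleN1r.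
have hu4 : l1le u (1 / 4) by apply: le_l1le hs; lra.
have [g [_ [gu _] gcap]] := neumann hu4.
have [nu [sg [anu nnu [K K1 hK] [sg1 sgM] [temp husg]]]] :=
  weight_below (p1 0%N) (aw 0%N) (nadm 0%N) (ucap 0%N I) hs.
have pn n : p n <= p 0%N.
  by elim: n => // n IH; exact: le_trans (pS n) IH.
have wn n k : w 0%N k <= w n k.
  by elim: n => // n IH; apply: le_trans IH _; exact: wS.
have anun n := almost_monotone_exponent (p1 n) (pn n) anu.
have nu1 k : 1 <= nu k by case: anu => [[]].
have nu0 k : 0 <= nu k by rewrite (le_trans ler01).
have K0 : 0 <= K by rewrite (le_trans ler01)// ltW.
have hKn n k : nu k <= K * w n k by apply: le_trans (hK k) _; rewrite ler_wpM2l.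
(* A constant family: monotonicity in [n] is an equality. *)
exists (fun=> nu).
  move=> n; split => //; first by exists K.
  by move=> adm; case: (nadm n adm).
have sub' := lpw_cap_subalgebra (A := A) (w := fun=> nu) p1 anun.
apply: (left_inverse_from_neumann (s := s) (h := h) (g := g) sub' p1 (fun=> nu0) hf).
  move=> n _; apply: (gcap (p n) nu sg) => //.
  - exact: almost_monotone_lp_algebra.
  - have pn0 : 0 < p n by apply: lt_trans (p1 n).
    exact: (lpw_le pn0 K0 nu0 (w0 n) (hKn n) (ucap n I)).
by rewrite -[RHS]gu; congr conv; apply/funext => n; rewrite /u opprB addrC subrK.
Qed.

Lemma right_inverse_controlled A p w (f : int -> A) : type_I p w ->
  (forall n, almost_monotone_algebra_weight (p n) (w n)) ->
  (forall n, admissible (w n)) \/ (forall n, nonadmissible (w n)) -> lpw_cap A p w f ->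
  (forall z : R[i], `|z| = 1 -> right_invertible (fourier f z)) ->
  exists2 nu, controlled_weights p w nu &
    exists2 g, lpw_cap A p nu g & conv_right_inverse f g.
Proof.
move=> tI aw dich fcap inv.
have [nu cw [g gcap gf]] := @left_inverse_controlled (opposite A) p w f tI aw dich fcap inv.
exists nu => //; exists g => //.
have [_ [capl1 _ _ _ _]] := controlled_type_I_algebra A tI cw.
have p1 n : 1 < p n by case: tI.
have [fl1 _ _ _ _] := lpw_cap_subalgebra (A := A) p1 aw.
rewrite /conv_right_inverse -(conv_opposite (capl1 _ gcap) (fl1 _ fcap)).
exact: gf.
Qed.

(** [delta0 - S^-1 tau^e] is finitely supported, and its l1 inverse is the geometric series of the
    [S^-n tau^(e n)]. Weighted by [w 0], the coefficients have norm at least 1, so the series lies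
    outside the intersection; inverses in l1 being unique, there is no other candidate. *)
Lemma exponential_not_inverse_closed A p w (e : int) (S : R) :
  (forall n, 1 < p n) -> (forall n, almost_monotone_algebra_weight (p n) (w n)) ->
  e = 1 \/ e = -1 -> 1 < S -> (forall n : nat, S ^+ n <= w 0%N (n%:Z * e)) ->
  ~ inverse_closed (lpw_cap A p w).
Proof.
move=> p1 aw e1 S1 hS [_ invcl].
have p0 n : 0 < p n by apply: lt_trans (p1 n).
have w1 n k : 1 <= w n k by case: (aw n) => [[]].
have w0 n k : 0 <= w n k by rewrite (le_trans ler01).
have sub := lpw_cap_subalgebra (A := A) p1 aw; have [capl1 cap1 capD capZ capM] := sub.
have S0 : 0 < S by rewrite (lt_trans ltr01).
pose r := S^-1; have r0 : 0 <= r by rewrite invr_ge0 ltW.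
have r1 : r < 1 by rewrite invf_lt1.
pose c : R[i] := (r%:C)%C.
pose b : A := bone.
have rn k : rnorm (c ^+ k *: b) = r ^+ k * rnorm b.
  rewrite rnormZ; congr (_ * _); rewrite ger0_norm; first by rewrite /c -rmorphXn.
  by rewrite exprn_ge0// /c ler0c.
pose g (n : int) : A := if 0 <= n * e then c ^+ absz n *: b else 0.
pose f (n : int) : A := delta0 n - c *: single e b n.
have gl1 : l1 g.
  apply: (@l1le_l1 _ _ _ (rnorm b * (2 / (1 - r)))).
  have := sumleZ (rnorm_ge0 b) (fun n => exprn_ge0 _ r0) (sumle_geometric r0 r1).
  apply: le_sumle => // n; rewrite /g; case: ifP => _; first by rewrite rn mulrC.
  by rewrite rnorm0 mulr_ge0 ?rnorm_ge0 ?exprn_ge0.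
have fcap : lpw_cap A p w f.
  have hs : lpw_cap A p w (single e b) by move=> n _; exact: lpw_single (p0 n) (w0 n).
  have := capD _ _ cap1 (capZ (- c) _ hs).
  by congr lpw_cap; apply/funext => n; rewrite scaleNr.
have rec n : g n - c *: g (n - e) = delta0 n.
  rewrite /g /delta0; have [->|n0] := eqVneq n 0.
    have [-> ->] : 0 * e >= 0 /\ ((0 - e) * e >= 0) = false by case: e1 => ->.
    by rewrite scaler0 subr0 expr0 scale1r.
  have [ne|ne] := leP 0 (n * e).
    have [-> ->] : (n - e) * e >= 0 /\ absz n = (absz (n - e)%R).+1.
      by move: n0 ne; case: e1 => ->; clear; lia.
    by rewrite scalerA -exprS subrr.
  have -> : ((n - e) * e >= 0) = false.
    by move: n0 ne; case: e1 => ->; clear; lia.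
  by rewrite scaler0 subr0.
have dl1 := @l1_delta0 R A; have sl1 := @l1_single R A e b.
have csl1 : l1 (fun n => c *: single e b n) by exact: l1Z.
have finv : conv_inverse f g.
  split; apply/funext => n; rewrite -rec.
    by rewrite convBr// conv1r convZr// conv_singler bmul1r.
  by rewrite convBl// conv1l convZl// conv_singlel bmul1l.
have [|g' g'cap [g'f _]] := invcl f fcap; first by exists g.
have gE : g' = g := conv_inverse_unique (capl1 _ fcap) (capl1 _ g'cap) gl1 g'f finv.2.
have [t t0 ht] := (lpwP g (p0 0%N) (w0 0%N)).1 (eq_ind g' (lpw (p 0%N) (w 0%N)) (g'cap 0%N I) g gE).
pose x n := (rnorm (g n) * w 0%N n) `^ p 0%N.
have x0 n : 0 <= x n by exact: powR_ge0.
(* [N] terms, each at least 1, below a bound independent of [N]. *)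
have big N : N%:R <= t `^ p 0%N.
  pose s : seq int := [seq i%:Z * e | i <- iota 0 N].
  have us : uniq s.
    rewrite map_inj_uniq ?iota_uniq// => i j; case: e1 => ->; clear; lia.
  apply: le_trans (sumle_uniq us x0 ht); rewrite big_map big_iota.
  rewrite -[leLHS]mulr1 mulr_natl -[N in leLHS]card_ord -sumr_const.
  apply: ler_sum => i _; rewrite /x /g.
  have [-> ->] : (0 <= i%:Z * e * e) /\ absz (i%:Z * e) = i by case: e1 => ->; clear; lia.
  rewrite rn [leLHS](_ : 1 = 1 `^ p 0%N); last by rewrite powR1.
  apply: ge0_ler_powR.
  - exact: ltW.
  - by rewrite nnegrE.
  - by rewrite nnegrE !mulr_ge0 ?exprn_ge0 ?rnorm_ge0.
  - have h := ler_pM ler01 (exprn_ge0 i (ltW S0)) (@rnorm_bone_ge1 R A) (hS i).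
    rewrite -mulrA; apply: le_trans (ler_wpM2l (exprn_ge0 i r0) h).
    by rewrite mul1r -exprMn /r mulVf ?gt_eqF// expr1n.
have := big (Num.truncn (t `^ p 0%N)).+1.
by apply/negP; rewrite -ltNge; exact: truncnS_gt.
Qed.

End InverseInIntersection.

Theorem theorem7p2 (R : realType) (A : banachAlgType R[i])
    (p : nat -> R) (w : nat -> int -> R)
    (typeI_w : type_I p w)
    (amon_w : forall n, almost_monotone_algebra_weight (p n) (w n))
    (dich_w : (forall n, admissible (w n)) \/ (forall n, nonadmissible (w n))) :
  (forall f : int -> A, lpw_cap A p w f ->
    [/\ (forall z : R[i], `|z| = 1 -> left_invertible (fourier f z)) ->
          exists nu : nat -> int -> R,
            [/\ controlled_weights p w nu,
                exists2 g, lpw_cap A p nu g & conv_left_inverse f g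
              & type_I_algebra A p nu],
        (forall z : R[i], `|z| = 1 -> right_invertible (fourier f z)) ->
          exists nu : nat -> int -> R,
            [/\ controlled_weights p w nu,
                exists2 g, lpw_cap A p nu g & conv_right_inverse f g
              & type_I_algebra A p nu]
      & (forall z : R[i], `|z| = 1 -> invertible (fourier f z)) ->
          exists nu : nat -> int -> R,
            [/\ controlled_weights p w nu,
                exists2 g, lpw_cap A p nu g & conv_inverse f g
              & type_I_algebra A p nu]])
  /\
  (inverse_closed (lpw_cap A p w) <->
     forall n, admissible (w n) /\ almost_monotone_algebra_weight (p n) (w n)).
Proof.
have p1 n : 1 < p n by case: typeI_w.
have sub := lpw_cap_subalgebra (A := A) p1 amon_w; have [capl1 _ _ _ _] := sub.
split=> [f fcap|].
  have linv := left_inverse_controlled typeI_w amon_w dich_w fcap.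
  have rinv := right_inverse_controlled typeI_w amon_w dich_w fcap.
  split=> inv.
  - have [nu cw hg] := linv inv; exists nu.
    by split; [exact: cw|exact: hg|exact: controlled_type_I_algebra typeI_w cw].
  - have [nu cw hg] := rinv inv; exists nu.
    by split; [exact: cw|exact: hg|exact: controlled_type_I_algebra typeI_w cw].
  - have [|nu cw [g gcap gf]] := linv.
      by move=> z /inv[b [ba _]]; exists b.
    have [|nu' cw' [g' g'cap fg']] := rinv.
      by move=> z /inv[b [_ ab]]; exists b.
    have tI := controlled_type_I_algebra A typeI_w cw.
    have tI' := controlled_type_I_algebra A typeI_w cw'.
    (* The two weight families may differ, but both inverses lie in l1, where they coincide; the
       family of the left inverse is kept. *)
    have gg' : g = g'.
      apply: (conv_inverse_unique (capl1 _ fcap) _ _ gf fg').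
        by case: tI => _ [h _ _ _ _]; exact: h.
      by case: tI' => _ [h _ _ _ _]; exact: h.
    exists nu; split; [exact: cw| |exact: tI].
    by exists g; [exact: gcap|split; [exact: gf|rewrite gg'; exact: fg']].
split=> [invcl n|adm].
  split; last exact: amon_w.
  case: dich_w => [adm|nadm]; first exact: adm.
  have [e [e1 [S S1 hS]]] := nonadmissible_side (amon_w 0%N) (nadm 0%N).
  by case: (exponential_not_inverse_closed p1 amon_w e1 S1 hS invcl).
split=> // f fcap [g gl1 [gf fg]].
have [||h hcap hf] := left_inverse_admissible p1 amon_w _ fcap gl1.
- by move=> n; case: (adm n).
(* The l1 inverse is an approximate left inverse with error 0. *)
- have -> : (fun n => delta0 n - conv g f n) = (fun=> 0 : A).
    by apply/funext => n; rewrite gf subrr.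
  by apply: le_sumle (@sumle0 R int) => // n; rewrite rnorm0.
exists h => //; split => //.
by rewrite (conv_inverse_unique (capl1 _ fcap) (capl1 _ hcap) gl1 hf fg).
Qed.
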